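(* Let $p \in [2,\infty)$ and let $q$ be defined by $\frac1p + \frac1q = 1$. Let \[ K = \{ (x,y,z)^T \in \mathbb R^3 \mid z \geq -x^{1/p}y^{1/q},\ x \geq 0,\ y \geq 0\}, \] and let $F$ be the canonical potential of $K$. For $\xi > 0$ define \[ t(\xi) = \frac{1-\xi}{\sqrt{\xi + p + q - 1}+\sqrt{p+q}}\left(\frac{\sqrt{\xi + p + q - 1}+\sqrt{p+q-1}}{\sqrt{\xi + p + q - 1}-\sqrt{p+q-1}}\right)^{\frac{\sqrt{p+q-1}}{\sqrt{p+q}}} \left(\sqrt{\xi + p + q - 1}+\sqrt{q-1}\right)^{-\frac1p}\left(\sqrt{\xi + p + q - 1}+\sqrt{p-1}\right)^{-\frac1q} \] and \[ \phi(\xi) = \log\frac{1+\xi+\frac{\xi^2}{p+q}}{1+\xi\sqrt{1+\frac{\xi-1}{p+q}}} + \log\frac{1-\xi}{t(\xi)}, \] where $\frac{1-\xi}{t(\xi)}$ is extended by continuity to $\xi = 1$. Then the level set $\{F = 0\}$, which is a complete hyperbolic affine sphere asymptotic to $\partial K$, is given by the hypersurface immersion \[ (0,\infty) \times \mathbb R \ni \begin{pmatrix} \xi \\ \mu \end{pmatrix} \mapsto \begin{pmatrix} x \\ y \\ z \end{pmatrix} = e^{\frac{\phi(\xi)}{3}} \begin{pmatrix} e^{\frac{q+1}{3q}\mu} \\ e^{-\frac{p+1}{3p}\mu} \\ e^{-\frac{\mu(p-q)}{3(p+q)}}t(\xi) \end{pmatrix}. \]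
   Context: A convex cone in $\mathbb R^n$ is regular if it is closed, has non-empty interior, and contains no line. The canonical potential of a regular convex cone $K\subset\mathbb R^n$ is the unique smooth solution $F: K^o \to \mathbb R$ ($K^o$ the interior of $K$) of the Monge-Ampère problem $\det F'' = e^{2F}$, $F|_{\partial K} = +\infty$, $F'' \succ 0$, where $F''$ is the Hessian in the standard coordinates and the boundary condition means that $F(x) \to +\infty$ as $x$ tends to a boundary point of $K$. It is known that this solution exists and is unique, and that the complete hyperbolic affine spheres asymptotic to the boundary of $K$ (in the sense of equiaffine differential geometry: convex hypersurfaces whose affine normals all meet at the vertex of $K$, which separate their convex hull from that point, and which are complete in the affine metric) are exactly the level sets of $F$; they are related to each other by homotheties.
   Formalization: The canonical potential is taken to be the logarithmically homogeneous solution, F(λx) = F(x) − 3 log λ for λ > 0, because the stated Monge–Ampère problem with F → +∞ at the boundary points of K does not by itself have a unique solution. *)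

(* Defs.v *)
From HB Require Import structures.
From mathcomp Require Import all_boot all_order all_algebra.
From mathcomp Require Import all_classical all_reals all_analysis.

Set Implicit Arguments.
Unset Strict Implicit.
Unset Printing Implicit Defensive.

Import Order.TTheory GRing.Theory Num.Theory.
Import numFieldNormedType.Exports.

Local Open Scope classical_set_scope.
Local Open Scope ring_scope.

Definition boundary (T : topologicalType) (A : set T) : set T :=
  closure A `\` A°.

(* C^infinity: every iterated directional derivative exists and is (Frechet)
   differentiable at every point of U (U is meant to be open). *)
Definition smooth_on (R : realType) (V W : normedModType R)
    (U : set V) (f : V -> W) : Prop :=
  forall (vs : seq V) (x : V), U x ->
    differentiable (foldr (fun v (g : V -> W) => 'D_v g) f vs) x.

Definition std_basis (R : realType) (n : nat) (i : 'I_n) : 'rV[R]_n :=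
  delta_mx 0 i.

Definition qform (R : realType) (n : nat) (A : 'M[R]_n) (v : 'rV[R]_n) : R :=
  (v *m A *m v^T) 0 0.

Definition posdef (R : realType) (n : nat) (A : 'M[R]_n) : Prop :=
  A^T = A /\ forall v : 'rV[R]_n, v != 0 -> 0 < qform A v.

Definition hessian (R : realType) (n : nat) (F : 'rV[R]_n -> R)
    (x : 'rV[R]_n) : 'M[R]_n :=
  \matrix_(i, j) 'D_(std_basis R i) ('D_(std_basis R j) F) x.

Definition convex_hull (R : realType) (V : lmodType R) (A : set V) : set V :=
  smallest (@convex_set R V) A.

Definition regular_cone (R : realType) (n : nat) (K : set 'rV[R]_n) : Prop :=
  [/\ forall (l : R) x, 0 < l -> K x -> K (l *: x),
      @convex_set R 'rV[R]_n K,
      closed K,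
      K° !=set0
    & ~ exists x v : 'rV[R]_n, v != 0 /\ forall s : R, K (x + s *: v)].

(* F is a smooth solution of det F'' = e^{2F}, F'' > 0 on the interior of K,
   F = +oo on the boundary. *)
Definition monge_ampere_solution (R : realType) (n : nat)
    (K : set 'rV[R]_n) (F : 'rV[R]_n -> R) : Prop :=
  [/\ smooth_on K° F,
      forall x, K° x -> \det (hessian F x) = expR (2 * F x),
      forall x, K° x -> posdef (hessian F x)
    & forall b, boundary K b -> F x @[x --> within K° (nbhs b)] --> +oo].

(* The boundary condition at finite boundary points does not by itself single
   out one solution, because K is unbounded.  On the orthant, for instance,
   - \sum_i ln (sinh (a_i * x_i) / a_i) is a solution for all a_i > 0.
   The solution given by the Cheng-Yau theorem is the logarithmically
   homogeneous one, whose level sets are homothetic to each other: it is the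
   limit of the above as all a_i --> 0, namely - \sum_i ln x_i. *)
Definition log_homogeneous (R : realType) (n : nat)
    (K : set 'rV[R]_n) (F : 'rV[R]_n -> R) : Prop :=
  forall (l : R) x, 0 < l -> K° x -> F (l *: x) = F x - n%:R * ln l.

Definition canonical_potential (R : realType) (n : nat)
    (K : set 'rV[R]_n) (F : 'rV[R]_n -> R) : Prop :=
  monge_ampere_solution K F /\ log_homogeneous K F.

Definition zero_level_set (R : realType) (n : nat)
    (K : set 'rV[R]_n) (F : 'rV[R]_n -> R) : set 'rV[R]_n :=
  [set x | K° x /\ F x = 0].

Definition hypersurface_immersion (R : realType) (n : nat)
    (U : set 'rV[R]_n) (X : 'rV[R]_n -> 'rV[R]_n.+1) : Prop :=
  smooth_on U X /\ forall u, U u -> injective ('d X u).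

(* nu is the affine normal field of the immersion X and h its affine metric
   (the Blaschke structure).  The transversal field nu induces h through the
   Gauss formula X_ij = (tangential part) + h_ij nu; it is determined up to
   sign by the last two conditions: its derivatives are tangential, and the
   volume form det (nu, X_1, ..., X_n) it induces is that of the metric h.
   Positive definiteness of h (local strong convexity) fixes the sign. *)
Definition blaschke_structure (R : realType) (n : nat)
    (U : set 'rV[R]_n) (X nu : 'rV[R]_n -> 'rV[R]_n.+1)
    (h : 'rV[R]_n -> 'M[R]_n) : Prop :=
  smooth_on U nu /\
  forall u, U u ->
    [/\ ~ range ('d X u) (nu u),
        forall i j : 'I_n, range ('d X u)
          ('D_(std_basis R i) ('D_(std_basis R j) X) u - h u i j *: nu u),
        posdef (h u),
        forall v : 'rV[R]_n, range ('d X u) ('D_v nu u)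
      & (\det (col_mx (nu u) ('J X u) : 'M[R]_n.+1)) ^+ 2 = \det (h u)].

Definition C1_curve (R : realType) (n : nat) (U : set 'rV[R]_n)
    (g : R -> 'rV[R]_n) (a b : 'rV[R]_n) : Prop :=
  [/\ forall t : R, derivable g t 1,
      continuous (derive1 g),
      forall t : R, 0 <= t <= 1 -> U (g t),
      g 0 = a
    & g 1 = b].

Definition curve_length (R : realType) (n : nat) (h : 'rV[R]_n -> 'M[R]_n)
    (g : R -> 'rV[R]_n) : \bar R :=
  (\int[@lebesgue_measure R]_(t in `[0%R, 1%R])
      (Num.sqrt (qform (h (g t)) (derive1 g t)))%:E)%E.

(* Every Cauchy sequence for the Riemannian distance of h (the infimum of the
   lengths of curves in U) converges in U. *)
Definition complete_metric (R : realType) (n : nat)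
    (U : set 'rV[R]_n) (h : 'rV[R]_n -> 'M[R]_n) : Prop :=
  forall a : nat -> 'rV[R]_n, (forall k, U (a k)) ->
    (forall e : R, 0 < e -> exists N : nat, forall k m : nat,
        (N <= k)%N -> (N <= m)%N ->
        exists g : R -> 'rV[R]_n,
          C1_curve U g (a k) (a m) /\ (curve_length h g < e%:E)%E) ->
    exists2 l, U l & a @ \oo --> l.

Definition separates (R : realType) (n : nat)
    (S A : set 'rV[R]_n) (o : 'rV[R]_n) : Prop :=
  forall g : R -> 'rV[R]_n, {within `[0%R, 1%R], continuous g} ->
    g 0 = o -> A (g 1) -> exists2 t : R, 0 <= t <= 1 & S (g t).

(* The immersed hypersurface X : U -> R^(n+1) is a complete hyperbolic affine
   sphere with centre o.  The third clause says that X is a convex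
   hypersurface, the fourth that it separates its convex hull from o. *)
Definition complete_hyperbolic_affine_sphere (R : realType) (n : nat)
    (U : set 'rV[R]_n) (X : 'rV[R]_n -> 'rV[R]_n.+1)
    (o : 'rV[R]_n.+1) : Prop :=
  exists (nu : 'rV[R]_n -> 'rV[R]_n.+1) (h : 'rV[R]_n -> 'M[R]_n),
    [/\ blaschke_structure U X nu h,
        forall u, U u -> exists s : R, X u + s *: nu u = o,
        X @` U `<=` boundary (convex_hull (X @` U)),
        separates (X @` U) (convex_hull (X @` U)) o
      & complete_metric U h].

Definition asymptotic_to_boundary (R : realType) (n : nat)
    (S K : set 'rV[R]_n) : Prop :=
  S `<=` K° /\
  forall e : R, 0 < e -> exists M : R, forall x, S x -> M < `|x| ->
    exists2 b, boundary K b & `|x - b| < e.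

Section PowerCone.
Context {R : realType}.
Implicit Types p q xi : R.

Definition power_cone p q : set 'rV[R]_3 :=
  [set v | let x := v 0 0 in let y := v 0 1 in let z := v 0 2 in
     [/\ - (x `^ p^-1 * y `^ q^-1) <= z, 0 <= x & 0 <= y]].

Definition t_fun p q xi : R :=
  let s := Num.sqrt (xi + p + q - 1) in
  let a := Num.sqrt (p + q) in
  let b := Num.sqrt (p + q - 1) in
  (1 - xi) / (s + a) * ((s + b) / (s - b)) `^ (b / a)
  * (s + Num.sqrt (q - 1)) `^ (- p^-1)
  * (s + Num.sqrt (p - 1)) `^ (- q^-1).

Definition ratio_fun p q xi : R :=
  if xi == 1 then lim ((1 - x) / t_fun p q x @[x --> (1 : R)^'])
  else (1 - xi) / t_fun p q xi.

Definition phi_fun p q xi : R :=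
  ln ((1 + xi + xi ^+ 2 / (p + q))
      / (1 + xi * Num.sqrt (1 + (xi - 1) / (p + q))))
  + ln (ratio_fun p q xi).

(* (0, oo) x R, with coordinates xi = u 0 0 and mu = u 0 1 *)
Definition half_plane : set 'rV[R]_2 := [set u | 0 < u 0 0].

Definition sphere_map p q (u : 'rV[R]_2) : 'rV[R]_3 :=
  let xi := u 0 0 in let mu := u 0 1 in
  expR (phi_fun p q xi / 3) *:
    \row_(i < 3) [:: expR ((q + 1) / (3 * q) * mu);
                     expR (- ((p + 1) / (3 * p) * mu));
                     expR (- (mu * (p - q) / (3 * (p + q)))) * t_fun p q xi]`_i.

End PowerCone.

(* Main.v *)
(* In terms of s = sqrt(xi + p + q - 1) the surface X(xi, mu) is elementary, and
   differentiating it twice gives X_ij = Gamma^k_ij X_k + (Q_ij / 3) X with a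
   positive definite form Q such that 3 det Q = det(X, X_1, X_2)^2.  So X is an
   affine sphere: its affine normal is a constant multiple of X and its affine
   metric a constant multiple of Q.

   Neither existence nor uniqueness of the canonical potential is used.  Given
   F, let E = e^(-F/3), which is homogeneous of degree 1 and vanishes on the
   boundary of K, and let l be a linear form that is positive on K \ {0}.  If E
   were not 1 on the surface, the quotient (E - 1) / l would attain a positive
   maximum or a negative minimum c0 on it.  At this point E - 1 - c0 l has an
   extremum along the surface; as l is linear, the Gauss formula turns the
   second derivative test into an inequality between Q / E and the form
   F'' - dF^2 / 3 on the tangent plane.  Since 3 det(F'' - dF^2 / 3) equals
   e^(2F) det(X, X_1, X_2)^2, comparing determinants yields an inequality
   between E and 1 that contradicts the sign of c0.  Hence F = 0 on the
   surface, and as each ray of the interior of K meets the surface, the surface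
   is the whole level set.

   The hull lies in {F <= 0}, which is convex because F'' > 0.  Completeness
   holds because Q dominates a multiple of d phi^2 + d mu^2 and phi maps (0, oo)
   onto R. *)

Require Import Defs.
From mathcomp Require Import all_boot all_order all_algebra.
From mathcomp Require Import all_classical all_reals all_analysis.
From mathcomp Require Import ring lra.
Import Order.TTheory GRing.Theory Num.Theory.
Import numFieldNormedType.Exports.
Local Open Scope classical_set_scope.
Local Open Scope ring_scope.
Set Implicit Arguments.
Unset Strict Implicit.
Unset Printing Implicit Defensive.

(** * Smoothness and derivative tests *)

(** The surface is not compact, so [E - 1] alone need not attain its extrema. Dividing by l confines
    the parameters. If [(E - 1) / l >= k > 0], homogeneity moves the point to the slice [l = 1],
    where [E >= k] cuts out a compact part of the interior. If [(1 - E) / l >= k > 0], then [E >= 0]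
    gives [l <= 1/k], and on a bounded piece of the surface the product [xyz = t e^phi] keeps [xi]
    and [mu] in a box. The linear correction costs nothing at the extremum. In the second derivative
    the tangential part of the Gauss formula drops out by the first order condition, and the part
    along [X] contributes [c0 l(X) Q/3 = (E - 1) Q/3], so that only [(Q - E (F'' - dF^2/3)) / 3] is
    left. The form [F'' - dF^2/3] is the Schur complement of [F''(X, X) = 3] in the Hessian, which
    is why its determinant is governed by the Monge-Ampère equation. Comparing determinants compares
    [E^-2], from the binary form [Q/E], with [E^-6 = e^(2F)]. *)

Lemma differentiable_near (R : realType) (V W : normedModType R) (f g : V -> W)
    (x : V) :
  {near x, f =1 g} -> differentiable f x -> differentiable g x.
Proof.
move=> fg dfx.
have fgx : f x = g x := nbhs_singleton fg.
have /diff_locallyP [cdf fE] := dfx.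
have gE : g \o shift x = cst (g x) + 'd f x +o_ 0 id.
  apply/eqaddoP => e e0; move/eqaddoP : fE => /(_ e e0) fE.
  have fg0 : \forall h \near (0 : V), f (h + x) = g (h + x).
    by have := fg; rewrite (near_shift 0) /= ; apply: filterS => h /=; rewrite subr0.
  near=> h.
  have H1 : f (h + x) = g (h + x) by near: h.
  suff -> : (g \o shift x - (cst (g x) + 'd f x)) h =
    (f \o shift x - (cst (f x) + 'd f x)) h by near: h.
  by rewrite !fctE /= H1 /cst fgx.
have dgE := diff_unique cdf gE.
apply/diff_locallyP; split; first by rewrite dgE.
by rewrite dgE.
Unshelve. all: by end_near. Qed.

Section IsDerive.
Context {R : realType} {V : normedModType R}.
Implicit Types (f g : V -> R) (x v : V).

(** Reduces directional derivatives to one real variable, so that the one-variable chain rule yields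
    [isd_comp]. *)
Lemma is_derive_line (W : normedModType R) (f : V -> W) x v df :
  is_derive x v f df <-> is_derive (0 : R) 1 (fun t : R => f (x + t *: v)) df.
Proof.
have E : (fun h : R => h^-1 *: ((f \o shift x) (h *: v) - f x)) =
    (fun h : R => h^-1 *: (((fun t : R => f (x + t *: v)) \o shift 0) (h *: (1 : R))
       - f (x + 0 *: v))).
  apply/funext => h /=; rewrite scale0r addr0 addr0 [h *: v + x]addrC.
  by rewrite /GRing.scale /= mulr1.
split=> -[D1 D2]; split.
- by move: D1; rewrite /derivable E.
- by move: D2; rewrite /derive E.
- by move: D1; rewrite /derivable E.
- by move: D2; rewrite /derive E.
Qed.

Lemma isd_cst (c : R) x v : is_derive x v (fun _ => c) 0.
Proof. exact: is_derive_cst. Qed.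

Lemma isd_add f g x v df dg : is_derive x v f df -> is_derive x v g dg ->
  is_derive x v (fun u => f u + g u) (df + dg).
Proof. by move=> ? ?; exact: is_deriveD. Qed.

Lemma isd_opp f x v df : is_derive x v f df -> is_derive x v (fun u => - f u) (- df).
Proof. by move=> ?; exact: is_deriveN. Qed.

Lemma isd_mul f g x v df dg : is_derive x v f df -> is_derive x v g dg ->
  is_derive x v (fun u => f u * g u) (f x * dg + g x * df).
Proof. by move=> ? ?; exact: is_deriveM. Qed.

Lemma isd_comp (h : R -> R) f x v dh df : is_derive (f x) 1 h dh ->
  is_derive x v f df -> is_derive x v (fun u => h (f u)) (dh * df).
Proof.
move=> Dh /is_derive_line Df; apply/is_derive_line.
apply: (@is_derive1_comp _ h (fun t : R => f (x + t *: v))) => //.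
by rewrite scale0r addr0.
Qed.

Lemma isd_exp f x v df : is_derive x v f df ->
  is_derive x v (fun u => expR (f u)) (expR (f x) * df).
Proof. by move=> Df; apply: isd_comp. Qed.

Lemma isd_ln f x v df : 0 < f x -> is_derive x v f df ->
  is_derive x v (fun u => ln (f u)) ((f x)^-1 * df).
Proof. by move=> f0 Df; apply: isd_comp => //; exact: is_derive1_ln. Qed.

Lemma isd_inv f x v df : f x != 0 -> is_derive x v f df ->
  is_derive x v (fun u => (f u)^-1) (- (f x) ^- 2 * df).
Proof.
move=> f0 Df; apply: (@isd_comp (fun y => y^-1)) => //.
apply: is_derive_eq; first by apply: is_deriveV => //; exact: is_derive_id.
by rewrite /GRing.scale /= mulr1.
Qed.

Lemma isd_near (W : normedModType R) (f g : V -> W) x v (df : W) (U : set V) :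
  open U -> U x -> (forall u, U u -> f u = g u) ->
  is_derive x v f df -> is_derive x v g df.
Proof.
move=> oU Ux fg; apply: near_eq_is_derive.
by apply: filterS (open_nbhs_nbhs (conj oU Ux)).
Qed.

Lemma is_derive_unique (W : normedModType R) (f : V -> W) x v (d1 d2 : W) :
  is_derive x v f d1 -> is_derive x v f d2 -> d1 = d2.
Proof. by move=> [_ <-] [_ <-]. Qed.

End IsDerive.

Lemma is_derive_continuous (R : realType) (f : R -> R) (x df : R) :
  is_derive x 1 f df -> {for x, continuous f}.
Proof. by move=> [D _]; apply/differentiable_continuous/derivable1_diffP. Qed.

Lemma is_derive_rowP (R : realType) (V : normedModType R) n (f : V -> 'rV[R]_n)
    (x v : V) (df : 'rV[R]_n) :
  is_derive x v f df <-> forall i, is_derive x v (fun u => f u 0 i) (df 0 i).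
Proof.
split=> [[D1 D2] i|H].
  have D3 : forall i, derivable (fun u => f u 0 i) x v.
    by move=> j; have /derivable_mxP := D1; apply.
  by split; [exact: D3|rewrite -D2 derive_mx // mxE].
have D1 : derivable f x v.
  by apply/derivable_mxP => k j; rewrite (ord1 k); case: (H j).
split => //; rewrite derive_mx //; apply/rowP => i; rewrite mxE.
by case: (H i).
Qed.

Lemma differentiable_row (R : realType) (V : normedModType R) n (f : V -> 'rV[R]_n)
    (x : V) :
  (forall i, differentiable (fun u => f u 0 i) x) -> differentiable f x.
Proof.
move=> H.
rewrite (_ : f = (\sum_(i < n) (fun u => f u 0 i *: (delta_mx 0 i : 'rV[R]_n)))).
  by apply: differentiable_sum => i; apply: differentiableZl.
by apply/funext => u; rewrite fct_sumE {1}(row_sum_delta (f u)).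
Qed.

Section Elementary.
Context {R : realType} {n : nat}.
Implicit Types (U : set 'rV[R]_n) (f g : 'rV[R]_n -> R).

(* [el_ext] lets a function be replaced off [U], where logarithms have junk
   values; the class is closed under directional derivatives ([el_diff]). *)
Inductive elementary U : ('rV[R]_n -> R) -> Prop :=
| el_cst c : elementary U (fun _ => c)
| el_coord i : elementary U (fun u => u 0 i)
| el_add f g : elementary U f -> elementary U g -> elementary U (fun u => f u + g u)
| el_mul f g : elementary U f -> elementary U g -> elementary U (fun u => f u * g u)
| el_exp f : elementary U f -> elementary U (fun u => expR (f u))
| el_ln f : elementary U f -> (forall u, U u -> 0 < f u) ->
    elementary U (fun u => ln (f u))
| el_ext f g : elementary U f -> (forall u, U u -> f u = g u) -> elementary U g.

Lemma el_opp U f : elementary U f -> elementary U (fun u => - f u).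
Proof.
move=> Hf; apply: (el_ext (el_mul (el_cst U (-1)) Hf))  => u _.
by rewrite mulN1r.
Qed.

Lemma el_sub U f g : elementary U f -> elementary U g ->
  elementary U (fun u => f u - g u).
Proof. by move=> Hf Hg; apply: el_add => //; apply: el_opp. Qed.

Lemma el_inv U f : elementary U f -> (forall u, U u -> 0 < f u) ->
  elementary U (fun u => (f u)^-1).
Proof.
move=> Hf f0; apply: el_ext (el_exp (el_opp (el_ln Hf f0))) _ => u Uu /=.
by rewrite expRN lnK // posrE f0.
Qed.

Lemma el_sqrt U f : elementary U f -> (forall u, U u -> 0 < f u) ->
  elementary U (fun u => Num.sqrt (f u)).
Proof.
move=> Hf f0; apply: el_ext (el_exp (el_mul (el_ln Hf f0) (el_cst U 2^-1))) _ => u Uu /=.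
have := f0 _ Uu => fu; apply/esym/eqP.
rewrite -(@eqrXn2 _ 2) ?expR_ge0 ?sqrtr_ge0 // sqr_sqrtr ?ltW // -expRM_natr.
by rewrite -mulrA mulVf ?mulr1 ?lnK // pnatr_eq0.
Qed.

Lemma el_diff U f : open U -> elementary U f ->
  (forall u, U u -> differentiable f u) /\ (forall v, elementary U ('D_v f)).
Proof.
move=> oU; elim=> {f}.
- move=> c; split=> [u _|v]; first exact: differentiable_cst.
  by apply: el_ext (el_cst U 0) _ => u _; rewrite derive_cst.
- move=> i; split=> [u _|v]; first exact: differentiable_coord.
  apply: el_ext (el_cst U (v 0 i)) _ => u _.
  have /is_derive_rowP/(_ i) [_ <- //] := is_derive_id u v.
- move=> f g _ [f1 f2] _ [g1 g2]; split=> [u Uu|v].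
    by apply: differentiableD; [apply: f1|apply: g1].
  apply: el_ext (el_add (f2 v) (g2 v)) _ => u Uu.
  by apply/esym/derive_val; apply: isd_add; apply: derivableP;
    apply: diff_derivable; [apply: f1|apply: g1].
- move=> f g ef [f1 f2] eg [g1 g2]; split=> [u Uu|v].
    by apply: differentiableM; [apply: f1|apply: g1].
  apply: el_ext (el_add (el_mul ef (g2 v)) (el_mul eg (f2 v))) _ => u Uu.
  by apply/esym/derive_val; apply: isd_mul; apply: derivableP;
    apply: diff_derivable; [apply: f1|apply: g1].
- move=> f ef [f1 f2]; split=> [u Uu|v].
    apply: (@differentiable_comp _ _ _ _ f expR); first exact: f1.
    by apply/derivable1_diffP; exact: derivable_expR.
  apply: el_ext (el_mul (el_exp ef) (f2 v)) _ => u Uu.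
  by apply/esym/derive_val; apply: isd_exp; apply: derivableP;
    apply: diff_derivable; apply: f1.
- move=> f ef [f1 f2] f0; split=> [u Uu|v].
    apply: (@differentiable_comp _ _ _ _ f (@ln R)); first exact: f1.
    by apply/derivable1_diffP; case: (is_derive1_ln (f0 _ Uu)).
  apply: el_ext (el_mul (el_inv ef f0) (f2 v)) _ => u Uu.
  apply/esym/derive_val; apply: isd_ln; first exact: f0.
  by apply: derivableP; apply: diff_derivable; apply: f1.
- move=> f g _ [f1 f2] fg.
  have near_fg u : U u -> {near u, f =1 g}.
    by move=> Uu; apply: filterS (open_nbhs_nbhs (conj oU Uu)).
  split=> [u Uu|v]; first exact: differentiable_near (near_fg _ Uu) (f1 _ Uu).
  by apply: el_ext (f2 v) _ => u Uu; apply: near_eq_derive; exact: near_fg.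
Qed.

(** Since the class is stable under ['D_v] on [U], induction on the list of directions keeps the
    coordinates of every iterated derivative elementary. *)
Lemma elementary_smooth_row U m (X : 'rV[R]_n -> 'rV[R]_m) : open U ->
  (forall i, elementary U (fun u => X u 0 i)) -> smooth_on U X.
Proof.
move=> oU HX vs x Ux.
suff H : forall i, elementary U
    (fun u => (foldr (fun v (g : 'rV[R]_n -> 'rV[R]_m) => 'D_v g) X vs) u 0 i).
  by apply: differentiable_row => i; exact: (el_diff oU (H i)).1.
elim: vs => [//|v vs IH] i /=.
set Y := foldr _ _ _ in IH *.
apply: el_ext ((el_diff oU (IH i)).2 v) _ => u Uu.
have DY : derivable Y u v.
  apply/derivable_mxP => k j; rewrite (ord1 k); apply: diff_derivable.
  exact: (el_diff oU (IH j)).1.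
by rewrite derive_mx // mxE.
Qed.

End Elementary.

Section SecondDerivativeTest.
Context {R : realType}.
Variables (f f1 : R -> R) (d2 e : R).
Hypotheses (e0 : 0 < e) (Df : forall t : R, `|t| < e -> is_derive t 1 f (f1 t))
  (Df1 : is_derive (0 : R) 1 f1 d2) (fmax : forall t : R, `|t| < e -> f t <= f 0).

Lemma max_derive1_eq0 : f1 0 = 0.
Proof.
have D0 : is_derive (0 : R) 1 f 0.
  apply: (@derive1_at_max _ f (- e) e).
  - by rewrite ge0_cp ?ltW.
  - move=> t; rewrite in_itv /= -ltr_norml => te.
    by case: (Df te).
  - by rewrite in_itv /= oppr_lt0 e0.
  - by move=> t; rewrite in_itv /= -ltr_norml => te; exact: fmax.
by apply: is_derive_unique D0; apply: Df; rewrite normr0.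
Qed.

(** As [f1 0 = 0], a positive [d2] would make [f1] positive just to the right of 0, and the mean
    value theorem would give a value of [f] above [f 0]. *)
Lemma max_derive2_le0 : d2 <= 0.
Proof.
rewrite leNgt; apply/negP => d20.
have [D1 D2] := Df1.
have : \forall h \near (0 : R)^', 0 < h^-1 *: ((f1 \o shift 0) (h *: (1 : R)) - f1 0).
  by move: D1; rewrite /derivable /= => /cvgr_gt; apply; move: D2; rewrite /derive => ->.
rewrite near_withinE => /nbhs_ballP [r /= r0 Hr].
pose s := Num.min r e / 2.
have m0 : 0 < Num.min r e by rewrite lt_min r0.
have s0 : 0 < s by rewrite divr_gt0.
have mr : Num.min r e <= r by rewrite ge_min lexx.
have me : Num.min r e <= e by rewrite ge_min lexx orbT.
have sr : s < r by rewrite /s; lra.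
have se : s < e by rewrite /s; lra.
have [c] : exists2 c, c \in `]0, s[%R & f s - f 0 = f1 c * (s - 0).
  apply: MVT => //.
    move=> t; rewrite in_itv /= => /andP[t0 ts]; apply: Df.
    by rewrite gtr0_norm // (lt_trans ts).
  apply: derivable_within_continuous => t; rewrite in_itv /= => /andP[t0 ts].
  by case: (@Df t) => //; rewrite ger0_norm // (le_lt_trans ts).
rewrite in_itv /= => /andP[c0 cs] E.
have ce : `|c| < e by rewrite gtr0_norm // (lt_trans cs).
have f1c : 0 < f1 c.
  have /= := Hr c; rewrite /ball /= sub0r normrN gtr0_norm // => /(_ (lt_trans cs sr)).
  move=> /(_ (lt0r_neq0 c0)); rewrite max_derive1_eq0 subr0 addr0 /GRing.scale /= mulr1.
  by rewrite pmulr_rgt0 // invr_gt0.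
have : f s <= f 0 by apply: fmax; rewrite gtr0_norm.
by rewrite -subr_le0 E subr0 leNgt mulr_gt0.
Qed.

End SecondDerivativeTest.

Lemma form2_det_ge0 (R : realType) (a b c : R) :
  (forall v w, 0 <= a * v ^+ 2 + 2 * b * v * w + c * w ^+ 2) ->
  [/\ 0 <= a, 0 <= c & b ^+ 2 <= a * c].
Proof.
move=> H.
have a0 : 0 <= a by have := H 1 0; lra.
have c0 : 0 <= c by have := H 0 1; lra.
split => //.
have [/eqP a1|a1] := boolP (a == 0).
  subst a; suff -> : b = 0 by rewrite mul0r expr0n.
  apply/eqP/negP => /negP b0.
  (* With [a = 0] the form takes the value -1 at this point. *)
  have := H (- (c + 1) / (2 * b)) 1.
  have -> : 2 * b * (- (c + 1) / (2 * b)) = - (c + 1).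
    by rewrite mulrC divfK // mulf_neq0.
  by lra.
have a2 : 0 < a by rewrite lt_neqAle eq_sym a1.
have := H (- b / a) 1.
have -> : a * (- b / a) ^+ 2 + 2 * b * (- b / a) * 1 + c * 1 ^+ 2 = (a * c - b ^+ 2) / a.
  by field.
by rewrite pmulr_lge0 ?invr_gt0 // subr_ge0.
Qed.

(** The increment of the determinant is the determinant of the difference plus the mixed term
    [a C + c A - 2 b B]. The latter is nonnegative because [(b B)^2 <= (a C)(c A)] and the geometric
    mean is at most the arithmetic one. *)
Lemma form2_det_le (R : realType) (a b c a' b' c' : R) :
  (forall v w, 0 <= a * v ^+ 2 + 2 * b * v * w + c * w ^+ 2) ->
  (forall v w, a * v ^+ 2 + 2 * b * v * w + c * w ^+ 2 <=
               a' * v ^+ 2 + 2 * b' * v * w + c' * w ^+ 2) ->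
  a * c - b ^+ 2 <= a' * c' - b' ^+ 2.
Proof.
move=> H1 H2.
have [a0 c0 abc] := form2_det_ge0 H1.
have H3 v w : 0 <= (a' - a) * v ^+ 2 + 2 * (b' - b) * v * w + (c' - c) * w ^+ 2.
  by have := H2 v w; lra.
have [] := form2_det_ge0 H3.
set A := a' - a; set B := b' - b; set C := c' - c => A0 C0 ABC.
have -> : a' * c' - b' ^+ 2 = a * c - b ^+ 2 + (A * C - B ^+ 2) + (a * C + c * A - 2 * b * B).
  by rewrite /A /B /C; ring.
suff : 2 * b * B <= a * C + c * A by lra.
apply: le_trans (ler_norm _) _.
rewrite -(@ler_pXn2r _ 2) ?nnegrE ?normr_ge0 ?addr_ge0 ?mulr_ge0 // real_normK ?num_real //.
have : b ^+ 2 * B ^+ 2 <= (a * c) * (A * C) by apply: ler_pM; rewrite ?sqr_ge0.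
by have := sqr_ge0 (a * C - c * A); lra.
Qed.

Lemma det_mx22E (R : realType) (M : 'M[R]_2) :
  \det M = M 0 0 * M 1 1 - M 0 1 * M 1 0.
Proof.
rewrite (expand_det_row _ 0) !big_ord_recl big_ord0 /= /cofactor !det_mx11 !mxE /=.
(* Cofactor expansion produces lifted ordinals that differ syntactically from numerals; indexing by
   naturals identifies equal entries for [ring]. *)
pose f (i j : nat) := M (inord i) (inord j).
have ME i j : M i j = f i j by rewrite /f !inord_val.
by rewrite !ME /=; ring.
Qed.

Lemma det_mx33E (R : realType) (M : 'M[R]_3) :
  \det M = M 0 0 * (M 1 1 * M 2 2 - M 1 2 * M 2 1)
         - M 0 1 * (M 1 0 * M 2 2 - M 1 2 * M 2 0)
         + M 0 2 * (M 1 0 * M 2 1 - M 1 1 * M 2 0).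
Proof.
rewrite (expand_det_row _ 0) !big_ord_recl big_ord0 /= /cofactor !det_mx22E !mxE /=.
pose f (i j : nat) := M (inord i) (inord j).
have ME i j : M i j = f i j by rewrite /f !inord_val.
by rewrite !ME /=; ring.
Qed.

Lemma isd_id (R : realType) (x : R) : is_derive x 1 (fun u : R => u) 1.
Proof. exact: is_derive_id. Qed.

(** Applies the derivation rules by the syntax of the function, with the derivative left as an
    existential variable to be filled in; nonvanishing and positivity conditions remain as goals.
    [notypeclasses refine] keeps instance search from choosing another derivation, since [is_derive]
    is a class. *)
Ltac der :=
  lazymatch goal with
  | |- is_derive _ _ (fun _ => ?c) _ => exact: isd_cst
  | |- is_derive _ _ (fun u => u) _ => exact: isd_id
  | |- is_derive ?x ?v (fun u => @?f u + @?g u) _ =>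
      notypeclasses refine (@isd_add _ _ f g x v _ _ _ _); cbv beta; der
  | |- is_derive ?x ?v (fun u => - @?f u) _ =>
      notypeclasses refine (@isd_opp _ _ f x v _ _); cbv beta; der
  | |- is_derive ?x ?v (fun u => @?f u * @?g u) _ =>
      notypeclasses refine (@isd_mul _ _ f g x v _ _ _ _); cbv beta; der
  | |- is_derive ?x ?v (fun u => expR (@?f u)) _ =>
      notypeclasses refine (@isd_exp _ _ f x v _ _); cbv beta; der
  | |- is_derive ?x ?v (fun u => ln (@?f u)) _ =>
      notypeclasses refine (@isd_ln _ _ f x v _ _ _); cbv beta; [| der]
  | |- is_derive ?x ?v (fun u => (@?f u)^-1) _ =>
      notypeclasses refine (@isd_inv _ _ f x v _ _ _); cbv beta; [| der]
  | |- is_derive _ _ _ _ => try eassumption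
  end.

Lemma isd_eq (R : realType) (V W : normedModType R) (f : V -> W) (x v : V) (d d' : W) :
  is_derive x v f d -> d = d' -> is_derive x v f d'.
Proof. by move=> ? <-. Qed.

Ltac der_eq := notypeclasses refine (@isd_eq _ _ _ _ _ _ _ _ _ _); [der|cbv beta].

Lemma is_derive_lt (R : realType) (f f1 : R -> R) (c x y : R) :
  (forall z : R, c < z -> is_derive z 1 f (f1 z)) ->
  (forall z : R, c < z -> 0 < f1 z) -> c < x -> x < y -> f x < f y.
Proof.
move=> Df f10 cx xy.
have [z] : exists2 z, z \in `]x, y[%R & f y - f x = f1 z * (y - x).
  apply: MVT => // [z|]; first by rewrite in_itv /= => /andP[xz _]; apply: Df; lra.
  apply: derivable_within_continuous => z; rewrite in_itv /= => /andP[xz _].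
  by case: (Df z) => //; lra.
rewrite in_itv /= => /andP[xz zy] E.
by rewrite -subr_gt0 E mulr_gt0 ?subr_gt0 // f10 //; lra.
Qed.

Lemma is_derive_le (R : realType) (f f1 : R -> R) (c x y : R) :
  (forall z : R, c < z -> is_derive z 1 f (f1 z)) ->
  (forall z : R, c < z -> 0 <= f1 z) -> c < x -> x < y -> f x <= f y.
Proof.
move=> Df f10 cx xy.
have [z] : exists2 z, z \in `]x, y[%R & f y - f x = f1 z * (y - x).
  apply: MVT => // [z|]; first by rewrite in_itv /= => /andP[xz _]; apply: Df; lra.
  apply: derivable_within_continuous => z; rewrite in_itv /= => /andP[xz _].
  by case: (Df z) => //; lra.
rewrite in_itv /= => /andP[xz zy] E.
by rewrite -subr_ge0 E mulr_ge0 ?subr_ge0 ?(ltW xy) // f10 //; lra.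
Qed.

(** * The functions t and phi *)

(* With [g = sqrt (p - 1)], [h = sqrt (q - 1)], [a = sqrt (p + q)],
   [b = sqrt (p + q - 1)] and [s = sqrt (xi + b ^ 2)] one has [p = g a],
   [q = h a] and [1 - xi = (a - s) (a + s)], so that [t = (a - s) e^(- psi)],
   [(1 - xi) / t = (a + s) e^psi] and [e^phi = (s ^ 2 + a s + 1) e^psi / a].
   Below, [tS] and [fS] are t and phi as functions of [s], and [mS] is
   [d phi / d t]. *)
Section Profile.
Context {R : realType}.
Variables g h a b : R.

Record profile_params : Prop := ProfileParams {
  pp_g : 0 < g; pp_h : h = g^-1; pp_a : a = g + h; pp_b : 0 < b;
  pp_b2 : b ^+ 2 = a ^+ 2 - 1 }.

Definition psi (s : R) :=
  b / a * (ln (s - b) - ln (s + b)) + h / a * ln (s + h) + g / a * ln (s + g).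
Definition polP (s : R) := s ^+ 2 + a * s + 1.
Definition psi1 (s : R) :=
  s * (s ^+ 2 + 2 * a * s + b ^+ 2) / (polP s * (s ^+ 2 - b ^+ 2)).
(** [ratW] and [ratV] are, up to sign, what remains of the derivatives of [tS] and [mS] after the
    exponential factor is split off. *)
Definition ratW (s : R) := (3 * s ^+ 2 - b ^+ 2) / (polP s * (s ^+ 2 - b ^+ 2)).
Definition ratV (s : R) :=
  (2 * s ^+ 4 + 4 * a * s ^+ 3 + (1 + 2 * a ^+ 2) * s ^+ 2 - b ^+ 2)
  / (polP s * (s ^+ 2 - b ^+ 2)).
(** In the coordinates phi and mu the form Q of the affine metric will read [ratA dphi^2 - 2 (1 -
    2c) dphi dmu + ratC dmu^2]. *)
Definition ratA (s : R) :=
  ((polP s) ^+ 2 / (s + a) ^+ 2 + (a ^+ 2 - 4) / 3) / (3 * s ^+ 2 - b ^+ 2).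
Definition ratC (s : R) := (3 * s ^+ 2 - b ^+ 2) / (3 * a ^+ 2).
Definition tS (s : R) := (a - s) * expR (- psi s).
Definition mS (s : R) := - (s + a) * expR (psi s).
Definition fS (s : R) := ln (polP s) - ln a + psi s.

Hypothesis pp : profile_params.

Lemma h_gt0 : 0 < h.
Proof. by case: pp => g0 -> _ _ _; rewrite invr_gt0. Qed.

Lemma gh1 : g * h = 1.
Proof. by case: pp => g0 -> _ _ _; rewrite mulfV // gt_eqF. Qed.

Lemma a_ge2 : 2 <= a.
Proof.
have := gh1; have := h_gt0; case: pp => g0 _ -> _ _ h0 E.
by have := sqr_ge0 (g - h); nra.
Qed.

Lemma b_lt_a : b < a.
Proof. by have := a_ge2; case: pp => _ _ _ b0 E; nra. Qed.

Lemma polP_ge1 s : 0 < s -> 1 < polP s.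
Proof. by move=> s0; rewrite /polP; have := a_ge2; nra. Qed.

Lemma polP_gt0 s : 0 < s -> 0 < polP s.
Proof. by move=> /polP_ge1; apply: lt_trans. Qed.

Lemma s2b2_gt0 s : b < s -> 0 < s ^+ 2 - b ^+ 2.
Proof. by case: pp => _ _ _ b0 _ bs; nra. Qed.

Lemma bs_gt0 s : b < s -> 0 < s.
Proof. by apply: lt_trans; case: pp. Qed.

Lemma polPE s : polP s = (s + g) * (s + h).
Proof. by have := gh1; rewrite /polP (pp_a pp) => E; rewrite -E; ring. Qed.

Lemma ratW_num_gt0 s : b < s -> 0 < 3 * s ^+ 2 - b ^+ 2.
Proof. by move=> bs; have := s2b2_gt0 bs; have := sqr_ge0 s; lra. Qed.

Lemma ratW_gt0 s : b < s -> 0 < ratW s.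
Proof.
move=> bs; have s2 := s2b2_gt0 bs; have b0 := pp_b pp.
have P0 : 0 < polP s by apply: polP_gt0; lra.
by rewrite divr_gt0 ?mulr_gt0 //; nra.
Qed.

(** The coefficients [b/a], [h/a], [g/a] in [psi] are the residues in the partial fraction expansion
    of [psi1], whose poles are [b], [-b], [-h] and [-g]. *)
Lemma is_derive_psi s : b < s -> is_derive s 1 psi (psi1 s).
Proof.
move=> bs; have b0 := pp_b pp; have g0 := pp_g pp; have h0 := h_gt0; have a2 := a_ge2.
have s2 := s2b2_gt0 bs.
rewrite /psi /psi1; der_eq; try lra.
have -> : b / a * ((s - b)^-1 * (1 + 0) + - ((s + b)^-1 * (1 + 0))) +
   (ln (s - b) - ln (s + b)) * 0 = 2 * b ^+ 2 / (a * (s ^+ 2 - b ^+ 2)).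
  by field; rewrite (gt_eqF s2) /= !gt_eqF //; lra.
rewrite polPE.
have s2' : s ^+ 2 - b ^+ 2 != 0 by rewrite gt_eqF.
have g' : g != 0 by rewrite gt_eqF.
have a' : g * g + 1 != 0 by rewrite gt_eqF //; nra.
have sh' : s * g + 1 != 0 by rewrite gt_eqF //; nra.
have sg' : s + g != 0 by rewrite gt_eqF //; lra.
(* From here everything is expressed in [s] and [g] alone; [s2''] is the denominator [s^2 - b^2]
   multiplied by [g^2], the form in which [field] asks for it. *)
move: s2'; rewrite (pp_b2 pp) (pp_a pp) (pp_h pp) => s2'.
have s2'' : (s * g) ^+ 2 - ((g * g + 1) ^+ 2 + -1 * g ^+ 2) != 0.
  apply: contra_neq s2' => E.
  have -> : s ^+ 2 - ((g + g^-1) ^+ 2 - 1) =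
     ((s * g) ^+ 2 - ((g * g + 1) ^+ 2 + -1 * g ^+ 2)) / (g * g) by field.
  by rewrite E mul0r.
by field; rewrite g' s2'' sh' sg' a'.
Qed.

Lemma rat_nonzero s : b < s ->
  [/\ polP s != 0, s ^+ 2 - (a ^+ 2 - 1) != 0, a != 0, s + a != 0
    & 3 * s ^+ 2 - (a ^+ 2 - 1) != 0].
Proof.
move=> bs; have s0 := bs_gt0 bs; have a2 := a_ge2.
rewrite -(pp_b2 pp) (gt_eqF (polP_gt0 s0)) (gt_eqF (s2b2_gt0 bs)).
by rewrite (gt_eqF (ratW_num_gt0 bs)) !gt_eqF //; lra.
Qed.

Lemma ratWE s : b < s -> ratW s = 1 + (a - s) * psi1 s.
Proof.
move=> /rat_nonzero[P0 s2 _ _ _]; rewrite /ratW /psi1 (pp_b2 pp).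
by move: P0; rewrite /polP => P0; field; rewrite P0 s2.
Qed.

Lemma ratVE s : b < s -> ratV s = 1 + (s + a) * psi1 s.
Proof.
move=> /rat_nonzero[P0 s2 _ _ _]; rewrite /ratV /psi1 (pp_b2 pp).
by move: P0; rewrite /polP => P0; field; rewrite P0 s2.
Qed.

(** This is the relation [dphi = m dt]: in the product of [mS] with the derivative of [tS] the
    exponentials cancel, which leaves the right-hand side. *)
Lemma phi1E s : b < s -> (2 * s + a) / polP s + psi1 s = (s + a) * ratW s.
Proof.
move=> /rat_nonzero[P0 s2 _ _ _]; rewrite /ratW /psi1 (pp_b2 pp).
by move: P0; rewrite /polP => P0; field; rewrite P0 s2.
Qed.

Lemma is_derive_tS s : b < s -> is_derive s 1 tS (- (expR (- psi s) * ratW s)).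
Proof.
move=> bs; have Dp := is_derive_psi bs; rewrite /tS.
by der_eq; rewrite ratWE //; ring.
Qed.

Lemma is_derive_mS s : b < s -> is_derive s 1 mS (- (expR (psi s) * ratV s)).
Proof.
move=> bs; have Dp := is_derive_psi bs; rewrite /mS.
by der_eq; rewrite ratVE //; ring.
Qed.

Lemma is_derive_fS s : b < s -> is_derive s 1 fS ((s + a) * ratW s).
Proof.
move=> bs; have Dp := is_derive_psi bs; have P0 := polP_gt0 (bs_gt0 bs).
rewrite /fS; have -> : (fun u => ln (polP u) - ln a + psi u) =
  (fun u => ln (u * u + a * u + 1) - ln a + psi u).
  by apply/funext => u; rewrite /polP expr2.
der_eq; first by move: P0; rewrite /polP expr2.
have -> : s * s + a * s + 1 = polP s by rewrite /polP expr2.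
by rewrite -phi1E //; field; rewrite gt_eqF.
Qed.

Lemma tS_mS s : tS s * mS s = s ^+ 2 - a ^+ 2.
Proof.
rewrite /tS /mS mulrACA -expRD addNr expR0; ring.
Qed.

Lemma expR_fS s : 0 < s -> expR (fS s) = polP s / a * expR (psi s).
Proof.
move=> s0; rewrite /fS expRD expRB !lnK ?posrE ?polP_gt0 //.
by have := a_ge2; lra.
Qed.

Lemma tS_expR_fS s : 0 < s -> tS s * expR (fS s) = (a - s) * polP s / a.
Proof.
move=> s0; rewrite expR_fS // /tS.
have E : expR (- psi s) * expR (psi s) = 1 by rewrite -expRD addNr expR0.
by rewrite -[RHS]mulr1 -E; ring.
Qed.

Lemma ratA_ge s : b < s -> 3^-1 <= ratA s.
Proof.
move=> bs; have N0 := ratW_num_gt0 bs; have s0 := bs_gt0 bs; have a2 := a_ge2.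
rewrite /ratA ler_pdivlMr //.
have sa : 0 < s + a by lra.
have : s ^+ 2 <= polP s ^+ 2 / (s + a) ^+ 2.
  rewrite ler_pdivlMr ?exprn_gt0 // -exprMn lerXn2r ?nnegrE ?mulr_ge0 //.
  - by rewrite ltW.
  - by rewrite ltW.
  - by rewrite ltW // polP_gt0.
  by rewrite /polP; lra.
have := sqr_ge0 b; have : 0 <= a ^+ 2 - 4 by nra.
by lra.
Qed.

Lemma ratC_ge s : b < s -> 2^-1 <= ratC s.
Proof.
move=> bs; have s2 := s2b2_gt0 bs; have a2 := a_ge2; have b2 := pp_b2 pp.
rewrite /ratC ler_pdivlMr; nra.
Qed.

(** The determinant of Q in the coordinates phi and mu. Here [c] is the off-diagonal coefficient up
    to sign, that is, the later [1 - 2 * c]. *)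
Lemma ratAC_det s c : b < s -> 9 * c ^+ 2 = 1 - 4 / a ^+ 2 ->
  3 * (ratA s * ratC s - c ^+ 2) = (polP s / (a * (s + a))) ^+ 2.
Proof.
move=> bs E; have [P0 s2 a0 sa N0] := rat_nonzero bs.
have -> : c ^+ 2 = (1 - 4 / a ^+ 2) / 9 by rewrite -E; field.
rewrite /ratA /ratC (pp_b2 pp); move: P0; rewrite /polP => P0.
by field; rewrite a0 sa N0.
Qed.

Lemma ratQ11 s : b < s ->
  ratW s * ratV s - ((s + a) * ratW s) ^+ 2 / 3 = ratA s * ((s + a) * ratW s) ^+ 2.
Proof.
move=> bs; have [P0 s2 a0 sa N0] := rat_nonzero bs.
rewrite /ratA /ratW /ratV (pp_b2 pp); move: P0; rewrite /polP => P0.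
by field; rewrite P0 s2 sa N0.
Qed.

Lemma tS_decr s s' : b < s -> s < s' -> tS s' < tS s.
Proof.
move=> bs ss'; rewrite -ltrN2.
apply: (@is_derive_lt _ (fun s => - tS s) (fun s => expR (- psi s) * ratW s) b) => [z bz|z bz|//|//].
  by have Dt := is_derive_tS bz; der_eq; rewrite opprK.
by rewrite mulr_gt0 ?expR_gt0 ?ratW_gt0.
Qed.

Lemma fS_incr s s' : b < s -> s < s' -> fS s < fS s'.
Proof.
apply: (@is_derive_lt _ fS (fun s => (s + a) * ratW s) b) => z bz.
  exact: is_derive_fS.
by rewrite mulr_gt0 ?ratW_gt0 //; have := bs_gt0 bz; have := a_ge2; lra.
Qed.

(** * Behaviour of psi, t and phi as s tends to b and to infinity *)

Lemma ln_sub_le (x y : R) : 0 < x -> 0 < y -> ln x - ln y <= (x - y) / y.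
Proof.
move=> x0 y0; rewrite -ln_div ?posrE //.
have -> : x / y = 1 + (x - y) / y by field; rewrite gt_eqF.
apply: le_ln1Dx; rewrite ltr_pdivlMr //; lra.
Qed.

Lemma gh_over_a : h / a + g / a = 1.
Proof. by have := a_ge2; rewrite -mulrDl addrC -(pp_a pp) => a2; rewrite mulfV // gt_eqF //; lra. Qed.

(** The weights [h/a] and [g/a] add up to 1, so the last two logarithms together behave like one
    [ln s], while the term in [b] is nonpositive. With [psi_ge] this gives [psi = ln s + O(1/s)],
    whence t tends to -1. *)
Lemma psi_le s : b < s -> psi s <= ln s + a / s.
Proof.
move=> bs; have s0 := bs_gt0 bs; have b0 := pp_b pp; have g0 := pp_g pp.
have h0 := h_gt0; have a2 := a_ge2; have E := gh_over_a.
have L1 : ln (s - b) <= ln (s + b) by rewrite ler_ln ?posrE; lra.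
have L2 : ln (s + h) - ln s <= h / s.
  by apply: le_trans (ln_sub_le _ _) _; rewrite ?[s + h]addrC ?addrK //; lra.
have L3 : ln (s + g) - ln s <= g / s.
  by apply: le_trans (ln_sub_le _ _) _; rewrite ?[s + g]addrC ?addrK //; lra.
have ba : 0 <= b / a by rewrite divr_ge0; lra.
have ha : 0 <= h / a by rewrite divr_ge0; lra.
have ga : 0 <= g / a by rewrite divr_ge0; lra.
have M1 := mulr_ge0 ba (etrans (subr_ge0 _ _) L1).
have M2 : h / a * (ln (s + h) - ln s) <= h / a * (h / s) by rewrite ler_wpM2l.
have M3 : g / a * (ln (s + g) - ln s) <= g / a * (g / s) by rewrite ler_wpM2l.
have M4 : h / a * (h / s) + g / a * (g / s) <= a / s.
  have -> : h / a * (h / s) + g / a * (g / s) = (h * h + g * g) / (a * s).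
    by field; rewrite !gt_eqF //; lra.
  have -> : a / s = a * a / (a * s) by field; rewrite !gt_eqF //; lra.
  rewrite ler_pM2r; last by rewrite invr_gt0 mulr_gt0; lra.
  by rewrite (pp_a pp); nra.
have -> : ln s = h / a * ln s + g / a * ln s by rewrite -mulrDl E mul1r.
rewrite /psi; lra.
Qed.

Definition kap := 2 * b ^+ 2 / a.

Lemma psi_ge s : b < s -> ln s - kap / (s - b) <= psi s.
Proof.
move=> bs; have s0 := bs_gt0 bs; have b0 := pp_b pp; have g0 := pp_g pp.
have h0 := h_gt0; have a2 := a_ge2; have E := gh_over_a.
have L1 : ln (s + b) - ln (s - b) <= 2 * b / (s - b).
  apply: le_trans (ln_sub_le _ _) _; try lra.
have L2 : ln s <= ln (s + h) by rewrite ler_ln ?posrE; lra.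
have L3 : ln s <= ln (s + g) by rewrite ler_ln ?posrE; lra.
have ba : 0 <= b / a by rewrite divr_ge0; lra.
have ha : 0 <= h / a by rewrite divr_ge0; lra.
have ga : 0 <= g / a by rewrite divr_ge0; lra.
have M1 : b / a * (ln (s + b) - ln (s - b)) <= kap / (s - b).
  have -> : kap / (s - b) = b / a * (2 * b / (s - b)).
    by rewrite /kap; field; rewrite !gt_eqF //; lra.
  by rewrite ler_wpM2l.
have M2 : h / a * ln s <= h / a * ln (s + h) by rewrite ler_wpM2l.
have M3 : g / a * ln s <= g / a * ln (s + g) by rewrite ler_wpM2l.
have -> : ln s = h / a * ln s + g / a * ln s by rewrite -mulrDl E mul1r.
rewrite /psi; lra.
Qed.

Lemma expR_Npsi_ge s : b < s -> (1 - a / s) / s <= expR (- psi s).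
Proof.
move=> bs; have s0 := bs_gt0 bs; have := psi_le bs => L.
have : expR (- (ln s + a / s)) <= expR (- psi s) by rewrite ler_expR lerN2.
apply: le_trans; rewrite opprD expRD [expR (- ln s)]expRN lnK ?posrE // mulrC.
rewrite ler_pM2l ?invr_gt0 //.
exact: expR_ge1Dx.
Qed.

Lemma tS_leN1 s : a <= s -> tS s <= - 1 + 2 * a / s.
Proof.
move=> as_; have ba := b_lt_a; have a2 := a_ge2; have s0 : 0 < s by lra.
have bs : b < s by lra.
have := expR_Npsi_ge bs => L.
have M : (s - a) * ((1 - a / s) / s) <= (s - a) * expR (- psi s).
  by rewrite ler_wpM2l // subr_ge0.
have E : (s - a) * ((1 - a / s) / s) = 1 - 2 * a / s + (a / s) ^+ 2.
  by field; rewrite gt_eqF.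
by have := sqr_ge0 (a / s); rewrite /tS; lra.
Qed.

Lemma kap_gt0 : 0 < kap.
Proof.
by have := a_ge2; have := pp_b pp => b0 a2; rewrite /kap divr_gt0 ?mulr_gt0 ?exprn_gt0 //; lra.
Qed.

Lemma tS_ge s : b < s -> - expR (kap / (s - b)) <= tS s.
Proof.
move=> bs; have s0 := bs_gt0 bs; have a2 := a_ge2.
rewrite /tS.
have L : expR (- psi s) <= expR (kap / (s - b)) / s.
  rewrite -[s in _ / s]lnK ?posrE // -expRB ler_expR.
  by have := psi_ge bs; lra.
have : s * expR (- psi s) <= expR (kap / (s - b)).
  by rewrite mulrC -ler_pdivlMr.
have : 0 <= a * expR (- psi s) by rewrite mulr_ge0 ?expR_ge0 //; lra.
lra.
Qed.

(** [tS] decreases strictly and is bounded below by [- expR (kap / (s - b))], which tends to -1.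
    Were -1 reached at [s], the value at [s + 1] would be below -1 by a fixed amount, against this
    bound far out. *)
Lemma tS_gtN1 s : b < s -> - 1 < tS s.
Proof.
move=> bs; rewrite ltNge; apply/negP => ts.
pose s' := s + 1.
have ss' : s < s' by rewrite /s'; lra.
have ts' := tS_decr bs ss'.
pose e := ln (- tS s').
have e0 : 0 < e by apply: ln_gt0; lra.
have k0 := kap_gt0.
(* Large enough for [e * (r - b) > kap], so that the lower bound at [r] already exceeds [tS s']. *)
pose r := s' + b + (kap / e + 1).
have ke : 0 < kap / e by rewrite divr_gt0.
have b0 := pp_b pp.
have s'r : s' < r by rewrite /r; lra.
have br : b < r by lra.
have := tS_ge br; have tr : tS r < tS s' by apply: tS_decr => //; lra.
move=> L.
have : - tS s' < expR (kap / (r - b)) by lra.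
have tp : 0 < - tS s' by lra.
rewrite -[X in X < _]lnK ?posrE // ltr_expR -/e ltr_pdivlMr; last by lra.
move=> M.
have : e * (kap / e + 1) < kap.
  apply: le_lt_trans M; rewrite ler_pM2l // /r; lra.
have -> : e * (kap / e + 1) = kap + e by field; rewrite gt_eqF.
lra.
Qed.

(** Obtained by integrating the derivative of t from infinity: [1 + tS s - C / s^2] is nondecreasing
    beyond [a], and [tS_leN1] bounds it by [2 a / r] at every later [r], so it cannot be
    positive. *)
Lemma tS_far : exists2 C, 0 < C & forall s, a < s -> 1 + tS s <= C / s ^+ 2.
Proof.
have ba := b_lt_a; have a2 := a_ge2; have b0 := pp_b pp; have k0 := kap_gt0.
pose K := expR (kap / (a - b)).
(* Makes [2 C / z^3] the product of the two bounds used below, [K / z] for [expR (- psi z)] and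
   [3 a^2 / z^2] for [ratW z]. *)
pose C := 3 * a ^+ 2 * K / 2.
have K0 : 0 < K by apply: expR_gt0.
have C0 : 0 < C by rewrite /C divr_gt0 ?mulr_gt0 ?exprn_gt0 //; lra.
exists C => // s as_.
pose f s := 1 + tS s - C * (s * s)^-1.
pose f1 s := 2 * C * (s * s * s)^-1 - expR (- psi s) * ratW s.
have Df z : a < z -> is_derive z 1 f (f1 z).
  move=> az; have bz : b < z by lra.
  have z0 : z != 0 by rewrite gt_eqF //; lra.
  have := is_derive_tS bz => D; rewrite /f; der_eq; first by rewrite mulf_neq0.
  by rewrite /f1; field.
have f1_0 z : a < z -> 0 <= f1 z.
  move=> az; have bz : b < z by lra.
  have z0 : 0 < z by lra.
  have L1 : expR (- psi z) <= K / z.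
    rewrite /K -[z in _ / z]lnK ?posrE // -expRB ler_expR.
    have : kap / (z - b) <= kap / (a - b).
      by rewrite ler_pM2l // lef_pV2 ?posrE; lra.
    by have := psi_ge bz; lra.
  have L2 : ratW z <= 3 * a ^+ 2 / z ^+ 2.
    rewrite /ratW ler_pdivrMr; last by rewrite mulr_gt0 ?polP_gt0 ?s2b2_gt0.
    have P : z ^+ 2 <= polP z by rewrite /polP; nra.
    have Q : z ^+ 2 / a ^+ 2 <= z ^+ 2 - b ^+ 2.
      rewrite ler_pdivrMr ?exprn_gt0 //; try lra.
      rewrite (pp_b2 pp).
      have : 0 <= (z ^+ 2 - a ^+ 2) * (a ^+ 2 - 1) by apply: mulr_ge0; nra.
      lra.
    have M : z ^+ 2 * (z ^+ 2 / a ^+ 2) <= polP z * (z ^+ 2 - b ^+ 2).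
      by apply: ler_pM => //; rewrite ?divr_ge0 ?sqr_ge0.
    have := ler_wpM2l (_ : 0 <= 3 * a ^+ 2 / z ^+ 2) M.
    have -> : 3 * a ^+ 2 / z ^+ 2 * (z ^+ 2 * (z ^+ 2 / a ^+ 2)) = 3 * z ^+ 2.
      by field; rewrite !gt_eqF //; lra.
    have K1 : 0 <= 3 * a ^+ 2 / z ^+ 2 by rewrite divr_ge0 ?sqr_ge0 // mulr_ge0 ?sqr_ge0.
    by move=> /(_ K1); have := sqr_ge0 b; lra.
  have M : expR (- psi z) * ratW z <= K / z * (3 * a ^+ 2 / z ^+ 2).
    by apply: ler_pM => //; rewrite ltW // ratW_gt0.
  rewrite /f1 subr_ge0 (le_trans M) //.
  have -> : K / z * (3 * a ^+ 2 / z ^+ 2) = 2 * C * (z * z * z)^-1.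
    by rewrite /C; field; rewrite gt_eqF.
  exact: lexx.
have fle r : s < r -> f s <= 2 * a / r.
  move=> sr; have := is_derive_le Df f1_0 as_ sr => /le_trans; apply.
  have := @tS_leN1 r; rewrite /f => L.
  have : 0 <= C * (r * r)^-1 by rewrite divr_ge0 ?mulr_ge0 //; lra.
  by have := L (_ : a <= r); lra.
suff : f s <= 0 by rewrite /f expr2; lra.
rewrite leNgt; apply/negP => fs0.
pose r := s + 2 * a / f s.
have r1 : 0 < 2 * a / f s by rewrite divr_gt0 //; lra.
have := fle r; rewrite ler_pdivlMr; last by rewrite /r; lra.
have -> : f s * r = f s * s + 2 * a by rewrite /r; field; rewrite gt_eqF.
have : 0 < f s * s by rewrite mulr_gt0 //; lra.
have : s < r by rewrite /r; lra.
by move=> /[swap] ? /[swap] L /L; lra.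
Qed.

(** The exponents balance: [1 + t] is of order at most [s^-2] and [e^phi] of order at most [s^3].
    This product controls the vertical distance from the surface to the graph
    [z = - x^(1/p) y^(1/q)]. *)
Lemma tS_fS_far : exists2 C, 0 < C & forall s, a < s ->
  (1 + tS s) ^+ 3 * expR (fS s) ^+ 2 <= C.
Proof.
have [C C0 HC] := tS_far.
have ba := b_lt_a; have a2 := a_ge2; have b0 := pp_b pp.
pose D := 3 / a * expR 1.
have D0 : 0 < D by rewrite /D mulr_gt0 ?expR_gt0 // divr_gt0 //; lra.
exists (C ^+ 3 * D ^+ 2); first by rewrite mulr_gt0 ?exprn_gt0.
move=> s as_; have bs : b < s by lra.
have s0 : 0 < s by lra.
have L : expR (fS s) <= D * s ^+ 3.
  rewrite expR_fS //.
  have P : polP s / a <= 3 / a * s ^+ 2.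
    by rewrite mulrAC ler_pM2r ?invr_gt0; [rewrite /polP; nra|lra].
  have E : expR (psi s) <= expR 1 * s.
    rewrite -[s in _ * s]lnK ?posrE // -expRD ler_expR.
    have := psi_le bs.
    have : a / s <= 1 by rewrite ler_pdivrMr //; lra.
    lra.
  have -> : D * s ^+ 3 = (3 / a * s ^+ 2) * (expR 1 * s) by rewrite /D; ring.
  apply: ler_pM => //.
  by rewrite divr_ge0 // ?ltW ?polP_gt0 //; lra.
have t0 := tS_gtN1 bs.
have -> : C ^+ 3 * D ^+ 2 = (C / s ^+ 2) ^+ 3 * (D * s ^+ 3) ^+ 2.
  by field; rewrite gt_eqF.
apply: ler_pM; rewrite ?exprn_ge0 ?expR_ge0 //; first by lra.
  by rewrite lerXn2r ?nnegrE ?HC //; [lra|rewrite divr_ge0 ?sqr_ge0 // ltW].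
by rewrite lerXn2r ?nnegrE ?expR_ge0 // mulr_ge0 ?exprn_ge0 // ltW.
Qed.

(** The term [ln (s - b)] sends [psi] to minus infinity at [b]. Keeping [s <= (a + b) / 2] leaves
    [a - s] bounded below, so that t becomes large there. *)
Lemma psi_unbounded N : exists2 s, b < s <= (a + b) / 2 & psi s <= N.
Proof.
have ba := b_lt_a; have a2 := a_ge2; have b0 := pp_b pp; have g0 := pp_g pp.
have h0 := h_gt0; have aE := pp_a pp; have E := gh_over_a.
(* Chosen so that [b/a * (ln y - ln b) = N - ln (2 * a)]; the other two terms of [psi] add at most
   [ln (2 * a)]. *)
pose y := expR (ln b + a / b * (N - ln (2 * a))).
have y0 : 0 < y by exact: expR_gt0.
pose d := Num.min y ((a - b) / 2).
have d0 : 0 < d by rewrite /d lt_min y0 /=; lra.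
have dy : d <= y by rewrite ge_min lexx.
have da : d <= (a - b) / 2 by rewrite ge_min lexx orbT.
exists (b + d); first by lra.
rewrite /psi.
have -> : b + d - b = d by ring.
have L0 : ln d <= ln b + a / b * (N - ln (2 * a)).
  by rewrite -[X in _ <= X]expRK ler_ln ?posrE.
have L1 : ln b <= ln (b + d + b) by rewrite ler_ln ?posrE; lra.
have L2 : ln (b + d + h) <= ln (2 * a) by rewrite ler_ln ?posrE; lra.
have L3 : ln (b + d + g) <= ln (2 * a) by rewrite ler_ln ?posrE; lra.
have ba' : 0 <= b / a by rewrite divr_ge0; lra.
have ha : 0 <= h / a by rewrite divr_ge0; lra.
have ga : 0 <= g / a by rewrite divr_ge0; lra.
have M1 : b / a * (ln d - ln (b + d + b)) <= b / a * (a / b * (N - ln (2 * a))).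
  by rewrite ler_wpM2l //; lra.
have M2 := ler_wpM2l ha L2.
have M3 := ler_wpM2l ga L3.
have E1 : b / a * (a / b * (N - ln (2 * a))) = N - ln (2 * a).
  by field; rewrite !gt_eqF //; lra.
have E2 : ln (2 * a) = h / a * ln (2 * a) + g / a * ln (2 * a).
  by rewrite -mulrDl E mul1r.
lra.
Qed.

Lemma tS_onto c : - 1 < c -> exists2 s, b < s & tS s = c.
Proof.
move=> c1; have ba := b_lt_a; have a2 := a_ge2; have b0 := pp_b pp.
have [s1 /andP[bs1 s1a] ps1] := psi_unbounded (- (2 / (a - b) * `|c|)).
pose s2 := a + 2 * a / (c + 1).
have d0 : 0 < 2 * a / (c + 1) by rewrite divr_gt0; lra.
have s12 : s1 <= s2 by rewrite /s2; lra.
have H1 : c <= tS s1.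
  apply: le_trans (ler_norm _) _.
  have E : 1 + 2 / (a - b) * `|c| <= expR (- psi s1).
    apply: le_trans (expR_ge1Dx _) _; rewrite ler_expR; lra.
  have F : (a - b) / 2 * (1 + 2 / (a - b) * `|c|) <= tS s1.
    apply: ler_pM => //; try lra.
    by rewrite addr_ge0 // mulr_ge0 // divr_ge0; lra.
  apply: le_trans F.
  have -> : (a - b) / 2 * (1 + 2 / (a - b) * `|c|) = (a - b) / 2 + `|c|.
    by field; rewrite gt_eqF //; lra.
  lra.
have H2 : tS s2 <= c.
  have := @tS_leN1 s2 => /(_ ltac:(rewrite /s2; lra)) L.
  apply: le_trans L _.
  have : 2 * a / s2 <= c + 1; last by lra.
  rewrite ler_pdivrMr; last by rewrite /s2; lra.
  have -> : (c + 1) * s2 = 2 * a + (c + 1) * a by rewrite /s2; field; rewrite gt_eqF //; lra.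
  have : 0 <= (c + 1) * a by rewrite mulr_ge0; lra.
  lra.
have [||s] := @IVT _ tS s1 s2 c s12.
- apply: derivable_within_continuous => z; rewrite in_itv /= => /andP[xz _].
  by case: (@is_derive_tS z) => //; lra.
- by rewrite ge_min le_max H1 H2 orbT.
- by rewrite in_itv /= => /andP[s1s _] ts; exists s => //; lra.
Qed.

Lemma fS_onto c : exists2 s, b < s & fS s = c.
Proof.
have ba := b_lt_a; have a2 := a_ge2; have b0 := pp_b pp.
have [s1 /andP[bs1 s1a] ps1] := psi_unbounded (c - ln (polP a)).
pose s2 := a + expR (c + kap / (a - b)).
have e0 : 0 < expR (c + kap / (a - b)) := expR_gt0 _.
have s12 : s1 <= s2 by rewrite /s2; lra.
have H1 : fS s1 <= c.
  rewrite /fS.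
  have : ln (polP s1) <= ln (polP a).
    by rewrite ler_ln ?posrE ?polP_gt0 /polP; nra.
  have : 0 <= ln a by apply: ln_ge0; lra.
  lra.
have H2 : c <= fS s2.
  have bs2 : b < s2 by rewrite /s2; lra.
  have := psi_ge bs2 => L.
  have L1 : kap / (s2 - b) <= kap / (a - b).
    by rewrite ler_pM2l ?kap_gt0 // lef_pV2 ?posrE; rewrite ?/s2; lra.
  have L2 : c + kap / (a - b) <= ln s2.
    by rewrite -[X in X <= _]expRK ler_ln ?posrE /s2; lra.
  have L3 : ln a <= ln (polP s2).
    have s2p : 0 < s2 by lra.
    rewrite ler_ln ?posrE ?polP_gt0 //; last lra.
    rewrite /polP; have : a <= s2 by rewrite /s2; lra.
    by have := mulr_ge0 (ltW s2p) (ltW s2p); nra.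
  by rewrite /fS; lra.
have [||s] := @IVT _ fS s1 s2 c s12.
- apply: derivable_within_continuous => z; rewrite in_itv /= => /andP[xz _].
  by case: (@is_derive_fS z) => //; lra.
- by rewrite ge_min le_max H1 H2 orbT.
- by rewrite in_itv /= => /andP[s1s _] ts; exists s => //; lra.
Qed.

(** * Return from the variable s to xi *)

Definition sq (x : R) := Num.sqrt (x + b ^+ 2).

Lemma sqE x : 0 < x -> sq x ^+ 2 = x + b ^+ 2.
Proof. by move=> x0; rewrite /sq sqr_sqrtr // addr_ge0 ?sqr_ge0 // ltW. Qed.

Lemma sq_gt x : 0 < x -> b < sq x.
Proof.
move=> x0; have := sqE x0; have := sqrtr_ge0 (x + b ^+ 2); rewrite -/(sq x).
by have := pp_b pp; nra.
Qed.

Lemma sq_onto s : b < s -> exists2 x, 0 < x & sq x = s.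
Proof.
move=> bs; exists (s ^+ 2 - b ^+ 2); first exact: s2b2_gt0.
by rewrite /sq subrK sqrtr_sqr gtr0_norm // bs_gt0.
Qed.

Lemma is_derive_sq (x : R) : 0 < x -> is_derive x 1 sq (2 * sq x)^-1.
Proof.
move=> x0; have D : is_derive (x + b ^+ 2) 1 (@Num.sqrt R) (2 * sq x)^-1.
  by apply: is_derive1_sqrt; rewrite ltr_wpDr ?sqr_ge0.
have D2 : is_derive x 1 (fun x => x + b ^+ 2) 1 by der_eq; rewrite addr0.
by notypeclasses refine (isd_eq (@isd_comp _ _ (@Num.sqrt R) (fun x => x + b ^+ 2) x 1 _ _ D D2) _); rewrite mulr1.
Qed.

Definition t_xi x := tS (sq x).
Definition m_xi x := mS (sq x).
Definition phi_xi x := fS (sq x).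
Definition dt_xi x := - (expR (- psi (sq x)) * ratW (sq x)) * (2 * sq x)^-1.
Definition dm_xi x := - (expR (psi (sq x)) * ratV (sq x)) * (2 * sq x)^-1.

Lemma dt_xi_lt0 x : 0 < x -> dt_xi x < 0.
Proof.
move=> x0; have bs := sq_gt x0; have s0 := bs_gt0 bs.
have W0 := ratW_gt0 bs; have e0 := expR_gt0 (- psi (sq x)).
by rewrite /dt_xi mulNr oppr_lt0 divr_gt0 // mulr_gt0.
Qed.

Lemma m_dt_xi x : 0 < x -> m_xi x * dt_xi x = (sq x + a) * ratW (sq x) * (2 * sq x)^-1.
Proof.
move=> x0; rewrite /m_xi /mS /dt_xi.
have E : expR (psi (sq x)) * expR (- psi (sq x)) = 1 by rewrite -expRD subrr expR0.
rewrite -[RHS]mul1r -E; ring.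
Qed.

Lemma is_derive_t_xi (x : R) : 0 < x -> is_derive x 1 t_xi (dt_xi x).
Proof.
move=> x0.
exact: (isd_comp (is_derive_tS (sq_gt x0)) (is_derive_sq x0)).
Qed.

Lemma is_derive_m_xi (x : R) : 0 < x -> is_derive x 1 m_xi (dm_xi x).
Proof.
move=> x0.
exact: (isd_comp (is_derive_mS (sq_gt x0)) (is_derive_sq x0)).
Qed.

Lemma is_derive_phi_xi (x : R) : 0 < x -> is_derive x 1 phi_xi (m_xi x * dt_xi x).
Proof.
move=> x0; rewrite m_dt_xi //.
exact: (isd_comp (is_derive_fS (sq_gt x0)) (is_derive_sq x0)).
Qed.

Lemma derivable_dt_xi (x : R) : 0 < x -> exists t2, is_derive x 1 dt_xi t2.
Proof.
move=> x0; have bs := sq_gt x0; have s0 := bs_gt0 bs.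
have Dpsi := isd_comp (is_derive_psi bs) (is_derive_sq x0).
have Dsq := is_derive_sq x0.
have P0 := polP_gt0 s0; have N0 := s2b2_gt0 bs.
pose f y := - (expR (- psi (sq y)) * ((3 * (sq y * sq y) - b ^+ 2) *
  ((sq y * sq y + a * sq y + 1) * (sq y * sq y - b ^+ 2))^-1)) * (2 * sq y)^-1.
have -> : dt_xi = f by apply/funext => y; rewrite /dt_xi /f /ratW /polP !expr2.
eexists; rewrite /f; der.
  by move: P0 N0; rewrite /polP !expr2 => P0 N0; rewrite gt_eqF // mulr_gt0.
by rewrite gt_eqF // mulr_gt0.
Qed.

Lemma t_xi_gtN1 x : 0 < x -> - 1 < t_xi x.
Proof. by move=> /sq_gt /tS_gtN1. Qed.

Lemma t_xi_onto c : - 1 < c -> exists2 x, 0 < x & t_xi x = c.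
Proof.
move=> /tS_onto[s /sq_onto[x x0 xs] sc]; exists x => //.
by rewrite /t_xi xs.
Qed.

Lemma phi_xi_onto c : exists2 x, 0 < x & phi_xi x = c.
Proof.
have [s /sq_onto[x x0 xs] sc] := fS_onto c; exists x => //.
by rewrite /phi_xi xs.
Qed.

Lemma sq_incr x y : 0 < x -> x < y -> sq x < sq y.
Proof.
move=> x0 xy; have y0 : 0 < y by lra.
have := sqE x0; have := sqE y0; have := bs_gt0 (sq_gt x0); have := bs_gt0 (sq_gt y0).
by nra.
Qed.

Lemma t_xi_decr x y : 0 < x -> x < y -> t_xi y < t_xi x.
Proof. by move=> x0 xy; apply: tS_decr; [exact: sq_gt|exact: sq_incr]. Qed.

Lemma phi_xi_incr x y : 0 < x -> x < y -> phi_xi x < phi_xi y.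
Proof. by move=> x0 xy; apply: fS_incr; [exact: sq_gt|exact: sq_incr]. Qed.

(** On the surface [e^phi = x y r] and [t e^phi = x y z], where r is the geometric mean
    [x^(1/p) y^(1/q)]. The cases are split at [s = a], that is, at [xi = 1], where t changes
    sign. *)
Lemma t_phi_far : exists C, [/\ 0 < C,
  (forall x, 0 < x -> a < sq x -> (1 + t_xi x) ^+ 3 * expR (phi_xi x) ^+ 2 <= C),
  (forall x, 0 < x -> sq x <= a -> expR (phi_xi x) <= C) &
  (forall x, 0 < x -> sq x <= a -> 0 <= t_xi x /\ t_xi x * expR (phi_xi x) <= C)].
Proof.
have [C C0 HC] := tS_fS_far.
have ba := b_lt_a; have a2 := a_ge2.
have P0 : 0 < polP a by apply: polP_gt0; lra.
exists (C + expR (fS a) + polP a); split.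
- by have := expR_ge0 (fS a); lra.
- by move=> x x0 ax; have := HC _ ax; have := expR_ge0 (fS a); rewrite /t_xi /phi_xi; lra.
- move=> x x0 ax.
  have : expR (phi_xi x) <= expR (fS a).
    rewrite ler_expR; have := sq_gt x0 => bs; move: ax; rewrite le_eqVlt.
    by case/orP => [/eqP E|]; [rewrite /phi_xi E|move=> /(fS_incr bs)/ltW].
  lra.
- move=> x x0 ax; have bs := sq_gt x0; have s0 := bs_gt0 bs; split.
    by rewrite /t_xi /tS mulr_ge0 ?expR_ge0 // subr_ge0.
  rewrite /t_xi /phi_xi tS_expR_fS //.
  have P1 : polP (sq x) <= polP a by rewrite /polP; nra.
  have P2 := polP_gt0 s0.
  have : (a - sq x) * polP (sq x) / a <= polP a.
    rewrite ler_pdivrMr; last lra.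
    have : (a - sq x) * polP (sq x) <= a * polP a by apply: ler_pM; lra.
    lra.
  by have := expR_ge0 (fS a); lra.
Qed.

(** As [xi] tends to 0, phi tends to minus infinity and t to infinity, but the exponentials cancel
    in [t e^phi = (a - s) polP s / a], where [polP s > 1]. The constants come from
    [s <= (a + b) / 2]. *)
Lemma t_phi_near : exists c x0, [/\ 0 < c, 0 < x0 &
  forall x, 0 < x -> x <= x0 -> c <= t_xi x * expR (phi_xi x)].
Proof.
have ba := b_lt_a; have a2 := a_ge2; have b0 := pp_b pp.
have [x0 x00 Ex] : exists2 x, 0 < x & sq x = (a + b) / 2.
  by apply: sq_onto; lra.
exists ((a - b) / 2 / a), x0; split => //; first by rewrite !divr_gt0 //; lra.
move=> x xp xx0; have bs := sq_gt xp; have s0 := bs_gt0 bs.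
rewrite /t_xi /phi_xi tS_expR_fS // ler_pM2r ?invr_gt0; last lra.
have : sq x <= (a + b) / 2.
  by move: xx0; rewrite -Ex le_eqVlt => /orP[/eqP-> //|/(sq_incr xp)/ltW].
have P1 := polP_ge1 s0 => L.
by nra.
Qed.

End Profile.

(** * The Gauss formula *)

Lemma isd_coord (R : realType) n (u v : 'rV[R]_n) i :
  is_derive u v (fun w : 'rV[R]_n => w 0 i) (v 0 i).
Proof. by have /is_derive_rowP := is_derive_id u v; apply. Qed.

Section Surface.
Context {R : realType}.
Variables (c : R) (t t1 t2 m m1 f : R -> R).

(* [m] stands for the derivative of [f] with respect to [t]. *)
Record profile : Prop := Profile {
  pf_t : forall x : R, 0 < x -> is_derive x 1 t (t1 x);
  pf_t1 : forall x : R, 0 < x -> is_derive x 1 t1 (t2 x);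
  pf_m : forall x : R, 0 < x -> is_derive x 1 m (m1 x);
  pf_f : forall x : R, 0 < x -> is_derive x 1 f (m x * t1 x);
  pf_neq0 : forall x : R, 0 < x -> t1 x != 0 }.

Implicit Types u v w : 'rV[R]_2.

(** [sx] and [sy] are the coordinates x and y, and [sr] will be their geometric mean
    [x^(1/p) y^(1/q)]. The coefficients of mu, namely [c], [c - 1] and [1 - 2c], add up to 0, so the
    product of the three is [e^f]. *)
Definition sx u := expR (f (u 0 0) / 3 + c * u 0 1).
Definition sy u := expR (f (u 0 0) / 3 - (1 - c) * u 0 1).
Definition sr u := expR (f (u 0 0) / 3 + (1 - 2 * c) * u 0 1).
Definition f1 x := m x * t1 x.
Definition f2 x := m x * t2 x + t1 x * m1 x.

Definition row3 (x y z : R) : 'rV[R]_3 := \row_(i < 3) [:: x; y; z]`_i.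

Definition surf u := row3 (sx u) (sy u) (sr u * t (u 0 0)).

(** The differential of [f/3 + l mu], hence the logarithmic derivative of [sx], [sy] and [sr] for
    the respective [l]. *)
Definition dl (l : R) u v := f1 (u 0 0) * v 0 0 / 3 + l * v 0 1.

Definition dsurf u v :=
  row3 (sx u * dl c u v) (sy u * dl (c - 1) u v)
       (sr u * (t1 (u 0 0) * v 0 0 + t (u 0 0) * dl (1 - 2 * c) u v)).

Definition ddsurf u v w :=
  let l := dl (1 - 2 * c) u in let x := u 0 0 in
  let g := f2 x * v 0 0 * w 0 0 / 3 in
  row3 (sx u * (dl c u v * dl c u w + g))
       (sy u * (dl (c - 1) u v * dl (c - 1) u w + g))
       (sr u * ((t1 x * v 0 0 + t x * l v) * l w + t2 x * v 0 0 * w 0 0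
                + t1 x * w 0 0 * l v + t x * g)).

(** For the exponent [c = (1 + 1/q) / 3] used later the factors are [1/q] and [1/p]. *)
Definition gauss_k : R := (3 * c - 1) * (2 - 3 * c).

(* The Christoffel symbols of the connection induced by the position vector. *)
Definition gamma u v w : 'rV[R]_2 :=
  let x := u 0 0 in let s := v 0 0 * w 0 1 + v 0 1 * w 0 0 in
  \row_(i < 2) [::
    (2 * f1 x / 3 + t2 x / t1 x) * (v 0 0 * w 0 0) + (1 - 2 * c) * s
      - gauss_k * t x / t1 x * (v 0 1 * w 0 1);
    f1 x / 3 * s + (2 * c - 1) * (v 0 1 * w 0 1)]`_i.

Definition form u v w : R :=
  let x := u 0 0 in
  (m1 x * t1 x - f1 x ^+ 2 / 3) * (v 0 0 * w 0 0)
  - (1 - 2 * c) * f1 x * (v 0 0 * w 0 1 + v 0 1 * w 0 0)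
  + (3 * c * (1 - c) + gauss_k * t x * m x) * (v 0 1 * w 0 1).

Lemma row3E (x y z : R) : (row3 x y z 0 0 = x) * (row3 x y z 0 1 = y) * (row3 x y z 0 2 = z).
Proof. by rewrite /row3 !mxE. Qed.

Lemma row3P (X Y : 'rV[R]_3) : X 0 0 = Y 0 0 -> X 0 1 = Y 0 1 -> X 0 2 = Y 0 2 -> X = Y.
Proof.
move=> H0 H1 H2; apply/rowP; case=> -[|[|[|//]]] Hi.
- by rewrite (_ : Ordinal Hi = 0) //; apply/val_inj.
- by rewrite (_ : Ordinal Hi = 1) //; apply/val_inj.
- by rewrite (_ : Ordinal Hi = 2) //; apply/val_inj.
Qed.

Lemma is_derive_row3 (V : normedModType R) (X Y Z : V -> R) (p q : V) dX dY dZ :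
  is_derive p q X dX -> is_derive p q Y dY -> is_derive p q Z dZ ->
  is_derive p q (fun p => row3 (X p) (Y p) (Z p)) (row3 dX dY dZ).
Proof.
move=> HX HY HZ; apply/is_derive_rowP; case=> -[|[|[|//]]] Hi; rewrite mxE /=.
- by rewrite (_ : (fun _ => _) = X) //; apply/funext => ?; rewrite mxE.
- by rewrite (_ : (fun _ => _) = Y) //; apply/funext => ?; rewrite mxE.
- by rewrite (_ : (fun _ => _) = Z) //; apply/funext => ?; rewrite mxE.
Qed.

Hypothesis pf : profile.

Lemma is_derive_surf u v : 0 < u 0 0 -> is_derive u v surf (dsurf u v).
Proof.
move=> u0.
have Du0 := isd_coord u v 0; have Du1 := isd_coord u v 1.
have Df := isd_comp (pf_f pf u0) Du0.
have Dt := isd_comp (pf_t pf u0) Du0.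
rewrite /surf /dsurf /sx /sy /sr /dl /f1; by apply: is_derive_row3; der_eq; field.
Qed.

Lemma is_derive_dsurf u v w : 0 < u 0 0 ->
  is_derive u w (fun u => dsurf u v) (ddsurf u v w).
Proof.
move=> u0.
have Du0 := isd_coord u w 0; have Du1 := isd_coord u w 1.
have Df := isd_comp (pf_f pf u0) Du0.
have Dt := isd_comp (pf_t pf u0) Du0.
have Dt1 := isd_comp (pf_t1 pf u0) Du0.
have Dm := isd_comp (pf_m pf u0) Du0.
rewrite /ddsurf /dsurf /sx /sy /sr /dl /f2 /f1.
by apply: is_derive_row3; der_eq; field.
Qed.

Lemma gauss_formula u v w : 0 < u 0 0 ->
  ddsurf u v w = dsurf u (gamma u v w) + (form u v w / 3) *: surf u.
Proof.
move=> u0; have t10 := pf_neq0 pf u0.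
apply: row3P; rewrite !mxE /= /dl /f2 /gamma /form /f1 /gauss_k !mxE /=.
all: by field.
Qed.

Lemma expR_fE u : sx u * sy u * sr u = expR (f (u 0 0)).
Proof. by rewrite /sx /sy /sr -!expRD; congr expR; field. Qed.

Lemma det_surf u v w :
  \det (\matrix_(i < 3) [:: surf u; dsurf u v; dsurf u w]`_i)
  = expR (f (u 0 0)) * t1 (u 0 0) * (v 0 0 * w 0 1 - v 0 1 * w 0 0).
Proof.
by rewrite det_mx33E !mxE /= -expR_fE /dl; field.
Qed.

Lemma dsurf_inj u v : 0 < u 0 0 -> dsurf u v = 0 -> v = 0.
Proof.
move=> u0 E; have t10 := pf_neq0 pf u0.
have E0 : dl c u v = 0.
  have := congr1 (fun X : 'rV[R]_3 => X 0 0) E; rewrite !mxE /= => /eqP.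
  by rewrite mulf_eq0 gt_eqF ?expR_gt0 //= => /eqP.
have E1 : dl (c - 1) u v = 0.
  have := congr1 (fun X : 'rV[R]_3 => X 0 1) E; rewrite !mxE /= => /eqP.
  by rewrite mulf_eq0 gt_eqF ?expR_gt0 //= => /eqP.
have v1 : v 0 1 = 0 by move: E0 E1; rewrite /dl; lra.
have E2 : t1 (u 0 0) * v 0 0 = 0.
  have := congr1 (fun X : 'rV[R]_3 => X 0 2) E; rewrite !mxE /= => /eqP.
  rewrite mulf_eq0 gt_eqF ?expR_gt0 //= => /eqP.
  have -> : dl (1 - 2 * c) u v = dl c u v by rewrite /dl v1 !mulr0.
  by rewrite E0 mulr0 addr0.
move/eqP: E2; rewrite mulf_eq0 (negbTE t10) /= => /eqP v0.
apply/rowP; case=> -[|[|//]] Hi; rewrite mxE.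
- by rewrite -v0; congr (v 0 _); apply/val_inj.
- by rewrite -v1; congr (v 0 _); apply/val_inj.
Qed.

End Surface.

(** * The power cone *)

Lemma rV_norm_le (R : realType) n (v : 'rV[R]_n) e : 0 <= e ->
  (forall i, `|v 0 i| <= e) -> `|v| <= e.
Proof.
move=> e0 H; rewrite [leLHS]/Num.Def.normr/= mx_normrE.
by apply: bigmax_le => // -[i j] _ /=; rewrite (ord1 i).
Qed.

Lemma rV_norm_lt (R : realType) n (v : 'rV[R]_n) e : 0 < e ->
  (forall i, `|v 0 i| < e) -> `|v| < e.
Proof.
move=> e0 H; rewrite [ltLHS]/Num.Def.normr/= mx_normrE.
by apply: bigmax_lt => // -[i j] _ /=; rewrite (ord1 i).
Qed.

Lemma ord3P (P : 'I_3 -> Prop) : P 0 -> P 1 -> P 2 -> forall i, P i.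
Proof.
move=> H0 H1 H2; case=> -[|[|[|//]]] Hi.
- by rewrite (_ : Ordinal Hi = 0) //; apply/val_inj.
- by rewrite (_ : Ordinal Hi = 1) //; apply/val_inj.
- by rewrite (_ : Ordinal Hi = 2) //; apply/val_inj.
Qed.

Section PosPow.
Context {R : realType}.
Implicit Types x y al : R.

(* The junk values of [powR] on negative numbers are cut off. *)
Definition pospow al x := (Num.max x 0) `^ al.

Lemma pospowE al x : 0 <= x -> pospow al x = x `^ al.
Proof. by move=> x0; rewrite /pospow max_l. Qed.

Lemma pospow_ge0 al x : 0 <= pospow al x.
Proof. exact: powR_ge0. Qed.

Lemma pospow_le0 al x : 0 < al -> x <= 0 -> pospow al x = 0.
Proof. by move=> a0 x0; rewrite /pospow max_r // powR0 // gt_eqF. Qed.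

Lemma pospow_gt0 al x : 0 < x -> 0 < pospow al x.
Proof. by move=> x0; rewrite pospowE ?ltW // powR_gt0. Qed.

Lemma pospow_le al x y : 0 < al -> x <= y -> pospow al x <= pospow al y.
Proof.
move=> a0 xy; apply: ge0_ler_powR; first exact: ltW.
- by rewrite nnegrE le_max lexx orbT.
- by rewrite nnegrE le_max lexx orbT.
by rewrite ge_max !le_max xy lexx orbT.
Qed.

Lemma pospow_continuous al : 0 < al -> continuous (pospow al).
Proof.
move=> a0 x; have [x0|x0] := ltP 0 x; last first.
  rewrite /continuous_at pospow_le0 //; apply/cvgrPdist_lt => e e0.
  have d0 : 0 < e `^ al^-1 by exact: powR_gt0.
  near=> y.
  rewrite sub0r normrN ger0_norm ?pospow_ge0 //.
  have [y0|y0] := leP y 0; first by rewrite pospow_le0.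
  rewrite pospowE; last exact: ltW.
  have -> : e = (e `^ al^-1) `^ al.
    by rewrite -powRrM mulVf ?gt_eqF // powRr1 // ltW.
  apply: gt0_ltr_powR => //; rewrite ?nnegrE ?ltW //.
  have : `|x - y| < e `^ al^-1 by near: y; exact: cvgr_dist_lt.
  by move/ltr_normlP => [+ _]; lra.
rewrite /continuous_at.
have E : {near x, (fun y => expR (al * ln y)) =1 pospow al}.
  near=> y; have y0 : 0 < y by near: y; exact: lt_nbhsr.
  by rewrite pospowE ?ltW // /powR gt_eqF.
rewrite -(nbhs_singleton E).
apply: cvg_trans; first exact: (near_eq_cvg E).
apply: (@continuous_comp _ _ _ (fun y => al * ln y) expR); last exact: continuous_expR.
apply: (@continuousM _ _ (fun _ => al) (@ln R)); first exact: cvg_cst.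
exact: continuous_ln.
Unshelve. all: by end_near. Qed.

End PosPow.

Section Cone.
Context {R : realType}.
Variables p q : R.
Hypotheses (p0 : 0 < p) (q0 : 0 < q) (pq1 : p^-1 + q^-1 = 1).
Implicit Types v w : 'rV[R]_3.

Definition gmean v := pospow p^-1 (v 0 0) * pospow q^-1 (v 0 1).

Lemma gmean_ge0 v : 0 <= gmean v.
Proof. by rewrite mulr_ge0 ?pospow_ge0. Qed.

Lemma gmean_gt0 v : 0 < v 0 0 -> 0 < v 0 1 -> 0 < gmean v.
Proof. by move=> x0 y0; rewrite mulr_gt0 ?pospow_gt0. Qed.

Lemma power_coneE : power_cone p q =
  [set v : 'rV[R]_3 | [/\ 0 <= v 0 0, 0 <= v 0 1 & 0 <= v 0 2 + gmean v]].
Proof.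
apply/seteqP; split => v /=.
  move=> [H x0 y0]; split => //; rewrite /gmean !pospowE //; lra.
move=> [x0 y0]; rewrite /gmean !pospowE // => H; split => //; lra.
Qed.

Lemma gmean_continuous : continuous gmean.
Proof.
move=> v; apply: (@continuousM _ _ (fun v => pospow p^-1 (v 0 0)) (fun v => pospow q^-1 (v 0 1))).
  apply: (@continuous_comp _ _ _ (fun v : 'rV[R]_3 => v 0 0) (pospow p^-1)).
    exact: coord_continuous.
  by apply: pospow_continuous; rewrite invr_gt0.
apply: (@continuous_comp _ _ _ (fun v : 'rV[R]_3 => v 0 1) (pospow q^-1)).
  exact: coord_continuous.
by apply: pospow_continuous; rewrite invr_gt0.
Qed.

Lemma gmeanD_continuous : continuous (fun v => v 0 2 + gmean v).
Proof.
move=> v; apply: (@continuousD _ _ _ (fun v : 'rV[R]_3 => v 0 2) gmean).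
  exact: coord_continuous.
exact: gmean_continuous.
Qed.

Lemma closed_power_cone : closed (power_cone p q).
Proof.
rewrite power_coneE.
have -> : [set v : 'rV[R]_3 | [/\ 0 <= v 0 0, 0 <= v 0 1 & 0 <= v 0 2 + gmean v]] =
   (fun v : 'rV[R]_3 => v 0 0) @^-1` [set x | 0 <= x] `&`
   ((fun v : 'rV[R]_3 => v 0 1) @^-1` [set x | 0 <= x] `&`
    (fun v => v 0 2 + gmean v) @^-1` [set x | 0 <= x]).
  by apply/seteqP; split => v /=; [case|case=> ? []].
apply: closedI; first by apply: preimage_closed (@closed_ge R 0) => v _; exact: coord_continuous.
apply: closedI; first by apply: preimage_closed (@closed_ge R 0) => v _; exact: coord_continuous.
by apply: preimage_closed (@closed_ge R 0) => v _; exact: gmeanD_continuous.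
Qed.

Lemma interior_power_cone : (power_cone p q)° =
  [set v : 'rV[R]_3 | [/\ 0 < v 0 0, 0 < v 0 1 & 0 < v 0 2 + gmean v]].
Proof.
apply/seteqP; split => v.
  rewrite power_coneE => /nbhs_ballP[e /= e0 H].
  (* A small step against each basis vector stays in the cone, which makes each inequality strict.
     The step in the third direction changes z but not [gmean]. *)
  have He i : [/\ 0 <= (v - (e / 2) *: std_basis R i) 0 0,
       0 <= (v - (e / 2) *: std_basis R i) 0 1 &
       0 <= (v - (e / 2) *: std_basis R i) 0 2 + gmean (v - (e / 2) *: std_basis R i)].
    apply: H; rewrite -ball_normE /ball_ /= opprB addrC subrK.
    apply: rV_norm_lt => // j; rewrite !mxE eqxx /=.
    by case: (j == i); rewrite /= ?mulr1 ?mulr0 ?normr0 // ger0_norm; lra.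
  split.
  - by have [+ _ _] := He 0; rewrite !mxE /=; lra.
  - by have [_ + _] := He 1; rewrite !mxE /=; lra.
  - by have [_ _] := He 2; rewrite /gmean !mxE /= mulr0 !subr0 mulr1; lra.
move=> /= H; rewrite /interior.
set U := [set v : 'rV[R]_3 | [/\ 0 < v 0 0, 0 < v 0 1 & 0 < v 0 2 + gmean v]] in H *.
suff oU : open U.
  apply: (@filterS _ _ _ U); last exact: open_nbhs_nbhs.
  by rewrite power_coneE => w [x0 y0 z0]; split; apply: ltW.
have -> : U =
   (fun v : 'rV[R]_3 => v 0 0) @^-1` [set x | 0 < x] `&`
   ((fun v : 'rV[R]_3 => v 0 1) @^-1` [set x | 0 < x] `&`
    (fun v => v 0 2 + gmean v) @^-1` [set x | 0 < x]).
  by apply/seteqP; split => w /=; [case|case=> ? []].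
apply: openI; first by apply: open_comp (@open_gt R 0) => w _; exact: coord_continuous.
apply: openI; first by apply: open_comp (@open_gt R 0) => w _; exact: coord_continuous.
by apply: open_comp (@open_gt R 0) => w _; exact: gmeanD_continuous.
Qed.

Lemma gmeanZ l v : 0 <= l -> 0 <= v 0 0 -> 0 <= v 0 1 -> gmean (l *: v) = l * gmean v.
Proof.
move=> l0 x0 y0; rewrite /gmean !mxE !pospowE ?mulr_ge0 // !powRM // mulrACA.
by rewrite -powRD ?pq1 ?powRr1 // oner_eq0.
Qed.

(** This is Hölder's inequality for sums of two terms, applied to the roots [x^(1/p)] and
    [y^(1/q)]. *)
Lemma gmeanD v w : 0 <= v 0 0 -> 0 <= v 0 1 -> 0 <= w 0 0 -> 0 <= w 0 1 ->
  gmean v + gmean w <= gmean (v + w).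
Proof.
move=> v0 v1 w0 w1.
rewrite /gmean !mxE !pospowE ?addr_ge0 //.
have K (r x : R) : 0 < r -> 0 <= x -> (x `^ r^-1) `^ r = x.
  by move=> r0 x0; rewrite -powRrM mulVf ?gt_eqF // powRr1.
have := hoelder2 (powR_ge0 (v 0 0) p^-1) (powR_ge0 (w 0 0) p^-1)
  (powR_ge0 (v 0 1) q^-1) (powR_ge0 (w 0 1) q^-1) p0 q0 pq1.
by rewrite !K.
Qed.

Lemma gmean_le_max v : 0 <= v 0 0 -> 0 <= v 0 1 -> gmean v <= Num.max (v 0 0) (v 0 1).
Proof.
move=> x0 y0; set M := Num.max _ _.
have M0 : 0 <= M by rewrite le_max x0.
have -> : M = pospow p^-1 M * pospow q^-1 M.
  by rewrite !pospowE // -powRD ?pq1 ?powRr1 // oner_eq0.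
by apply: ler_pM; rewrite ?pospow_ge0 // pospow_le ?invr_gt0 // le_max lexx ?orbT.
Qed.

Lemma power_coneZ l v : 0 < l -> power_cone p q v -> power_cone p q (l *: v).
Proof.
rewrite power_coneE => l0 [x0 y0 z0]; have l0' := ltW l0.
split; rewrite mxE; [exact: mulr_ge0|exact: mulr_ge0|].
by rewrite gmeanZ // -mulrDr mulr_ge0.
Qed.

Lemma power_coneD v w : power_cone p q v -> power_cone p q w -> power_cone p q (v + w).
Proof.
rewrite power_coneE => -[x0 y0 z0] [x1 y1 z1].
split; rewrite mxE; [exact: addr_ge0|exact: addr_ge0|].
by have := gmeanD x0 y0 x1 y1; lra.
Qed.

Lemma interior_power_coneZ l v : 0 < l -> (power_cone p q)° v -> (power_cone p q)° (l *: v).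
Proof.
rewrite interior_power_cone => l0 [x0 y0 z0]; split; rewrite ?mxE ?mulr_gt0 //.
by rewrite gmeanZ ?ltW // -mulrDr mulr_gt0.
Qed.

Lemma interior_power_coneD v w : (power_cone p q)° v -> (power_cone p q)° w ->
  (power_cone p q)° (v + w).
Proof.
rewrite interior_power_cone => -[x0 y0 z0] [x1 y1 z1].
split; rewrite mxE; [exact: addr_gt0|exact: addr_gt0|].
by have := gmeanD (ltW x0) (ltW y0) (ltW x1) (ltW y1); lra.
Qed.

Lemma cone_convex (A : set 'rV[R]_3) :
  (forall l v, 0 < l -> A v -> A (l *: v)) -> (forall v w, A v -> A w -> A (v + w)) ->
  @convex_set R 'rV[R]_3 A.
Proof.
move=> AZ AD x y l; rewrite !inE => Ax Ay.
rewrite /conv /=.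
have [l0 l1] : 0 <= l%:num /\ l%:num <= 1 by [].
have [E|l0'] := eqVneq l%:num 0.
  by rewrite E scale0r add0r /unstable.onem subr0 scale1r.
have [E|l1'] := eqVneq l%:num 1.
  by rewrite E scale1r /unstable.onem subrr scale0r addr0.
apply: AD; apply: AZ => //; first by rewrite lt_neqAle eq_sym l0'.
by rewrite /unstable.onem subr_gt0 lt_neqAle l1'.
Qed.

Lemma interior_power_cone1 : (power_cone p q)° (const_mx 1).
Proof.
rewrite interior_power_cone /=; split; rewrite ?mxE ?ltr01 //.
by rewrite ltr_wpDr ?gmean_ge0.
Qed.

(** The inequalities on x and y force the first two components of the direction to vanish. Then
    [gmean] is constant along the line, and the third inequality is affine as well. *)
Lemma power_cone_line v w : ~ (w != 0 /\ forall s : R, power_cone p q (v + s *: w)).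
Proof.
move=> [w0 H]; move/eqP: w0; apply.
have pinch (a b : R) : (forall s : R, 0 <= a + s * b) -> b = 0.
  move=> Hab; apply/eqP/negP => /negP b0.
  have := Hab (- (a + 1) / b); rewrite divfK //; lra.
have w0 : w 0 0 = 0.
  by apply: (@pinch (v 0 0)) => s; have := H s; rewrite power_coneE /= !mxE => -[].
have w1 : w 0 1 = 0.
  by apply: (@pinch (v 0 1)) => s; have := H s; rewrite power_coneE /= !mxE => -[].
have w2 : w 0 2 = 0.
  apply: (@pinch (v 0 2 + gmean v)) => s; have := H s.
  rewrite power_coneE /= => -[_ _]; rewrite /gmean !mxE w0 w1 !mulr0 !addr0; lra.
by apply/rowP; apply: ord3P; rewrite mxE.
Qed.

Lemma regular_power_cone : regular_cone (power_cone p q).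
Proof.
split.
- by move=> l x; exact: power_coneZ.
- by apply: cone_convex; [exact: power_coneZ|exact: power_coneD].
- exact: closed_power_cone.
- by exists (const_mx 1); exact: interior_power_cone1.
- by move=> [v [w [w0 H]]]; apply: (@power_cone_line v w).
Qed.

End Cone.

(** * Logarithmically homogeneous potentials *)

Lemma is_derive_comp_diff (R : realType) (V : normedModType R) (F : V -> R)
    (g : R -> V) (s : R) (w : V) :
  differentiable F (g s) -> is_derive s 1 g w ->
  is_derive s 1 (fun s => F (g s)) ('d F (g s) w).
Proof.
move=> DF [Dg gE].
have dg : differentiable g s by apply/derivable1_diffP.
have dFg : differentiable (F \o g) s by exact: differentiable_comp.
split; first by apply/derivable1_diffP.
rewrite deriveE // diff_comp //= -gE deriveE //.
Qed.

Section Potential.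
Context {R : realType}.
Variables (n : nat) (K : set 'rV[R]_n) (F : 'rV[R]_n -> R).
Implicit Types v w x : 'rV[R]_n.

Definition grad x i := 'D_(std_basis R i) F x.
Definition dF x v := \sum_i v 0 i * grad x i.
Definition bil x v w := \sum_i w 0 i * \sum_j v 0 j * hessian F x j i.

Lemma dFE x v : differentiable F x -> 'd F x v = dF x v.
Proof.
move=> DF; rewrite {1}(row_sum_delta v) linear_sum; apply: eq_bigr => i _.
by rewrite linearZ /= /grad deriveE.
Qed.

Lemma dFD x v w : dF x (v + w) = dF x v + dF x w.
Proof. by rewrite /dF -big_split; apply: eq_bigr => i _; rewrite mxE mulrDl. Qed.

Lemma dFZ x l v : dF x (l *: v) = l * dF x v.
Proof. by rewrite /dF mulr_sumr; apply: eq_bigr => i _; rewrite mxE mulrA. Qed.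

Lemma bilDl x v v' w : bil x (v + v') w = bil x v w + bil x v' w.
Proof.
rewrite /bil -big_split; apply: eq_bigr => i _ /=.
rewrite -mulrDr -big_split; congr (_ * _); apply: eq_bigr => j _ /=.
by rewrite mxE mulrDl.
Qed.

Lemma bilDr x v w w' : bil x v (w + w') = bil x v w + bil x v w'.
Proof. by rewrite /bil -big_split; apply: eq_bigr => i _ /=; rewrite mxE mulrDl. Qed.

Lemma bilZl x l v w : bil x (l *: v) w = l * bil x v w.
Proof.
rewrite /bil mulr_sumr; apply: eq_bigr => i _ /=.
rewrite mulrCA; congr (_ * _); rewrite mulr_sumr; apply: eq_bigr => j _.
by rewrite mxE mulrA.
Qed.

Lemma bilZr x l v w : bil x v (l *: w) = l * bil x v w.
Proof. by rewrite /bil mulr_sumr; apply: eq_bigr => i _ /=; rewrite mxE mulrA. Qed.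

Lemma bilE x v w : bil x v w = (v *m hessian F x *m w^T) 0 0.
Proof.
rewrite /bil mxE; apply: eq_bigr => i _; rewrite !mxE mulrC; congr (_ * _).
Qed.

Lemma qform_bil x v : qform (hessian F x) v = bil x v v.
Proof. by rewrite bilE. Qed.

Hypotheses (Fpot : canonical_potential K F)
  (KZ : forall l v, 0 < l -> K° v -> K° (l *: v)).

Lemma pot_diff x : K° x -> differentiable F x.
Proof. by case: Fpot => -[S _ _ _] _ Kx; exact: (S [::]). Qed.

Lemma grad_diff i x : K° x -> differentiable (fun x => grad x i) x.
Proof. by case: Fpot => -[S _ _ _] _ Kx; exact: (S [:: std_basis R i]). Qed.

Lemma bil_sym x v w : K° x -> bil x v w = bil x w v.
Proof.
case: Fpot => -[_ _ P _] _ Kx; have [HT _] := P _ Kx.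
rewrite !bilE.
have -> : (w *m hessian F x *m v^T) = (v *m hessian F x *m w^T)^T.
  by rewrite !trmx_mul trmxK HT mulmxA.
by rewrite [RHS]mxE.
Qed.

Lemma bil_gt0 x v : K° x -> v != 0 -> 0 < bil x v v.
Proof.
case: Fpot => -[_ _ P _] _ Kx v0; have [_] := P _ Kx.
by move=> /(_ v v0); rewrite qform_bil.
Qed.

Lemma bil_ge0 x v : K° x -> 0 <= bil x v v.
Proof.
move=> Kx; have [->|/(bil_gt0 Kx)/ltW//] := eqVneq v 0.
by rewrite /bil big1 // => i _; rewrite mxE mul0r.
Qed.

Lemma is_derive_pot (g : R -> 'rV[R]_n) (s : R) w : K° (g s) -> is_derive s 1 g w ->
  is_derive s 1 (fun s => F (g s)) (dF (g s) w).
Proof.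
move=> Kg Dg; rewrite -dFE; last exact: pot_diff.
by apply: is_derive_comp_diff => //; exact: pot_diff.
Qed.

Lemma is_derive_grad (g : R -> 'rV[R]_n) (s : R) w i : K° (g s) -> is_derive s 1 g w ->
  is_derive s 1 (fun s => grad (g s) i) (\sum_j w 0 j * hessian F (g s) j i).
Proof.
move=> Kg Dg.
have DG := grad_diff i Kg.
have := is_derive_comp_diff DG Dg; congr is_derive.
rewrite {1}(row_sum_delta w) linear_sum; apply: eq_bigr => j _.
by rewrite linearZ /= -deriveE // mxE.
Qed.

Lemma is_derive_bigsum (I : finType) (f : I -> R -> R) (d : I -> R) (s : R) :
  (forall i, is_derive s 1 (f i) (d i)) ->
  is_derive s 1 (fun s => \sum_i f i s) (\sum_i d i).
Proof.
move=> H.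
suff G r : is_derive s 1 (fun s => \sum_(i <- r) f i s) (\sum_(i <- r) d i) by exact: G.
elim: r => [|i r IH].
  rewrite big_nil (_ : (fun _ => _) = (fun=> 0)); first exact: isd_cst.
  by apply/funext => y; rewrite big_nil.
rewrite big_cons (_ : (fun _ => _) = (fun s => f i s + \sum_(j <- r) f j s)).
  by apply: isd_add.
by apply/funext => y; rewrite big_cons.
Qed.

Lemma is_derive_dF (g w : R -> 'rV[R]_n) (s : R) g' w' : K° (g s) -> is_derive s 1 g g' ->
  is_derive s 1 w w' ->
  is_derive s 1 (fun s => dF (g s) (w s)) (dF (g s) w' + bil (g s) g' (w s)).
Proof.
move=> Kg Dg Dw; rewrite /dF /bil -big_split /=.
apply: is_derive_bigsum => i.
have Dwi : is_derive s 1 (fun s => w s 0 i) (w' 0 i) by move/is_derive_rowP: Dw; apply.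
have Dgi := is_derive_grad i Kg Dg.
by notypeclasses refine (isd_eq (isd_mul Dwi Dgi) _); rewrite addrC; congr (_ + _); rewrite mulrC.
Qed.

Lemma is_derive_ray (x v : 'rV[R]_n) (s : R) : is_derive s 1 (fun s => x + s *: v) v.
Proof.
apply/is_derive_rowP => i.
rewrite (_ : (fun _ => _) = (fun s => x 0 i + s * v 0 i)).
  by der_eq; rewrite mulr0 mulr1 !add0r.
by apply/funext => r; rewrite !mxE.
Qed.

(** Euler's relation, the derivative at [s = 0] of logarithmic homogeneity along [(1 + s) x]. *)
Lemma euler x : K° x -> dF x x = - n%:R.
Proof.
move=> Kx.
have D1 : is_derive (0 : R) 1 (fun s => F (x + s *: x)) (dF x x).
  have := @is_derive_pot (fun s => x + s *: x) 0 x.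
  by rewrite scale0r addr0 => /(_ Kx (is_derive_ray x x 0)).
have D2 : is_derive (0 : R) 1 (fun s : R => F x - n%:R * ln (1 + s)) (- n%:R).
  by der_eq; rewrite ?addr0 // invr1; ring.
have U : open [set s : R | -1 < s] by exact: open_gt.
have D3 := @isd_near _ _ _ _ _ (0 : R) (1 : R) (dF x x) [set s : R | -1 < s] U _ _ D1.
apply: is_derive_unique (D3 _ _ _) D2 => /=; first lra.
move=> s s1; case: Fpot => _ L; rewrite -L //; last lra.
by rewrite scalerDl scale1r.
Qed.

(** Obtained by differentiating Euler's relation in the direction [w]. *)
Lemma euler2 x w : K° x -> bil x w x = - dF x w.
Proof.
move=> Kx.
have Dr := is_derive_ray x w 0.
have Kx' : K° (x + 0 *: w) by rewrite scale0r addr0.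
have := @is_derive_dF _ _ 0 w w Kx' Dr Dr; rewrite scale0r addr0 => D1.
have D2 : is_derive (0 : R) 1 (fun s : R => - n%:R : R) 0 by exact: isd_cst.
have oK : open K° by exact: open_interior.
have : \forall s \near (0 : R), - n%:R = dF (x + s *: w) (x + s *: w).
  have cr : {for (0 : R), continuous (fun s : R => x + s *: w)}.
    by apply/differentiable_continuous/derivable1_diffP; case: Dr.
  have : \forall s \near (0 : R), K° (x + s *: w).
    by apply: cr; rewrite /= scale0r addr0; exact: open_nbhs_nbhs.
  by apply: filterS => s Ks; rewrite euler.
move=> /near_eq_is_derive/(_ D2) D3.
have := is_derive_unique D1 D3; lra.
Qed.

Lemma euler3 x : K° x -> bil x x x = n%:R.
Proof. by move=> Kx; rewrite euler2 // euler // opprK. Qed.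

(** The expression is the Hessian evaluated at [w + (dF w / 3) x], the projection of [w] along [x]
    onto the kernel of [dF], since [dF x x = -3]. *)
Lemma bil_reduced_ge0 x w : n%:R = 3 :> R -> K° x -> 0 <= bil x w w - dF x w ^+ 2 / 3.
Proof.
move=> n3 Kx; have := bil_ge0 (w + (dF x w / 3) *: x) Kx.
rewrite bilDl !bilDr !bilZl !bilZr euler3 // [bil x x w]bil_sym // euler2 // n3.
by lra.
Qed.

(* For a potential on R^3, homogeneous of degree 1 on the cone; extended by 0
   it becomes continuous on the whole space. *)
Definition Epot x := if asbool (K° x) then expR (- F x / 3) else 0.

Lemma EpotE x : K° x -> Epot x = expR (- F x / 3).
Proof. by move=> Kx; rewrite /Epot asboolT. Qed.

Lemma Epot0 x : ~ K° x -> Epot x = 0.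
Proof. by move=> Kx; rewrite /Epot asboolF. Qed.

Lemma Epot_ge0 x : 0 <= Epot x.
Proof. by rewrite /Epot; case: ifP => // _; exact: expR_ge0. Qed.

Lemma EpotZ l x : n%:R = 3 :> R -> 0 < l -> Epot (l *: x) = l * Epot x.
Proof.
move=> n3 l0; have [Kx|nKx] := pselect (K° x).
  rewrite !EpotE //; last exact: KZ.
  case: Fpot => _ L; rewrite L // -[in RHS](lnK (_ : l \is Num.pos)) ?posrE // -expRD n3.
  by congr expR; field.
rewrite !Epot0 ?mulr0 // => Kl; apply: nKx.
rewrite -[x]scale1r -(mulVf (lt0r_neq0 l0)) -scalerA; apply: KZ => //.
by rewrite invr_gt0.
Qed.

(** At boundary points [F] tends to infinity from inside and [Epot] vanishes outside the interior,
    so the two definitions match; off [K] the function is locally 0, as [K] is closed. *)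
Lemma Epot_continuous : closed K -> continuous Epot.
Proof.
move=> cK x; have oK : open K° by exact: open_interior.
have [Kx|nKx] := pselect (K° x).
  have E : {near x, (fun x => expR (- F x / 3)) =1 Epot}.
    apply: filterS (open_nbhs_nbhs (conj oK Kx)) => y Ky.
    by rewrite EpotE.
  rewrite /continuous_at -(nbhs_singleton E).
  apply: cvg_trans; first exact: (near_eq_cvg E).
  apply: (@continuous_comp _ _ _ (fun x => - F x / 3) expR); last exact: continuous_expR.
  apply: (@continuousM _ _ (fun x => - F x) (fun=> 3^-1)); last exact: cst_continuous.
  by apply: (@continuousN _ _ _ F); apply: differentiable_continuous; exact: pot_diff.
rewrite /continuous_at Epot0 //; apply/(@cvgrPdist_lt _ _ _ (nbhs x)) => e e0.
have [Kx|nK] := pselect (K x).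
  case: Fpot => -[_ _ _ B] _.
  (* The threshold is the value of [F] at which [expR (- F / 3)] equals [e / 2]. *)
  have /B/cvgryPge/(_ (- 3 * ln (e / 2))) : boundary K x.
    by split=> //; apply: subset_closure.
  rewrite near_withinE; apply: filterS => y Hy.
  rewrite sub0r normrN ger0_norm ?Epot_ge0 //.
  have [Ky|nKy] := pselect (K° y); last by rewrite Epot0.
  rewrite EpotE //; have := Hy Ky => L.
  apply: (@le_lt_trans _ _ (e / 2)); last lra.
  rewrite -[leRHS]lnK ?posrE ?divr_gt0 // ler_expR; lra.
have : open (~` K) by rewrite openC.
move=> oC; apply: filterS (open_nbhs_nbhs (conj oC (nK : (~` K) x))) => y Cy.
by rewrite Epot0 ?subrr ?normr0 // => /interior_subset.
Qed.

(** A positive value inside the segment would force a positive slope before it and a negative slope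
    after it, whereas the slope is nondecreasing because the Hessian is positive. *)
Lemma pot_convex x y (s : R) : (forall s : R, 0 <= s <= 1 -> K° (x + s *: (y - x))) ->
  0 <= s <= 1 -> F x <= 0 -> F y <= 0 -> F (x + s *: (y - x)) <= 0.
Proof.
move=> HK s01 Fx Fy.
pose g r := x + r *: (y - x).
rewrite leNgt; apply/negP => Fs.
have s0 : 0 < s.
  rewrite lt_neqAle (andP s01).1 andbT; apply/eqP => E.
  by move: Fs; rewrite -E scale0r addr0; lra.
have s1 : s < 1.
  rewrite lt_neqAle (andP s01).2 andbT; apply/eqP => E.
  by move: Fs; rewrite E scale1r addrC subrK; lra.
have Dg (r : R) : is_derive r 1 g (y - x) by exact: is_derive_ray.
have DF (r : R) : 0 <= r <= 1 -> is_derive r 1 (fun r => F (g r)) (dF (g r) (y - x)).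
  by move=> r01; apply: is_derive_pot => //; exact: HK.
have D2 (r : R) : 0 <= r <= 1 ->
    is_derive r 1 (fun r => dF (g r) (y - x)) (bil (g r) (y - x) (y - x)).
  move=> r01; have Dc : is_derive r 1 (fun _ : R => y - x) 0 by exact: is_derive_cst.
  notypeclasses refine (isd_eq (is_derive_dF (HK _ r01) (Dg r) Dc) _).
  by rewrite /dF big1 ?add0r // => i _; rewrite mxE mul0r.
have [a] : exists2 a, a \in `]0, s[%R & F (g s) - F (g 0) = dF (g a) (y - x) * (s - 0).
  apply: (@MVT _ (fun r => F (g r))) => // [r|].
    by rewrite in_itv /= => r01; apply: DF; lra.
  apply: derivable_within_continuous => r; rewrite in_itv /= => r01.
  by case: (@DF r) => //; lra.
rewrite in_itv /= => a0s Ea.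
have [b] : exists2 b, b \in `]s, 1[%R & F (g 1) - F (g s) = dF (g b) (y - x) * (1 - s).
  apply: (@MVT _ (fun r => F (g r))) => // [r|].
    by rewrite in_itv /= => r01; apply: DF; lra.
  apply: derivable_within_continuous => r; rewrite in_itv /= => r01.
  by case: (@DF r) => //; lra.
rewrite in_itv /= => bs1 Eb.
have ab : a < b by lra.
have [c] : exists2 c, c \in `]a, b[%R &
    dF (g b) (y - x) - dF (g a) (y - x) = bil (g c) (y - x) (y - x) * (b - a).
  apply: (@MVT _ (fun r => dF (g r) (y - x))) => // [r|].
    by rewrite in_itv /= => r01; apply: D2; lra.
  apply: derivable_within_continuous => r; rewrite in_itv /= => r01.
  by case: (@D2 r) => //; lra.
rewrite in_itv /= => abc Ec.
have g0 : g 0 = x by rewrite /g scale0r addr0.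
have g1 : g 1 = y by rewrite /g scale1r addrC subrK.
have B0 : 0 <= bil (g c) (y - x) (y - x) by apply: bil_ge0; apply: HK; lra.
have B1 : 0 <= bil (g c) (y - x) (y - x) * (b - a) by apply: mulr_ge0 => //; lra.
rewrite g0 in Ea; rewrite g1 in Eb.
have Fgs : 0 < F (g s) by [].
have A1 : 0 < dF (g a) (y - x).
  by rewrite -(@pmulr_lgt0 _ (s - 0)); lra.
have A2 : dF (g b) (y - x) < 0.
  by rewrite -(@pmulr_llt0 _ (1 - s)); lra.
lra.
Qed.

End Potential.

(** * The surface is the zero level set *)

Lemma is_derive_along (R : realType) (V W : normedModType R) (f : V -> W) (x v : V)
    (s : R) df :
  is_derive (x + s *: v) v f df -> is_derive s 1 (fun s : R => f (x + s *: v)) df.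
Proof.
move=> /is_derive_line D; apply/is_derive_line; move: D; congr is_derive.
apply/funext => r; congr f.
by rewrite scalerDl addrA /GRing.scale /= mulr1.
Qed.

Lemma ln_le (R : realType) (x y : R) : 0 < x -> x <= y -> ln x <= ln y.
Proof. by move=> x0 xy; rewrite ler_ln ?posrE // (lt_le_trans x0). Qed.

Lemma mul3_le (R : realType) (x y z x' y' z' : R) : 0 <= x -> 0 <= y -> 0 <= z ->
  x <= x' -> y <= y' -> z <= z' -> x * y * z <= x' * y' * z'.
Proof. by move=> x0 y0 z0 xx yy zz; rewrite !ler_pM ?mulr_ge0. Qed.

Section PowerSurface.
Context {R : realType}.
Variables g h a b c p q : R.
Hypothesis pp : profile_params g h a b.
Hypotheses (cE : 3 * c - 1 = q^-1) (pE : p^-1 = h / a) (qE : q^-1 = g / a).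

Let tX := t_xi g h a b.
Let tX1 := dt_xi g h a b.
Let mX := m_xi g h a b.
Let mX1 := dm_xi g h a b.
Let fX := phi_xi g h a b.
(** The second derivative of t affects only the tangential part of the Gauss formula and not [form],
    so it is left without a closed formula. *)
Definition tX2 (x : R) : R := 'D_1 (tX1 : R -> R) x.
Definition X := surf c tX fX.
Definition dX := dsurf c tX tX1 mX fX.
Definition Q := form c tX tX1 mX mX1.

Implicit Types u v w : 'rV[R]_2.

Lemma pX : profile tX tX1 tX2 mX mX1 fX.
Proof.
split=> x x0.
- exact: is_derive_t_xi.
- have [t2 [D1 D2]] := derivable_dt_xi pp x0.
  exact: derivableP.
- exact: is_derive_m_xi.
- exact: is_derive_phi_xi.
- by rewrite lt_eqF // dt_xi_lt0.
Qed.

Lemma pq1 : p^-1 + q^-1 = 1.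
Proof. by rewrite pE qE (gh_over_a pp). Qed.

Lemma p_gt0 : 0 < p.
Proof. by rewrite -invr_gt0 pE divr_gt0 ?(h_gt0 pp) //; have := a_ge2 pp; lra. Qed.

Lemma q_gt0 : 0 < q.
Proof. by rewrite -invr_gt0 qE divr_gt0 ?(pp_g pp) //; have := a_ge2 pp; lra. Qed.

Lemma pcE : p^-1 = 2 - 3 * c.
Proof. by apply: (addIr q^-1); rewrite pq1 -cE; ring. Qed.

Lemma gauss_kE : gauss_k c = (a ^+ 2)^-1.
Proof.
have a0 : a != 0 by have := a_ge2 pp => a2; rewrite gt_eqF //; lra.
rewrite /gauss_k -pcE.
by rewrite cE pE qE mulf_div (gh1 pp) expr2 mul1r.
Qed.

Lemma c3E : 9 * (1 - 2 * c) ^+ 2 = 1 - 4 / a ^+ 2.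
Proof. by rewrite -gauss_kE /gauss_k; ring. Qed.

Lemma mtX x : 0 < x -> tX x * mX x = (sq b x) ^+ 2 - a ^+ 2.
Proof. by move=> x0; rewrite /tX /mX /t_xi /m_xi tS_mS. Qed.

Lemma f1_neq0 x : 0 < x -> mX x * tX1 x != 0.
Proof.
move=> x0; rewrite /mX /tX1 m_dt_xi // gt_eqF //.
have bs := sq_gt pp x0; have s0 := bs_gt0 pp bs; have a2 := a_ge2 pp.
have W0 := ratW_gt0 pp bs; have a0 : 0 < a by lra.
by apply: divr_gt0; apply: mulr_gt0 => //; apply: addr_gt0.
Qed.

Lemma Q11E x : 0 < x ->
  mX1 x * tX1 x - (mX x * tX1 x) ^+ 2 / 3 = ratA a b (sq b x) * (mX x * tX1 x) ^+ 2.
Proof.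
move=> x0; have bs := sq_gt pp x0; have s0 := bs_gt0 pp bs.
have E := ratQ11 pp bs.
have -> : mX1 x * tX1 x = ratW a b (sq b x) * ratV a b (sq b x) * ((2 * sq b x)^-1) ^+ 2.
  rewrite /mX1 /tX1 /dm_xi /dt_xi.
  set e := psi _ _ _ _ _.
  have E1 : expR e * expR (- e) = 1 by rewrite -expRD subrr expR0.
  by rewrite -[RHS]mul1r -E1; ring.
rewrite /mX /tX1 m_dt_xi //.
have -> : ((sq b x + a) * ratW a b (sq b x) * (2 * sq b x)^-1) ^+ 2 =
  ((sq b x + a) * ratW a b (sq b x)) ^+ 2 * ((2 * sq b x)^-1) ^+ 2 by rewrite exprMn.
by rewrite [RHS]mulrA -E; ring.
Qed.

Lemma Q22E x : 0 < x -> 3 * c * (1 - c) + gauss_k c * tX x * mX x = ratC a b (sq b x).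
Proof.
move=> x0; rewrite -(mulrA (gauss_k c)) mtX //.
have a0 : a != 0 by have := a_ge2 pp => a2; rewrite gt_eqF //; lra.
have -> : 3 * c * (1 - c) = (2 + gauss_k c) / 3 by rewrite /gauss_k; field.
by rewrite gauss_kE /ratC (pp_b2 pp); field.
Qed.

Lemma QE u v w : 0 < u 0 0 -> Q u v w =
  ratA a b (sq b (u 0 0)) * ((mX (u 0 0) * tX1 (u 0 0)) ^+ 2 * (v 0 0 * w 0 0))
  - (1 - 2 * c) * (mX (u 0 0) * tX1 (u 0 0)) * (v 0 0 * w 0 1 + v 0 1 * w 0 0)
  + ratC a b (sq b (u 0 0)) * (v 0 1 * w 0 1).
Proof. by move=> u0; rewrite /Q /form /f1 Q11E // Q22E //; ring. Qed.

Lemma Q_lb u v : 0 < u 0 0 ->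
  ((mX (u 0 0) * tX1 (u 0 0) * v 0 0) ^+ 2 + v 0 1 ^+ 2) / 20 <= Q u v v.
Proof.
move=> u0; rewrite QE //; have bs := sq_gt pp u0.
have A := ratA_ge pp bs; have C := ratC_ge pp bs.
have c3 := c3E; have k0 : 0 <= 4 / a ^+ 2 by rewrite divr_ge0 ?sqr_ge0.
set d := mX (u 0 0) * tX1 (u 0 0); set A' := ratA _ _ _ in A *; set C' := ratC _ _ _ in C *.
set y := v 0 1; set x := v 0 0.
set e := 1 - 2 * c in c3 *.
have E1 : 3^-1 * (d * x) ^+ 2 <= A' * (d * x) ^+ 2 by rewrite ler_wpM2r ?sqr_ge0.
have E2 : 2^-1 * y ^+ 2 <= C' * y ^+ 2 by rewrite ler_wpM2r ?sqr_ge0.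
have E3 : 2 * e * (d * x) * y <= 3 * e ^+ 2 * y ^+ 2 + 3^-1 * (d * x) ^+ 2.
  by have := sqr_ge0 (3 * e * y - d * x); lra.
have e1 : 9 * e ^+ 2 <= 1 by lra.
(* Here [17/60 = 1/3 - 1/20] and [9/20 = 1/2 - 1/20], which leaves 1/20 of each square. It works
   since [9 e^2 <= 1] gives [60/17 e^2 <= 60/153 < 9/20]. *)
have E4 : 2 * e * (d * x) * y <= 17 / 60 * (d * x) ^+ 2 + 9 / 20 * y ^+ 2.
  have := sqr_ge0 (60 / 17 * e * y - d * x).
  have : 9 * e ^+ 2 * y ^+ 2 <= 1 * y ^+ 2 by rewrite ler_wpM2r ?sqr_ge0.
  by have := sqr_ge0 y; lra.
by rewrite !expr2 in E1 E2 E4 *; lra.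
Qed.

Lemma Q_det u (v w : 'rV[R]_2) : 0 < u 0 0 ->
  3 * (Q u v v * Q u w w - Q u v w ^+ 2) =
  (expR (fX (u 0 0)) * tX1 (u 0 0) * (v 0 0 * w 0 1 - v 0 1 * w 0 0)) ^+ 2.
Proof.
move=> u0; rewrite !QE //; have bs := sq_gt pp u0; have s0 := bs_gt0 pp bs.
have E := ratAC_det pp bs c3E.
rewrite /fX /phi_xi (expR_fS pp s0).
have -> : mX (u 0 0) = - (sq b (u 0 0) + a) * expR (psi g h a b (sq b (u 0 0))) by [].
set A := ratA _ _ _ in E *; set C := ratC _ _ _ in E *; set k := 1 - 2 * c in E *.
set ex := expR _; set s := sq _ _ in E s0 *; set t := tX1 _.
transitivity (3 * (A * C - k ^+ 2) * ((s + a) * ex * t * (v 0 0 * w 0 1 - v 0 1 * w 0 0)) ^+ 2).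
  by ring.
rewrite E; have a2 := a_ge2 pp.
by field; rewrite !gt_eqF //; lra.
Qed.

Notation K := (power_cone p q).

Lemma X0 u : X u 0 0 = sx c fX u. Proof. by rewrite /X /surf row3E. Qed.
Lemma X1 u : X u 0 1 = sy c fX u. Proof. by rewrite /X /surf row3E. Qed.
Lemma X2 u : X u 0 2 = sr c fX u * tX (u 0 0). Proof. by rewrite /X /surf row3E. Qed.
Lemma sx_gt0 u : 0 < sx c fX u. Proof. exact: expR_gt0. Qed.
Lemma sy_gt0 u : 0 < sy c fX u. Proof. exact: expR_gt0. Qed.
Lemma sr_gt0 u : 0 < sr c fX u. Proof. exact: expR_gt0. Qed.

Lemma gmean_X u : gmean p q (X u) = sr c fX u.
Proof.
rewrite /gmean X0 X1 !pospowE ?expR_ge0 // /sx /sy /sr -!expRM -expRD; congr expR.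
by rewrite pcE -cE; field.
Qed.

Lemma X_interior u : 0 < u 0 0 -> K° (X u).
Proof.
move=> u0; rewrite interior_power_cone ?p_gt0 ?q_gt0 //=.
split; [by rewrite X0 sx_gt0|by rewrite X1 sy_gt0|].
have := t_xi_gtN1 pp u0; rewrite gmean_X X2 -/(tX (u 0 0)) => t1.
by have := sr_gt0 u => r0; rewrite -[X in _ + X]mulr1 -mulrDr mulr_gt0 //; lra.
Qed.

(** The ratios [z / gmean] and [x / y] are constant on rays and equal [t(xi)] and [e^mu] on the
    surface. Interior points have [z / gmean > -1], and t takes every value above -1. *)
Lemma cone_ray (v : 'rV[R]_3) : K° v -> exists l u, [/\ 0 < l, 0 < u 0 0 & v = l *: X u].
Proof.
rewrite interior_power_cone ?p_gt0 ?q_gt0 //= => -[x0 y0 z0].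
have r0 := gmean_gt0 p q x0 y0.
have t1 : - 1 < v 0 2 / gmean p q v by rewrite ltr_pdivlMr //; lra.
have [xi xi0 Et] := t_xi_onto pp t1.
pose u : 'rV[R]_2 := \row_(i < 2) [:: xi; ln (v 0 0) - ln (v 0 1)]`_i.
have u0 : u 0 0 = xi by rewrite mxE.
have u1 : u 0 1 = ln (v 0 0) - ln (v 0 1) by rewrite mxE.
pose l := v 0 0 / sx c fX u.
have l0 : 0 < l by rewrite divr_gt0 // sx_gt0.
exists l, u; split; rewrite ?u0 //.
have E0 : v 0 0 = l * sx c fX u by rewrite /l divfK // gt_eqF // sx_gt0.
have E1 : v 0 1 = l * sy c fX u.
  have Es : sx c fX u = sy c fX u * (v 0 0 / v 0 1).
    have -> : v 0 0 / v 0 1 = expR (u 0 1) by rewrite u1 expRB !lnK.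
    by rewrite /sx /sy -expRD; congr expR; ring.
  by rewrite /l Es; field; rewrite !gt_eqF // sy_gt0.
have E2 : gmean p q v = l * sr c fX u.
  rewrite -gmean_X -gmeanZ ?pq1 ?ltW //; last first.
  - by rewrite X1 sy_gt0.
  - by rewrite X0 sx_gt0.
  have e0 : (l *: X u) 0 0 = v 0 0 by rewrite mxE X0 -E0.
  have e1 : (l *: X u) 0 1 = v 0 1 by rewrite mxE X1 -E1.
  by rewrite /gmean e0 e1.
apply: row3P; rewrite !mxE /=; [exact: E0|exact: E1|].
by rewrite mulrA -E2 /tX Et mulrC divfK // gt_eqF.
Qed.

(* A linear form that is comparable to the norm on K. *)
Definition ell (v : 'rV[R]_3) := 2 * (v 0 0 + v 0 1) + v 0 2.

(** On the cone [z >= - gmean >= - (x + y)]; of the coefficient 2 in [ell], one half absorbs a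
    negative z and the other leaves [x + y]. *)
Lemma ell_bound (v : 'rV[R]_3) : K v ->
  [/\ 0 <= v 0 0, 0 <= v 0 1, v 0 0 + v 0 1 <= ell v & `|v 0 2| <= ell v].
Proof.
rewrite power_coneE => -[x0 y0 z0].
have : gmean p q v <= v 0 0 + v 0 1.
  apply: le_trans (gmean_le_max p_gt0 q_gt0 pq1 x0 y0) _.
  by rewrite ge_max; lra.
by move=> G; rewrite /ell ler_norml; split=> //; [|apply/andP; split]; lra.
Qed.

Lemma ell_X_gt0 u : 0 < u 0 0 -> 0 < ell (X u).
Proof.
move=> u0; have [_ _ L _] := ell_bound (interior_subset (X_interior u0)).
by have := sx_gt0 u; have := sy_gt0 u; move: L; rewrite X0 X1; lra.
Qed.

Lemma ellD (v w : 'rV[R]_3) : ell (v + w) = ell v + ell w.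
Proof. by rewrite /ell !mxE; ring. Qed.

Lemma ellZ l (v : 'rV[R]_3) : ell (l *: v) = l * ell v.
Proof. by rewrite /ell !mxE; ring. Qed.

Lemma is_derive_ell (f : R -> 'rV[R]_3) (s : R) f' :
  is_derive s 1 f f' -> is_derive s 1 (fun s => ell (f s)) (ell f').
Proof.
move=> /is_derive_rowP D; have D0 := D 0; have D1 := D 1; have D2 := D 2.
by rewrite /ell; der_eq; rewrite mulr0 addr0.
Qed.

(** * Comparison of the potential with the surface at an extremum *)

Variable F : 'rV[R]_3 -> R.
Hypothesis Fpot : canonical_potential K F.
Notation E := (Epot K F).

Lemma det_rows (A : 'M[R]_3) (H : 'M[R]_3) : \det (A *m H *m A^T) = \det A ^+ 2 * \det H.
Proof. by rewrite !det_mulmx det_tr; ring. Qed.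

(** The Gram matrix of [X], [V], [W] for the Hessian has determinant [det(X, V, W)^2 e^(2F)]. By
    Euler's relations its first row is [(3, - dF V, - dF W)], and the left-hand side is 3 times the
    determinant of the Schur complement of the entry 3. *)
Lemma det_reduced u v w : 0 < u 0 0 ->
  let x := X u in let V := dX u v in let W := dX u w in
  3 * ((bil F x V V - dF F x V ^+ 2 / 3) * (bil F x W W - dF F x W ^+ 2 / 3)
       - (bil F x V W - dF F x V * dF F x W / 3) ^+ 2) =
  (expR (fX (u 0 0)) * tX1 (u 0 0) * (v 0 0 * w 0 1 - v 0 1 * w 0 0)) ^+ 2
  * expR (2 * F x).
Proof.
move=> u0 x V W; have Kx : K° x := X_interior u0.
have [[_ MA _ _] _] := Fpot.
rewrite -(MA _ Kx) -(det_surf c tX tX1 mX fX) -det_rows.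
set A := \matrix_(i < 3) _.
have AE i j : (A *m hessian F x *m A^T) i j = bil F x (row i A) (row j A).
  rewrite bilE -row_mul !mxE; apply: eq_bigr => k _.
  by rewrite !mxE.
have r0 : row 0 A = x by apply/rowP => k; rewrite !mxE.
have r1 : row 1 A = V by apply/rowP => k; rewrite !mxE.
have r2 : row 2 A = W by apply/rowP => k; rewrite !mxE.
rewrite det_mx33E !AE r0 r1 r2 (euler3 Fpot) //.
rewrite [bil F x x V](bil_sym Fpot) // [bil F x x W](bil_sym Fpot) //.
rewrite !(euler2 Fpot) // [bil F x W V](bil_sym Fpot) //.
by field.
Qed.

Lemma surf_line_derive u v (s : R) : 0 < (u + s *: v) 0 0 ->
  is_derive s 1 (fun s : R => X (u + s *: v)) (dX (u + s *: v) v).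
Proof. by move=> us; apply: is_derive_along; exact: (is_derive_surf c pX). Qed.

Lemma dX_line_derive u v : 0 < u 0 0 ->
  is_derive (0 : R) 1 (fun s : R => dX (u + s *: v) v)
    (dX u (gamma c tX tX1 tX2 mX u v v) + (Q u v v / 3) *: X u).
Proof.
move=> u0; rewrite /dX /X /Q -(gauss_formula c pX) //.
apply: (@is_derive_along _ _ _ (fun u => dsurf c tX tX1 mX fX u v)).
rewrite scale0r addr0; exact: (is_derive_dsurf c pX).
Qed.

(* At an extremum of [E - 1 - c0 * ell] along the surface the quadratic forms
   [Q / E] and [Hess F - dF^2 / 3] are comparable, hence so are their
   determinants, which are known: their ratio is a power of [E]. *)
Lemma no_extremum sg u c0 : 0 < u 0 0 -> (sg = 1 \/ sg = -1) -> 0 < sg * c0 ->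
  E (X u) - 1 = c0 * ell (X u) ->
  (forall w, 0 < w 0 0 -> sg * (E (X w) - 1 - c0 * ell (X w)) <= 0) -> False.
Proof.
move=> u0 sg1 c00 Eu Hmax.
have Kx := X_interior u0.
set x := X u in Eu Kx.
pose ex := expR (- F x / 3).
have ex0 : 0 < ex by exact: expR_gt0.
have exE : E x = ex by rewrite EpotE.
have n3 : 3%:R = 3 :> R by [].
have sg0 : sg != 0 by case: sg1 => ->; rewrite ?oppr_eq0 oner_eq0.
pose w' v := dX u (gamma c tX tX1 tX2 mX u v v) + (Q u v v / 3) *: x.
have key v : ex * dF F x (dX u v) / 3 + c0 * ell (dX u v) = 0 /\
    sg * (ex * (- (dF F x (w' v) + bil F x (dX u v) (dX u v)) / 3)
       + (- dF F x (dX u v) / 3) * (ex * (- dF F x (dX u v) / 3)) - c0 * ell (w' v)) <= 0.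
  pose y (s : R) := u + s *: v.
  pose ph (s : R) := sg * (expR (- F (X (y s)) / 3) - 1 - c0 * ell (X (y s))).
  pose ph1 (s : R) := sg * (expR (- F (X (y s)) / 3) * (- dF F (X (y s)) (dX (y s) v) / 3)
     - c0 * ell (dX (y s) v)).
  (* For parameters below this bound the line [u + s *: v] stays in the half plane. *)
  pose e := u 0 0 / (`|v 0 0| + 1).
  have e0 : 0 < e by rewrite divr_gt0 // ltr_wpDl.
  have ye s : `|s| < e -> 0 < y s 0 0.
    move=> se; rewrite /y !mxE.
    have : `|s * v 0 0| < u 0 0.
      rewrite normrM; apply: (@le_lt_trans _ _ (`|s| * (`|v 0 0| + 1))).
        by rewrite ler_wpM2l // lerDl.
      by rewrite -ltr_pdivlMr // ltr_wpDl.
    by move/ltr_normlP => [+ _]; lra.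
  have y0 : y 0 = u by rewrite /y scale0r addr0.
  have Dph (s : R) : `|s| < e -> is_derive s 1 ph (ph1 s).
    move=> se; have ys := ye _ se.
    have DX := surf_line_derive ys.
    have DF := @is_derive_pot _ _ _ _ Fpot (fun s : R => X (u + s *: v)) s _ (X_interior ys) DX.
    have Dl := is_derive_ell DX.
    rewrite /ph; der_eq; rewrite /ph1 -/(y s); by field.
  have z0 : `|0 : R| < e by rewrite normr0.
  have Dph1 : is_derive (0 : R) 1 ph1 (sg * (ex * (- (dF F x (w' v) + bil F x (dX u v) (dX u v)) / 3)
       + (- dF F x (dX u v) / 3) * (ex * (- dF F x (dX u v) / 3)) - c0 * ell (w' v))).
    have y00 : 0 < (u + 0 *: v) 0 0 by rewrite -/(y 0) y0.
    have DX := surf_line_derive y00; have DdX := dX_line_derive v u0.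
    have DF := @is_derive_pot _ _ _ _ Fpot (fun s : R => X (u + s *: v)) 0 _ (X_interior y00) DX.
    have DdF := @is_derive_dF _ _ _ _ Fpot (fun s : R => X (u + s *: v))
      (fun s : R => dX (u + s *: v) v) 0 _ _ (X_interior y00) DX DdX.
    have Dl := is_derive_ell DdX.
    rewrite /ph1 /y; der_eq; rewrite -/(y 0) y0 -/x -/ex -/(w' v); by field.
  have phmax (s : R) : `|s| < e -> ph s <= ph 0.
    move=> se; have ys := ye _ se.
    have -> : ph 0 = 0 by rewrite /ph y0 -/x -/ex -exE Eu subrr mulr0.
    by have := Hmax _ ys; rewrite (EpotE F (X_interior ys)).
  split; last exact: max_derive2_le0 e0 Dph Dph1 phmax.
  have := max_derive1_eq0 e0 Dph phmax; rewrite /ph1 y0 -/x -/ex => /eqP.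
  by rewrite mulf_eq0 (negbTE sg0) /= => /eqP H; rewrite -oppr0 -H; ring.
(* The first order condition in the direction of the Christoffel vector removes the tangential
   terms, and [c0 * ell x = ex - 1] cancels [ex * Q / 3] against the correction, up to a remaining
   [Q / 3]. *)
pose A v w := bil F x (dX u v) (dX u w) - dF F x (dX u v) * dF F x (dX u w) / 3.
have key2 v : 0 <= sg * (A v v - Q u v v / ex).
  have [E1 _] := key (gamma c tX tX1 tX2 mX u v v); have [_ E2] := key v.
  move: E2; rewrite /w' dFD dFZ (euler Fpot) // ellD ellZ /A.
  move: E1; set dg := dF _ _ _; set lg := ell _ => E1.
  set B := bil _ _ _ _; set d := dF _ _ _; set q0 := Q _ _ _ => E2.
  have E3 : c0 * ell x = ex - 1 by rewrite -Eu exE.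
  have := E2; rewrite -(@pmulr_rle0 _ (3 / ex)) ?divr_gt0 //.
  suff -> : 3 / ex * (sg * (ex * (- (dg + q0 / 3 * - 3%:R + B) / 3) +
     - d / 3 * (ex * (- d / 3)) - c0 * (lg + q0 / 3 * ell x))) = - (sg * (B - d * d / 3 - q0 / ex)).
    by rewrite oppr_le0.
  have -> : c0 * (lg + q0 / 3 * ell x) = c0 * lg + q0 / 3 * (c0 * ell x) by ring.
  have -> : c0 * lg = - (ex * dg / 3) by apply/eqP; rewrite -addr_eq0 addrC E1.
  rewrite E3; field.
  by rewrite gt_eqF.
pose e0 := std_basis R (0 : 'I_2); pose e1 := std_basis R (1 : 'I_2).
have dXlin (s r : R) : dX u (s *: e0 + r *: e1) = s *: dX u e0 + r *: dX u e1.
  by apply: row3P; rewrite /dX !mxE /= /dl !mxE /=; field.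
have Qlin (s r : R) : Q u (s *: e0 + r *: e1) (s *: e0 + r *: e1) =
    Q u e0 e0 * s ^+ 2 + 2 * Q u e0 e1 * s * r + Q u e1 e1 * r ^+ 2.
  by rewrite /Q /form !mxE /=; ring.
have Alin (s r : R) : A (s *: e0 + r *: e1) (s *: e0 + r *: e1) =
    A e0 e0 * s ^+ 2 + 2 * A e0 e1 * s * r + A e1 e1 * r ^+ 2.
  rewrite /A dXlin !bilDl !bilDr !bilZl !bilZr !dFD !dFZ.
  by rewrite (bil_sym Fpot (dX u e1) (dX u e0)) //; field.
have Qd := Q_det e0 e1 u0; have Ad := det_reduced e0 e1 u0.
rewrite /= -/x in Ad.
have dne : 0 < (expR (fX (u 0 0)) * tX1 (u 0 0) * (e0 0 0 * e1 0 1 - e0 0 1 * e1 0 0)) ^+ 2.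
  rewrite !mxE /= mulr0 subr0 !mulr1 exprn_even_gt0 //=.
  apply: mulf_neq0; first by rewrite gt_eqF ?expR_gt0.
  by rewrite lt_eqF ?dt_xi_lt0.
move: Qd Ad dne; set d2 := (expR _ * _ * _) ^+ 2 => Qd Ad dne.
have F6 : expR (2 * F x) = ex^-1 ^+ 6.
  by rewrite /ex -expRN -expRM_natl; congr expR; field.
have l0 := ell_X_gt0 u0; rewrite -/x in l0.
have Qge0 v : 0 <= Q u v v.
  by apply: le_trans (Q_lb v u0); rewrite divr_ge0 ?addr_ge0 ?sqr_ge0.
have detQ : 3 * (Q u e0 e0 / ex * (Q u e1 e1 / ex) - (Q u e0 e1 / ex) ^+ 2) = d2 * ex^-1 ^+ 2.
  by rewrite -Qd; ring.
have detA : 3 * (A e0 e0 * A e1 e1 - A e0 e1 ^+ 2) = d2 * ex^-1 ^+ 6.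
  by rewrite -F6 -Ad /A !expr2.
have r0 : 0 < ex^-1 by rewrite invr_gt0.
have rE : ex^-1 * ex = 1 by rewrite mulVf // gt_eqF.
set r := ex^-1 in detQ detA r0 rE.
have QexE (s t : R) : Q u e0 e0 * r * s ^+ 2 + 2 * (Q u e0 e1 * r) * s * t + Q u e1 e1 * r * t ^+ 2
    = Q u (s *: e0 + t *: e1) (s *: e0 + t *: e1) * r by rewrite Qlin; ring.
(* For [sg = 1] the forms satisfy [Q / ex <= A], so the determinants give [r^2 <= r^6] although
   [r < 1]. For [sg = -1] all inequalities are reversed. *)
case: sg1 => sgE; rewrite sgE in key2 c00.
- have : Q u e0 e0 * r * (Q u e1 e1 * r) - (Q u e0 e1 * r) ^+ 2 <=
      A e0 e0 * A e1 e1 - A e0 e1 ^+ 2.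
    apply: form2_det_le => s t; rewrite QexE; first by rewrite mulr_ge0 ?Qge0 ?ltW.
    by rewrite -Alin; have := key2 (s *: e0 + t *: e1); rewrite -/r; lra.
  have ex1 : 1 < ex.
    have : 0 < c0 * ell x by rewrite mulr_gt0 //; lra.
    by rewrite -Eu exE; lra.
  have r1 : r < 1 by rewrite -rE ltr_pMr.
  have : r ^+ 6 < r ^+ 2.
    by rewrite -[X in _ < X]mulr1 (exprD r 2 4) ltr_pM2l ?exprn_gt0 // exprn_ilt1 // ltW.
  by rewrite -(ltr_pM2l dne); lra.
- have : A e0 e0 * A e1 e1 - A e0 e1 ^+ 2 <=
      Q u e0 e0 * r * (Q u e1 e1 * r) - (Q u e0 e1 * r) ^+ 2.
    apply: form2_det_le => s t; rewrite -Alin.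
      by rewrite /A -expr2 (bil_reduced_ge0 Fpot).
    by rewrite QexE; have := key2 (s *: e0 + t *: e1); rewrite -/r; lra.
  have ex1 : ex < 1.
    have : 0 < - c0 * ell x by rewrite mulr_gt0 //; lra.
    by rewrite mulNr -Eu exE; lra.
  have r1 : 1 < r by rewrite -rE gtr_pMr.
  have : r ^+ 2 < r ^+ 6.
    by rewrite -[X in X < _]mulr1 (exprD r 2 4) ltr_pM2l ?exprn_gt0 // exprn_egt1.
  by rewrite -(ltr_pM2l dne); lra.
Qed.

(** * Compactness for the maximum principle *)

Lemma gmean_ge_min (v : 'rV[R]_3) : 0 <= v 0 0 -> 0 <= v 0 1 ->
  Num.min (v 0 0) (v 0 1) <= gmean p q v.
Proof.
move=> x0 y0; set M := Num.min _ _.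
have M0 : 0 <= M by rewrite le_min x0.
have -> : M = pospow p^-1 M * pospow q^-1 M.
  by rewrite !pospowE // -powRD ?pq1 ?powRr1 // oner_eq0.
by apply: ler_pM; rewrite ?pospow_ge0 // pospow_le ?invr_gt0 ?p_gt0 ?q_gt0 // ge_min lexx ?orbT.
Qed.

Lemma ell_continuous : continuous ell.
Proof.
move=> v; rewrite /ell.
have C i : {for v, continuous (fun v : 'rV[R]_3 => v 0 i)} by exact: coord_continuous.
apply: (@continuousD _ _ _ (fun v : 'rV[R]_3 => 2 * (v 0 0 + v 0 1))) => //.
apply: (@continuousM _ _ (fun=> 2) (fun v : 'rV[R]_3 => v 0 0 + v 0 1)).
  exact: cst_continuous.
by apply: (@continuousD _ _ _ (fun v : 'rV[R]_3 => v 0 0)).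
Qed.

Lemma Econt : continuous E.
Proof.
apply: (Epot_continuous Fpot); apply: closed_power_cone; [exact: p_gt0|exact: q_gt0].
Qed.

(** [E] vanishes off the interior, so [E >= k] on the slice [ell = 1] defines a compact subset of
    the interior, on which each defining function of the cone has a positive minimum. *)
Lemma E_slice_bound (k : R) : 0 < k -> exists2 d, 0 < d & forall v : 'rV[R]_3, K v -> ell v = 1 ->
  k <= E v -> [/\ d <= v 0 0, d <= v 0 1 & d <= v 0 2 + gmean p q v].
Proof.
move=> k0.
pose D := [set v : 'rV[R]_3 | [/\ K v, ell v = 1 & k <= E v]].
have [D0|D0] := pselect (D !=set0); last first.
  by exists 1 => // v Kv lv Ev; exfalso; apply: D0; exists v.
have DK (v : 'rV[R]_3) : D v -> K° v.
  move=> [_ _ kv]; apply: contrapT => nK; move: kv; rewrite Epot0 //; lra.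
have cD : compact D.
  apply: bounded_closed_compact.
    exists 1; split=> // M M1 v [/ell_bound[x0 y0 xy z] l1 _].
    apply: rV_norm_le; first lra.
    rewrite l1 in xy z.
    by apply: ord3P; [rewrite ger0_norm //; lra|rewrite ger0_norm //; lra|lra].
  have -> : D = K `&` (ell @^-1` [set 1] `&` E @^-1` [set x | k <= x]).
    by apply/seteqP; split => v; [case|case=> ? []].
  apply: closedI; first by apply: closed_power_cone; [exact: p_gt0|exact: q_gt0].
  apply: closedI.
    by apply: preimage_closed (@closed_eq R 1) => v _; exact: ell_continuous.
  by apply: preimage_closed (@closed_ge R k) => v _; exact: Econt.
have pos (f : 'rV[R]_3 -> R) : continuous f -> (forall v : 'rV[R]_3, K° v -> 0 < f v) ->
    exists2 d, 0 < d & forall v : 'rV[R]_3, D v -> d <= f v.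
  move=> cf f0.
  have [m mD Hm] := EVT_min_rV D0 cD (continuous_subspaceT cf).
  rewrite inE in mD.
  by exists (f m); [apply: f0; exact: DK|move=> v Dv; apply: Hm; rewrite inE].
have IK := interior_power_cone p_gt0 q_gt0.
have [d1 d10 H1] : exists2 d, 0 < d & forall v : 'rV[R]_3, D v -> d <= v 0 0.
  by apply: pos => [|v]; [exact: coord_continuous|rewrite IK => -[]].
have [d2 d20 H2] : exists2 d, 0 < d & forall v : 'rV[R]_3, D v -> d <= v 0 1.
  by apply: pos => [|v]; [exact: coord_continuous|rewrite IK => -[]].
have [d3 d30 H3] : exists2 d, 0 < d & forall v : 'rV[R]_3, D v -> d <= v 0 2 + gmean p q v.
  apply: pos => [|v]; last by rewrite IK => -[].
  by apply: gmeanD_continuous; [exact: p_gt0|exact: q_gt0].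
exists (Num.min d1 (Num.min d2 d3)); first by rewrite !lt_min d10 d20.
move=> v Kv lv Ev; have Dv : D v by [].
by split; rewrite !ge_min ?(H1 _ Dv) ?(H2 _ Dv) ?(H3 _ Dv) ?orbT.
Qed.

Definition in_box (B : R * R * (R * R)) u :=
  B.1.1 <= u 0 0 <= B.1.2 /\ B.2.1 <= u 0 1 <= B.2.2.

Lemma tX_le_inv x y : 0 < x -> 0 < y -> tX x <= tX y -> y <= x.
Proof.
by move=> x0 y0; apply: contraTT; rewrite -!ltNge => /(t_xi_decr pp x0).
Qed.

Lemma fX_le_inv x y : 0 < x -> 0 < y -> fX x <= fX y -> x <= y.
Proof.
by move=> x0 y0; apply: contraTT; rewrite -!ltNge => /(phi_xi_incr pp y0).
Qed.

Lemma muE u : u 0 1 = ln (sx c fX u) - ln (sy c fX u).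
Proof. by rewrite /sx /sy !expRK; ring. Qed.

(** The parameters of [X u] depend only on its ray, so [X u] may be rescaled by [ell] into the
    slice, where [E >= k]. With L for [ell], the bounds [d L <= z + r], [d L <= r <= L] and [z <= L]
    put [t + 1 = (z + r) / r] between [d] and [2 / d]; the bounds on x and y confine
    [mu = ln x - ln y]. *)
Lemma superlevel_box_pos k : 0 < k -> exists B : R * R * (R * R), 0 < B.1.1 /\
  forall u, 0 < u 0 0 -> k * ell (X u) <= E (X u) - 1 -> in_box B u.
Proof.
move=> k0; have [d d0 Hd] := E_slice_bound k0.
have dm1 : -1 < d - 1 by lra.
have d2 : -1 < 2 / d - 1 by have : 0 < 2 / d; [rewrite divr_gt0|lra].
have [x1 x10 T1] := t_xi_onto pp dm1.
have [x2 x20 T2] := t_xi_onto pp d2.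
exists ((x2, x1), (ln d, - ln d)); split=> //= u u0 Hu.
have L0 := ell_X_gt0 u0; set L := ell (X u) in Hu L0.
have Kx := X_interior u0.
have [_ _ Lxy Lz] := ell_bound (interior_subset Kx).
rewrite -/L X0 X1 in Lxy Lz.
have Li : 0 < L^-1 by rewrite invr_gt0.
have KY := power_coneZ pq1 Li (interior_subset Kx).
have LY : ell (L^-1 *: X u) = 1 by rewrite ellZ mulVf // gt_eqF.
have EY : k <= E (L^-1 *: X u).
  rewrite (EpotZ Fpot (interior_power_coneZ p_gt0 q_gt0 pq1)) //.
  by rewrite mulrC ler_pdivlMr //; lra.
have sx0 := sx_gt0 u; have sy0 := sy_gt0 u; have sr0 := sr_gt0 u.
have [] := Hd _ KY LY EY; rewrite gmeanZ ?pq1 ?(ltW Li) //; first last.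
- by rewrite X1 ltW.
- by rewrite X0 ltW.
rewrite gmean_X ![(L^-1 *: X u) 0 _]mxE X0 X1 X2 -mulrDr ![L^-1 * _]mulrC !ler_pdivlMr // => Dx Dy Dz.
have gmax : sr c fX u <= L.
  have := gmean_le_max p_gt0 q_gt0 pq1 (v := X u).
  rewrite gmean_X X0 X1 => /(_ (ltW sx0) (ltW sy0)).
  by rewrite le_max => /orP[]; lra.
have gmin : d * L <= sr c fX u.
  have := gmean_ge_min (v := X u).
  rewrite gmean_X X0 X1 => /(_ (ltW sx0) (ltW sy0)).
  by rewrite ge_min => /orP[]; lra.
have zL : sr c fX u * tX (u 0 0) <= L by apply: le_trans (ler_norm _) _; rewrite -X2.
have dL0 : 0 < d * L by rewrite mulr_gt0.
split; last first.
  have lnL : ln (d * L) = ln d + ln L by rewrite lnM ?posrE.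
  have l1 : ln (d * L) <= ln (sx c fX u) by rewrite ler_ln ?posrE.
  have l2 : ln (d * L) <= ln (sy c fX u) by rewrite ler_ln ?posrE.
  have l3 : ln (sx c fX u) <= ln L by rewrite ler_ln ?posrE //; lra.
  have l4 : ln (sy c fX u) <= ln L by rewrite ler_ln ?posrE //; lra.
  by rewrite /= muE; lra.
apply/andP; split.
  apply: tX_le_inv => //; rewrite /tX T2 -/(tX (u 0 0)).
  rewrite lerBrDr ler_pdivlMr //.
  rewrite -(ler_pM2r L0).
  have : (tX (u 0 0) + 1) * (d * L) <= (tX (u 0 0) + 1) * sr c fX u.
    by rewrite ler_wpM2l // ltW //; have := t_xi_gtN1 pp u0; rewrite -/(tX _); lra.
  lra.
apply: tX_le_inv => //; rewrite /tX T1 -/(tX (u 0 0)).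
rewrite lerBlDr -(ler_pM2r sr0).
have : d * sr c fX u <= d * L by rewrite ler_pM2l.
lra.
Qed.

(** Since [E >= 0], the hypothesis bounds [ell], hence x, y, z and r, by [M = 1/k], and
    [e^phi = x y r <= M^3] bounds [xi] above. For small [xi], [x y z >= c1] with factors at most [M]
    keeps x, y and hence r above [c1 / M^2], so phi and [xi] are bounded below. Then x and y are
    bounded below throughout, which confines [mu]. *)
Lemma superlevel_box_neg k : 0 < k -> exists B : R * R * (R * R), 0 < B.1.1 /\
  forall u, 0 < u 0 0 -> k * ell (X u) <= 1 - E (X u) -> in_box B u.
Proof.
move=> k0; pose M := k^-1.
have M0 : 0 < M by rewrite invr_gt0.
have [c1 [x0 [c10 x00 Hc]]] := t_phi_near pp.
pose dl := c1 / (M * M).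
have dl0 : 0 < dl by rewrite divr_gt0 // mulr_gt0.
have [x1 x10 T1] := phi_xi_onto pp (ln (dl * dl * dl)).
pose xm := Num.min x0 x1.
have xm0 : 0 < xm by rewrite lt_min x00.
pose ka := expR (fX xm).
have ka0 : 0 < ka by exact: expR_gt0.
pose de := ka / (M * M).
have de0 : 0 < de by rewrite divr_gt0 // mulr_gt0.
have [x3 x30 T3] := phi_xi_onto pp (ln (M * M * M)).
exists ((xm, x3), (ln de - ln M, ln M - ln de)); split=> //= u u0 Hu.
have L0 := ell_X_gt0 u0; have Kx := X_interior u0.
have LM : ell (X u) <= M.
  rewrite /M -[X in _ <= X]mul1r ler_pdivlMr // mulrC.
  by have := Epot_ge0 K F (X u); lra.
have [_ _ Lxy Lz] := ell_bound (interior_subset Kx).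
rewrite X0 X1 in Lxy.
have sx0 := sx_gt0 u; have sy0 := sy_gt0 u; have sr0 := sr_gt0 u.
have xM : sx c fX u <= M by lra.
have yM : sy c fX u <= M by lra.
have zM : sr c fX u * tX (u 0 0) <= M by apply: le_trans (ler_norm _) _; rewrite -X2; lra.
have rM : sr c fX u <= M.
  have := gmean_le_max p_gt0 q_gt0 pq1 (v := X u).
  rewrite gmean_X X0 X1 => /(_ (ltW sx0) (ltW sy0)).
  by rewrite le_max => /orP[]; lra.
have fE := expR_fE c fX u.
have MM : 0 < M * M by rewrite mulr_gt0.
have xmu : xm <= u 0 0.
  rewrite /xm ge_min; have [ux|ux] := leP (u 0 0) x0; last by rewrite (ltW ux).
  apply/orP; right; apply: fX_le_inv => //.
  rewrite /fX T1 -/(fX (u 0 0)).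
  suff G : dl * dl * dl <= sx c fX u * sy c fX u * sr c fX u.
    have : ln (dl * dl * dl) <= ln (sx c fX u * sy c fX u * sr c fX u).
      by apply: ln_le G; apply: mulr_gt0 => //; apply: mulr_gt0.
    by rewrite fE expRK.
  have := Hc _ u0 ux; rewrite -/(tX _) -/(fX _) -fE => C.
  have C' : c1 <= sr c fX u * tX (u 0 0) * sx c fX u * sy c fX u by lra.
  have z0 : 0 < sr c fX u * tX (u 0 0).
    have : 0 < sr c fX u * tX (u 0 0) * (sx c fX u * sy c fX u) by lra.
    by rewrite pmulr_lgt0 // mulr_gt0.
  have Dx : dl <= sx c fX u.
    rewrite ler_pdivrMr //; apply: le_trans C' _.
    have : sr c fX u * tX (u 0 0) * sy c fX u <= M * M by apply: ler_pM => //; exact: ltW.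
    by rewrite -(ler_pM2l sx0); lra.
  have Dy : dl <= sy c fX u.
    rewrite ler_pdivrMr //; apply: le_trans C' _.
    have : sr c fX u * tX (u 0 0) * sx c fX u <= M * M by apply: ler_pM => //; exact: ltW.
    by rewrite -(ler_pM2l sy0); lra.
  have Dr : dl <= sr c fX u.
    have := gmean_ge_min (v := X u).
    rewrite gmean_X X0 X1 => /(_ (ltW sx0) (ltW sy0)).
    by rewrite ge_min => /orP[]; lra.
  exact: mul3_le (ltW dl0) (ltW dl0) (ltW dl0) Dx Dy Dr.
have kaf : ka <= sx c fX u * sy c fX u * sr c fX u.
  rewrite fE ler_expR; move: xmu; rewrite le_eqVlt => /orP[/eqP <- //|].
  by move=> /(phi_xi_incr pp xm0)/ltW.
have Dx : de <= sx c fX u.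
  rewrite ler_pdivrMr //; apply: le_trans kaf _.
  have : sy c fX u * sr c fX u <= M * M by apply: ler_pM => //; exact: ltW.
  by rewrite -(ler_pM2l sx0); lra.
have Dy : de <= sy c fX u.
  rewrite ler_pdivrMr //; apply: le_trans kaf _.
  have : sx c fX u * sr c fX u <= M * M by apply: ler_pM => //; exact: ltW.
  by rewrite -(ler_pM2l sy0); lra.
split; last first.
  have l1 : ln de <= ln (sx c fX u) by rewrite ler_ln ?posrE.
  have l2 : ln de <= ln (sy c fX u) by rewrite ler_ln ?posrE.
  have l3 : ln (sx c fX u) <= ln M by rewrite ler_ln ?posrE.
  have l4 : ln (sy c fX u) <= ln M by rewrite ler_ln ?posrE.
  by rewrite /= muE; lra.
rewrite xmu /=; apply: fX_le_inv => //.
rewrite /fX T3 -/(fX (u 0 0)).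
suff G : sx c fX u * sy c fX u * sr c fX u <= M * M * M.
  have : ln (sx c fX u * sy c fX u * sr c fX u) <= ln (M * M * M).
    by apply: ln_le G; rewrite fE expR_gt0.
  by rewrite fE expRK.
exact: mul3_le (ltW sx0) (ltW sy0) (ltW sr0) xM yM rM.
Qed.

Notation U := (@half_plane R).

Lemma open_half_plane : open U.
Proof.
by apply: (open_comp (f := fun u : 'rV[R]_2 => u 0 0) _ (@open_gt R 0)) => u _;
  exact: coord_continuous.
Qed.

Lemma el_sq : elementary U (fun u => sq b (u 0 0)).
Proof.
apply: el_sqrt => [|u u0]; first by apply: el_add; [exact: el_coord|exact: el_cst].
by rewrite ltr_wpDr ?sqr_ge0.
Qed.

Lemma el_psi : elementary U (fun u => psi g h a b (sq b (u 0 0))).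
Proof.
have es := el_sq.
have eC (r : R) := el_cst U r.
have pos (r : R) u : - b <= r -> U u -> 0 < sq b (u 0 0) + r.
  by move=> r0 u0; have := sq_gt pp u0; lra.
have b0 := pp_b pp; have g0 := pp_g pp; have h0 := h_gt0 pp.
have eL (r : R) : - b <= r -> elementary U (fun u => ln (sq b (u 0 0) + r)).
  by move=> r0; apply: el_ln => [|u]; [exact: el_add|exact: pos].
rewrite /psi; apply: el_add; first apply: el_add.
- apply: el_mul => //; apply: el_sub; [apply: eL|apply: eL]; lra.
- by apply: el_mul => //; apply: eL; lra.
- by apply: el_mul => //; apply: eL; lra.
Qed.

Lemma el_tX : elementary U (fun u => tX (u 0 0)).
Proof.
rewrite /tX /t_xi /tS; apply: el_mul.
  by apply: el_sub; [exact: el_cst|exact: el_sq].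
by apply: el_exp; apply: el_opp; exact: el_psi.
Qed.

Lemma el_fX : elementary U (fun u => fX (u 0 0)).
Proof.
have es := el_sq; have eC (r : R) := el_cst U r.
rewrite /fX /phi_xi /fS /polP; apply: el_add; last exact: el_psi.
apply: el_sub => //; apply: el_ln => [|u u0].
  apply: el_add => //; apply: el_add; last by apply: el_mul.
  by apply: (el_ext (el_mul es es)) => u _; rewrite expr2.
by have := polP_gt0 pp (bs_gt0 pp (sq_gt pp u0)).
Qed.

Lemma el_X i : elementary U (fun u => X u 0 i).
Proof.
have ef := el_fX; have et := el_tX; have eC (r : R) := el_cst U r.
have eL (r : R) : elementary U (fun u => expR (fX (u 0 0) / 3 + r * u 0 1)).
  by apply: el_exp; apply: el_add; apply: el_mul => //; exact: el_coord.
move: i; apply: ord3P.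
- by apply: (el_ext (eL c)) => u _; rewrite X0.
- by apply: (el_ext (eL (c - 1))) => u _; rewrite X1 /sy; congr expR; ring.
- by apply: (el_ext (el_mul (eL (1 - 2 * c)) et)) => u _; rewrite X2.
Qed.

Lemma smooth_X : smooth_on U X.
Proof. by apply: elementary_smooth_row; [exact: open_half_plane|exact: el_X]. Qed.

Lemma X_continuous u : U u -> {for u, continuous X}.
Proof. by move=> Uu; apply: differentiable_continuous; exact: (smooth_X [::]). Qed.

(** The quotient exceeds its value at [u0] only inside a compact box, so its maximum over the box is
    global. The sign [sg] treats a positive maximum and a negative minimum at once. *)
Lemma extremum_contra sg u0 : sg = 1 \/ sg = -1 -> 0 < u0 0 0 ->
  0 < sg * (E (X u0) - 1) ->
  (forall k, 0 < k -> exists B : R * R * (R * R), 0 < B.1.1 /\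
    forall u, 0 < u 0 0 -> k * ell (X u) <= sg * (E (X u) - 1) -> in_box B u) -> False.
Proof.
move=> sg1 u00 Eu0 Hbox.
have l0 := ell_X_gt0 u00.
pose Ph u := sg * (E (X u) - 1) / ell (X u).
have Ph0 : 0 < Ph u0 by rewrite divr_gt0.
have [B [B0 HB]] := Hbox _ Ph0.
pose A := [set u | in_box B u].
have Au0 : A u0 by apply: HB => //; rewrite /Ph divfK // gt_eqF.
have AU u : A u -> U u by move=> [/andP[H _] _]; rewrite /half_plane /=; lra.
have cA : compact A.
  pose I (i : 'I_2) : set R :=
    if i == 0 then `[B.1.1, B.1.2]%classic else `[B.2.1, B.2.2]%classic.
  have -> : A = [set v : 'rV[R]_2 | forall i, I i (v ord0 i)].
    apply/seteqP; split => u /=.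
      move=> [H1 H2]; case=> -[|[|//]] Hi; rewrite /I /= in_itv /=.
        by rewrite (_ : Ordinal Hi = 0) //; apply/val_inj.
      by rewrite (_ : Ordinal Hi = 1) //; apply/val_inj.
    move=> H; have := H 0; have := H 1; rewrite /I /= !in_itv /= => H1 H2.
    by split.
  by apply: rV_compact => i; rewrite /I; case: ifP => _; exact: segment_compact.
have cPh : {within A, continuous Ph}.
  apply: continuous_in_subspaceT => u; rewrite inE => Au.
  have Uu := AU _ Au; have cX := X_continuous Uu.
  apply: (@continuousM _ _ (fun u => sg * (E (X u) - 1)) (fun u => (ell (X u))^-1)).
    apply: (@continuousM _ _ (fun=> sg) (fun u => E (X u) - 1)); first exact: cst_continuous.
    apply: (@continuousB _ _ _ (fun u => E (X u)) (fun=> 1)); last exact: cst_continuous.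
    apply: (@continuous_comp _ _ _ X (Epot K F)) => //; exact: Econt.
  apply: (@continuousV _ _ (fun u => ell (X u))).
    by rewrite (gt_eqF (ell_X_gt0 Uu)).
  by apply: (@continuous_comp _ _ _ X ell) => //; exact: ell_continuous.
have [um umA Hm] := EVT_max_rV (ex_intro _ u0 Au0) cA cPh.
rewrite inE in umA; have Um := AU _ umA.
have m0 : Ph u0 <= Ph um by apply: Hm; rewrite inE.
have glob w : U w -> Ph w <= Ph um.
  move=> Uw; have [Aw|nAw] := pselect (A w); first by apply: Hm; rewrite inE.
  apply: le_trans m0; rewrite leNgt; apply/negP => H; apply: nAw; apply: (HB _ Uw).
  by move: H; rewrite {1}/Ph ltr_pdivlMr; [move/ltW|exact: ell_X_gt0].
have sg2 : sg * sg = 1 by case: sg1 => ->; ring.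
have lm := ell_X_gt0 Um.
apply: (@no_extremum sg um (sg * Ph um) Um sg1).
- by rewrite mulrA sg2 mul1r; apply: lt_le_trans m0.
- have PE : Ph um * ell (X um) = sg * (E (X um) - 1) by rewrite /Ph (divfK (lt0r_neq0 lm)).
  by rewrite -mulrA PE mulrA sg2 mul1r.
- move=> w Uw; have := glob _ Uw; rewrite {1}/Ph (ler_pdivrMr _ _ (ell_X_gt0 Uw)) => H.
  have -> : sg * (E (X w) - 1 - sg * Ph um * ell (X w)) =
    sg * (E (X w) - 1) - (sg * sg) * (Ph um * ell (X w)) by ring.
  by rewrite sg2 mul1r subr_le0.
Qed.

Lemma F_X u : 0 < u 0 0 -> F (X u) = 0.
Proof.
move=> u0; have EX := EpotE F (X_interior u0).
suff E1 : E (X u) = 1.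
  move: E1; rewrite EX => /(congr1 (@ln R)); rewrite expRK ln1 => H; lra.
apply/eqP; rewrite eq_le !leNgt; apply/andP; split; apply/negP => H.
- apply: (@extremum_contra 1 u) => //; first by left.
    by rewrite mul1r; lra.
  by move=> k k0; have [B [B0 HB]] := superlevel_box_pos k0; exists B; split => // w w0;
    rewrite mul1r; exact: HB.
- apply: (@extremum_contra (-1) u) => //; first by right.
    by rewrite mulN1r; lra.
  by move=> k k0; have [B [B0 HB]] := superlevel_box_neg k0; exists B; split => // w w0;
    rewrite mulN1r opprB; exact: HB.
Qed.

Lemma image_X : X @` U = zero_level_set K F.
Proof.
apply/seteqP; split => v.
  by move=> [u Uu <-]; split; [exact: X_interior|exact: F_X].
move=> [Kv Fv]; have [l [u [l0 u0 vE]]] := cone_ray Kv.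
exists u => //; rewrite vE.
suff -> : l = 1 by rewrite scale1r.
have [_ LH] := Fpot.
move: Fv; rewrite vE LH ?F_X //; last exact: X_interior.
rewrite sub0r => /eqP; rewrite oppr_eq0 mulf_eq0 pnatr_eq0 /= ln_eq0 //.
by move/eqP.
Qed.

(** * The affine sphere *)

(* [Y] will be [sphere_map p q], which is controlled on [U] only. *)
Variable Y : 'rV[R]_2 -> 'rV[R]_3.
Hypothesis YX : forall u, U u -> Y u = X u.

Lemma is_derive_Y u v : U u -> is_derive u v Y (dX u v).
Proof.
move=> Uu; apply: (isd_near open_half_plane Uu (fun w Uw => esym (YX Uw))).
exact: (is_derive_surf c pX v Uu).
Qed.

Lemma smooth_Y : smooth_on U Y.
Proof.
apply: elementary_smooth_row; first exact: open_half_plane.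
by move=> i; apply: (el_ext (el_X i)) => u Uu; rewrite YX.
Qed.

Lemma diff_Y u v : U u -> 'd Y u v = dX u v.
Proof.
move=> Uu; rewrite -deriveE; last exact: (smooth_Y [::]).
by case: (is_derive_Y v Uu).
Qed.

Lemma immersion_Y : hypersurface_immersion U Y.
Proof.
split=> [|u Uu v w E]; first exact: smooth_Y.
apply/subr0_eq/(@dsurf_inj _ c _ _ _ _ _ _ pX _ _ Uu); rewrite -[LHS]diff_Y // linearB /=.
by apply/eqP; rewrite subr_eq0 E.
Qed.

Lemma derive2_Y u v w : U u ->
  'D_w ('D_v Y) u = dX u (gamma c tX tX1 tX2 mX u v w) + (Q u v w / 3) *: X u.
Proof.
move=> Uu.
rewrite (@near_eq_derive _ _ _ _ (fun u => dX u v)).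
  rewrite -(gauss_formula c pX) //.
  by case: (is_derive_dsurf c pX v w Uu).
apply: filterS (open_nbhs_nbhs (conj open_half_plane Uu)) => x Ux.
by case: (is_derive_Y v Ux).
Qed.

(* The factor that makes [det (nu, X_1, X_2) ^ 2] equal to [det h], given that
   [3 det Q = det (X, X_1, X_2) ^ 2]. *)
Definition nu_scale : R := Num.sqrt (Num.sqrt 27^-1).
Definition nuX u := nu_scale *: X u.
Definition metricX u : 'M[R]_2 :=
  \matrix_(i, j) (Q u (std_basis R i) (std_basis R j) / (3 * nu_scale)).

Lemma nu_scale_gt0 : 0 < nu_scale.
Proof. by rewrite !sqrtr_gt0 invr_gt0. Qed.

Lemma nu_scale4 : nu_scale ^+ 4 = 27^-1.
Proof.
by rewrite (exprM _ 2 2) /nu_scale sqr_sqrtr ?sqrtr_ge0 // sqr_sqrtr // invr_ge0.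
Qed.

(** Were the position vector tangent, the logarithmic derivatives of x and y would agree, which
    forces [dmu = 0]; comparison with the third coordinate forces [dxi = 0], and then the common
    value [nu_scale] would be 0. *)
Lemma X_notin_range u v : U u -> dX u v <> nuX u.
Proof.
move=> Uu; rewrite /nuX => H; have n0 := nu_scale_gt0.
have t10 := pf_neq0 pX Uu.
have E0 : dl tX1 mX c u v = nu_scale.
  have := congr1 (fun X : 'rV[R]_3 => X 0 0) H; rewrite !mxE /= mulrC.
  by move/mulIf; apply; rewrite gt_eqF ?sx_gt0.
have E1 : dl tX1 mX (c - 1) u v = nu_scale.
  have := congr1 (fun X : 'rV[R]_3 => X 0 1) H; rewrite !mxE /= mulrC.
  by move/mulIf; apply; rewrite gt_eqF ?sy_gt0.
have v1 : v 0 1 = 0 by move: E0 E1; rewrite /dl; lra.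
have E2 : tX1 (u 0 0) * v 0 0 = 0.
  have := congr1 (fun X : 'rV[R]_3 => X 0 2) H; rewrite !mxE /=.
  have -> : dl tX1 mX (1 - 2 * c) u v = dl tX1 mX c u v by rewrite /dl v1 !mulr0.
  rewrite E0 mulrCA; move/(mulfI (lt0r_neq0 (sr_gt0 u))); lra.
move/eqP: E2; rewrite mulf_eq0 (negbTE t10) /= => /eqP v0.
by move: E0; rewrite /dl v0 v1 !mulr0 mul0r; lra.
Qed.

Lemma QC u v w : Q u v w = Q u w v.
Proof. by rewrite /Q /form; ring. Qed.

Lemma qform_metricX u v : U u -> qform (metricX u) v = Q u v v / (3 * nu_scale).
Proof.
move=> Uu; rewrite /qform mxE !big_ord_recl big_ord0 /= !mxE.
rewrite !big_ord_recl !big_ord0 /= !mxE /Q /form !mxE /=.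
have -> : lift ord0 ord0 = 1 :> 'I_2 by apply/val_inj.
by rewrite /=; ring.
Qed.

Lemma metricX_lb u v : U u ->
  ((mX (u 0 0) * tX1 (u 0 0) * v 0 0) ^+ 2 + v 0 1 ^+ 2) / (60 * nu_scale)
  <= qform (metricX u) v.
Proof.
move=> Uu; have n0 := nu_scale_gt0; rewrite qform_metricX //.
have -> : forall x : R, x / (60 * nu_scale) = x / 20 / (3 * nu_scale).
  by move=> x; field; rewrite gt_eqF.
by rewrite ler_pM2r ?Q_lb // invr_gt0 mulr_gt0.
Qed.

Lemma posdef_metricX u : U u -> posdef (metricX u).
Proof.
move=> Uu; split; first by apply/matrixP => i j; rewrite !mxE QC.
move=> v v0; apply: lt_le_trans (metricX_lb v Uu).
apply: divr_gt0; last by rewrite mulr_gt0 ?nu_scale_gt0.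
set d := mX _ * tX1 _; have d0 : d != 0 := f1_neq0 Uu.
have [v00|v00] := eqVneq (v 0 0) 0; last first.
  by apply: ltr_wpDr; rewrite ?sqr_ge0 // exprn_even_gt0 //= mulf_neq0.
have [v01|v01] := eqVneq (v 0 1) 0; last first.
  by apply: ltr_wpDl; rewrite ?sqr_ge0 // exprn_even_gt0.
case/eqP: v0; apply/rowP; case=> -[|[|//]] Hi; rewrite mxE.
- by rewrite -[RHS]v00; congr (v 0 _); apply/val_inj.
- by rewrite -[RHS]v01; congr (v 0 _); apply/val_inj.
Qed.

Lemma blaschke_Y : blaschke_structure U Y nuX metricX.
Proof.
have n0 := nu_scale_gt0; have n1 : nu_scale != 0 by rewrite gt_eqF.
split.
  apply: elementary_smooth_row; first exact: open_half_plane.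
  move=> i; apply: (el_ext (el_mul (el_cst U nu_scale) (el_X i))) => u _.
  by rewrite /nuX [in RHS]mxE.
move=> u Uu; split.
- by move=> [v _]; rewrite diff_Y //; exact: X_notin_range.
- move=> i j; rewrite derive2_Y //.
  exists (gamma c tX tX1 tX2 mX u (std_basis R j) (std_basis R i)) => //.
  rewrite diff_Y // /metricX mxE /nuX scalerA QC.
  have -> : Q u (std_basis R i) (std_basis R j) / (3 * nu_scale) * nu_scale =
    Q u (std_basis R i) (std_basis R j) / 3 by field.
  by rewrite addrK.
- exact: posdef_metricX.
- move=> v; exists (nu_scale *: v) => //; rewrite diff_Y //.
  have D : is_derive u v nuX (nu_scale *: dX u v).
    have /is_derive_rowP DX := is_derive_surf c pX v Uu.
    apply/is_derive_rowP => i; rewrite mxE.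
    rewrite (_ : (fun _ => _) = (fun u => nu_scale * X u 0 i)); last first.
      by apply/funext => w; rewrite mxE.
    have DXi := DX i.
    by der_eq; rewrite mulr0 addr0.
  case: D => _ ->.
  by apply: row3P; rewrite /dX !mxE /= /dl !mxE; field.
have DY v : 'D_v Y u = dX u v by case: (is_derive_Y v Uu).
pose A : 'M[R]_3 := \matrix_(i < 3) [:: nuX u; dX u (std_basis R 0); dX u (std_basis R 1)]`_i.
have -> : col_mx (nuX u) ('J Y u) = A.
  have J i j : 'J Y u i j = dX u (std_basis R i) 0 j.
    by rewrite /jacobian /lin1_mx mxE /= diff_Y.
  apply/matrixP => i j; rewrite mxE; case: splitP => k Hk.
    by rewrite (ord1 k) /A [RHS]mxE Hk (ord1 k).
  rewrite J /A [RHS]mxE Hk; case: k {Hk} => -[|[|//]] Hk /=.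
    by congr (dX u (std_basis R _) 0 j); apply/val_inj.
  by congr (dX u (std_basis R _) 0 j); apply/val_inj.
have DA : \det A = nu_scale * (expR (fX (u 0 0)) * tX1 (u 0 0)).
  have := det_surf c tX tX1 mX fX u (std_basis R 0) (std_basis R 1).
  rewrite [X in _ = _ * X -> _](_ : _ = 1); last by rewrite !mxE /=; ring.
  rewrite mulr1 => <-.
  rewrite !det_mx33E /A /nuX /dX !mxE /= ; ring.
rewrite DA det_mx22E !mxE.
have := Q_det (std_basis R 0) (std_basis R 1) Uu.
rewrite [X in _ = (_ * X) ^+ 2 -> _](_ : _ = 1); last by rewrite !mxE /=; ring.
rewrite mulr1 => H; rewrite exprMn -H.
have n4 := nu_scale4.
rewrite [Q u (std_basis R 1) (std_basis R 0)]QC.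
set q0 := Q _ _ _; set q1 := Q _ _ _; set q2 := Q _ _ _.
(* With k for [nu_scale] the metric is [Q / (3k)], so the condition reads
   [3 k^2 det Q = det Q / (9 k^2)], that is, [27 k^4 = 1]. *)
transitivity ((q0 * q1 - q2 ^+ 2) * (nu_scale ^+ 4 * 27) / (9 * nu_scale ^+ 2)).
  by field.
by rewrite n4; field.
Qed.

(** * Convex hull and separation from the origin *)

Definition subzero : set 'rV[R]_3 := [set v | K° v /\ F v <= 0].

Lemma conv_affine (v w : 'rV[R]_3) (l : {i01 R}) :
  conv l (v : convex_lmodType 'rV[R]_3) w = w + l%:num *: (v - w).
Proof.
rewrite /conv /= scalerBr /unstable.onem scalerBl scale1r.
by rewrite addrCA.
Qed.

Lemma segment_interior (v w : 'rV[R]_3) (s : R) : K° v -> K° w -> 0 <= s <= 1 ->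
  K° (v + s *: (w - v)).
Proof.
move=> Kv Kw s01.
have KZ l x := @interior_power_coneZ R p q p_gt0 q_gt0 pq1 l x.
have [->|s0] := eqVneq s 0; first by rewrite scale0r addr0.
have [->|s1] := eqVneq s 1; first by rewrite scale1r addrC subrK.
have -> : v + s *: (w - v) = (1 - s) *: v + s *: w.
  by rewrite scalerBr scalerBl scale1r addrCA addrC.
case/andP: s01 => s0' s1'.
apply: (interior_power_coneD p_gt0 q_gt0 pq1); apply: KZ => //.
  by rewrite subr_gt0 lt_neqAle s1.
by rewrite lt_neqAle eq_sym s0.
Qed.

Lemma convex_subzero : @convex_set R 'rV[R]_3 subzero.
Proof.
move=> v w l; rewrite !inE => -[Kv Fv] [Kw Fw].
have l01 : 0 <= l%:num <= 1 by apply/andP.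
rewrite conv_affine; split; first exact: segment_interior.
by apply: (pot_convex Fpot) => // s s01; exact: segment_interior.
Qed.

Lemma image_Y : Y @` U = zero_level_set K F.
Proof.
rewrite -image_X; apply/seteqP; split => v [u Uu <-]; exists u => //; rewrite YX //.
Qed.

Lemma hull_subzero : convex_hull (Y @` U) `<=` subzero.
Proof.
apply: smallest_sub; first exact: convex_subzero.
by rewrite image_Y => v [Kv Fv]; split; rewrite ?Fv.
Qed.

(** Shrinking a point of the surface towards the origin makes [F] positive, hence leaves the hull at
    once. *)
Lemma hull_boundary : Y @` U `<=` boundary (convex_hull (Y @` U)).
Proof.
move=> v Yv; split.
  by apply: subset_closure; apply: sub_gen_smallest.
move=> /nbhs_ballP[e /= e0 He].
move: Yv; rewrite image_Y => -[Kv Fv].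
(* With [l = 1 / (1 + d)] the displacement from [v] to [l *: v] has norm [d l |v|], which is at most
   [e / 2]. *)
pose d := e / (2 * (`|v| + 1)).
have v0 : 0 < `|v| + 1 by rewrite ltr_wpDl.
have d0 : 0 < d by rewrite divr_gt0 ?mulr_gt0.
have [l [l0 l1 lE]] : exists l, [/\ 0 < l, l < 1 & 1 - l = d * l].
  exists (1 / (1 + d)); split; first by rewrite divr_gt0 //; lra.
    by rewrite ltr_pdivrMr; lra.
  by field; rewrite gt_eqF //; lra.
have H : convex_hull (Y @` U) (l *: v).
  apply: He; rewrite -ball_normE /ball_ /= -[X in X - _]scale1r -scalerBl normrZ.
  rewrite lE ger0_norm; last exact: mulr_ge0 (ltW d0) (ltW l0).
  apply: (@le_lt_trans _ _ (d * (`|v| + 1))).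
    have dl1 : d * l <= d by rewrite ger_pMr // ltW.
    apply: ler_pM => //; last by rewrite lerDl.
    exact: mulr_ge0 (ltW d0) (ltW l0).
  rewrite /d.
  have -> : e / (2 * (`|v| + 1)) * (`|v| + 1) = e / 2 by field; rewrite gt_eqF.
  lra.
have [_] := hull_subzero H; case: Fpot => _ -> //; rewrite Fv sub0r.
have : ln l < 0 by apply: ln_lt0; rewrite l0.
by move=> H1 H2; have : 3%:R * ln l < 0; [rewrite pmulr_rlt0|lra].
Qed.

(** The path may leave the cone, so the intermediate value theorem is applied to the extended
    function [E], which is 0 at the origin and at least 1 on the hull; the value 1 occurs only on
    the level set. *)
Lemma separates_Y : separates (Y @` U) (convex_hull (Y @` U)) 0.
Proof.
move=> r cr r0 /hull_subzero[Kr Fr].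
have cEr : {within `[0%R, 1%R], continuous (fun s => E (r s))}.
  move=> s; apply: continuous_comp; first exact: cr.
  exact: Econt.
have E0 : E 0 = 0.
  by rewrite Epot0 // interior_power_cone ?p_gt0 ?q_gt0 //= => -[]; rewrite mxE ltxx.
have E1 : 1 <= E (r 1).
  by rewrite EpotE // -[leLHS]expR0 ler_expR; lra.
have [|s s01 Es] := IVT ler01 cEr (v := 1).
- by rewrite r0 E0 ge_min le_max ler01 E1 orbT.
exists s; first by move: s01; rewrite in_itv.
have Ks : K° (r s).
  by apply: contrapT => nK; move: Es; rewrite (Epot0 F nK) => /eqP; rewrite eq_sym oner_eq0.
rewrite image_Y; split => //.
move: Es; rewrite EpotE // => /(congr1 (@ln R)); rewrite expRK ln1; lra.
Qed.

(** * Asymptotic approach to the boundary of the cone *)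

Lemma boundary_cone (v : 'rV[R]_3) : 0 <= v 0 0 -> 0 <= v 0 1 ->
  0 <= v 0 2 + gmean p q v ->
  (v 0 0 = 0 \/ v 0 1 = 0 \/ v 0 2 + gmean p q v = 0) -> boundary K v.
Proof.
move=> x0 y0 z0 H; split; first by apply: subset_closure; rewrite power_coneE.
rewrite interior_power_cone ?p_gt0 ?q_gt0 //= => -[x1 y1 z1].
by case: H => [H|[H|H]]; move: x1 y1 z1; rewrite H ltxx.
Qed.

Lemma continuous_pospowM (al : R) (z y : R) (I : set R) : 0 < al ->
  {within I, continuous (fun x => z + pospow al x * y)}.
Proof.
move=> a0; apply: continuous_subspaceT => x.
apply: (@continuousD _ _ _ (fun=> z) (fun x => pospow al x * y)); first exact: cst_continuous.
apply: (@continuousM _ _ (pospow al) (fun=> y)); last exact: cst_continuous.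
exact: pospow_continuous.
Qed.

(** Lowering x alone reaches the boundary: the face [x = 0] if [z >= 0], and otherwise the graph, by
    the intermediate value theorem. In the maximum norm the distance is at most x. *)
Lemma near_face_x (v : 'rV[R]_3) : K° v -> exists2 w, boundary K w & `|v - w| <= v 0 0.
Proof.
rewrite interior_power_cone ?p_gt0 ?q_gt0 //= => -[x0 y0 z0].
have p'0 : 0 < p^-1 by rewrite invr_gt0 p_gt0.
suff [x' /andP[x'0 x'x] Hx] : exists2 x', 0 <= x' <= v 0 0 & boundary K (row3 x' (v 0 1) (v 0 2)).
  exists (row3 x' (v 0 1) (v 0 2)) => //.
  apply: rV_norm_le; first exact: ltW.
  apply: ord3P; rewrite !mxE /= ?subrr ?normr0 ?(ltW x0) // ger0_norm ?subr_ge0 //.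
  by rewrite gerBl.
have [z1|z1] := leP 0 (v 0 2).
  exists 0; first by rewrite lexx ltW.
  apply: boundary_cone; rewrite !row3E ?lexx ?(ltW y0) //; last by left.
  by rewrite addr_ge0 ?gmean_ge0.
have [|x' x'i Hx'] := IVT (ltW x0) (@continuous_pospowM p^-1 (v 0 2) (pospow q^-1 (v 0 1)) _ p'0) (v := 0).
  rewrite pospow_le0 // mul0r addr0 ge_min le_max (ltW z1) /=.
  by move: z0; rewrite /gmean => z0; rewrite (ltW z0) orbT.
move: x'i; rewrite in_itv /= => /andP[x'0 x'1].
exists x'; first by rewrite x'0.
by apply: boundary_cone; rewrite /gmean !row3E ?Hx' ?(ltW y0) //; right; right.
Qed.

Lemma near_face_y (v : 'rV[R]_3) : K° v -> exists2 w, boundary K w & `|v - w| <= v 0 1.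
Proof.
rewrite interior_power_cone ?p_gt0 ?q_gt0 //= => -[x0 y0 z0].
have q'0 : 0 < q^-1 by rewrite invr_gt0 q_gt0.
suff [y' /andP[y'0 y'y] Hy] : exists2 y', 0 <= y' <= v 0 1 & boundary K (row3 (v 0 0) y' (v 0 2)).
  exists (row3 (v 0 0) y' (v 0 2)) => //.
  apply: rV_norm_le; first exact: ltW.
  apply: ord3P; rewrite !mxE /= ?subrr ?normr0 ?(ltW y0) // ger0_norm ?subr_ge0 //.
  by rewrite gerBl.
have [z1|z1] := leP 0 (v 0 2).
  exists 0; first by rewrite lexx ltW.
  apply: boundary_cone; rewrite !row3E ?lexx ?(ltW x0) //; last by right; left.
  by rewrite addr_ge0 ?gmean_ge0.
have [|y' y'i Hy'] := IVT (ltW y0) (@continuous_pospowM q^-1 (v 0 2) (pospow p^-1 (v 0 0)) _ q'0) (v := 0).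
  rewrite pospow_le0 // mul0r addr0 ge_min le_max (ltW z1) /=.
  by move: z0; rewrite /gmean mulrC => z0; rewrite (ltW z0) orbT.
move: y'i; rewrite in_itv /= => /andP[y'0 y'1].
exists y'; first by rewrite y'0.
rewrite mulrC in Hy'.
by apply: boundary_cone; rewrite /gmean !row3E ?Hy' ?(ltW x0) //; right; right.
Qed.

Lemma near_graph (v : 'rV[R]_3) : K° v ->
  exists2 w, boundary K w & `|v - w| <= v 0 2 + gmean p q v.
Proof.
rewrite interior_power_cone ?p_gt0 ?q_gt0 //= => -[x0 y0 z0].
have G : gmean p q (row3 (v 0 0) (v 0 1) (- gmean p q v)) = gmean p q v.
  by rewrite {1}/gmean !row3E.
exists (row3 (v 0 0) (v 0 1) (- gmean p q v)).
  by apply: boundary_cone; rewrite ?G !row3E ?addNr ?(ltW x0) ?(ltW y0) //; right; right.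
apply: rV_norm_le; first exact: ltW.
apply: ord3P; rewrite !mxE /= ?subrr ?normr0 ?(ltW z0) // opprK ger0_norm //.
exact: ltW.
Qed.

Lemma asymptotic : asymptotic_to_boundary (zero_level_set K F) K.
Proof.
split; first by move=> v [].
move=> e e0; pose d := e / 2.
have d0 : 0 < d by rewrite divr_gt0.
have [C [C0 C1 C2 C3]] := t_phi_far pp.
have dd : 0 < d * d by rewrite mulr_gt0.
(* The first summand rules out [s <= a] once x and y exceed [d], where all coordinates are at most
   [C / d^2]. The second serves the part with [t < 0]. *)
exists (C / (d * d) + C / (d * d * (d * d * d))) => v.
have Cd : 0 < C / (d * d) by rewrite divr_gt0.
have Cd2 : 0 < C / (d * d * (d * d * d)) by rewrite divr_gt0 ?mulr_gt0.
rewrite -image_X => -[u Uu <-{v}] Hv.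
have Kx := X_interior Uu.
have fin (r : R) : (exists2 w, boundary K w & `|X u - w| <= r) -> r <= d ->
    exists2 w, boundary K w & `|X u - w| < e.
  move=> [w bw Hw] rd; exists w => //; apply: le_lt_trans Hw _.
  by apply: le_lt_trans rd _; rewrite /d; lra.
have [xd|xd] := leP (X u 0 0) d; first exact: fin (near_face_x Kx) xd.
have [yd|yd] := leP (X u 0 1) d; first exact: fin (near_face_y Kx) yd.
apply: (fin _ (near_graph Kx)); rewrite gmean_X X2.
rewrite X0 in xd; rewrite X1 in yd.
have sx0 := sx_gt0 u; have sy0 := sy_gt0 u; have sr0 := sr_gt0 u.
have fE := expR_fE c fX u.
have gmax := gmean_le_max p_gt0 q_gt0 pq1 (v := X u).
rewrite gmean_X X0 X1 in gmax; have {}gmax := gmax (ltW sx0) (ltW sy0).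
have gmin := gmean_ge_min (v := X u).
rewrite gmean_X X0 X1 in gmin; have {}gmin := gmin (ltW sx0) (ltW sy0).
have rd : d <= sr c fX u.
  by apply: le_trans gmin; rewrite le_min (ltW xd) (ltW yd).
set x := sx c fX u in xd sx0 fE gmax gmin *; set y := sy c fX u in yd sy0 fE gmax gmin *.
set r := sr c fX u in rd sr0 fE gmax gmin *; set t := tX (u 0 0).
have X0' : X u 0 0 = x := X0 u.
have X1' : X u 0 1 = y := X1 u.
have X2' : X u 0 2 = r * t := X2 u.
have [sa|sa] := leP (sq b (u 0 0)) a.
  exfalso; have L1 := C2 _ Uu sa; have [t0 L2] := C3 _ Uu sa.
  rewrite -/(fX (u 0 0)) -fE in L1 L2; rewrite -/(tX (u 0 0)) -/t in t0 L2.
  have dxy : d * d <= x * y := ler_pM (ltW d0) (ltW d0) (ltW xd) (ltW yd).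
  have dyr : d * d <= y * r := ler_pM (ltW d0) (ltW d0) (ltW yd) rd.
  have dxr : d * d <= x * r := ler_pM (ltW d0) (ltW d0) (ltW xd) rd.
  have B1 : x <= C / (d * d).
    rewrite ler_pdivlMr //; apply: le_trans L1.
    have -> : x * y * r = x * (y * r) by ring.
    by rewrite ler_pM2l.
  have B2 : y <= C / (d * d).
    rewrite ler_pdivlMr //; apply: le_trans L1.
    have -> : x * y * r = y * (x * r) by ring.
    by rewrite ler_pM2l.
  have B3 : r * t <= C / (d * d).
    rewrite ler_pdivlMr //; apply: le_trans L2.
    have -> : t * (x * y * r) = r * t * (x * y) by ring.
    by rewrite ler_wpM2l // mulr_ge0 // ltW.
  move: Hv; apply/negP; rewrite -leNgt.
  apply: (@le_trans _ _ (C / (d * d))); last by rewrite lerDl ltW.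
  apply: rV_norm_le; first exact: ltW.
  apply: ord3P; rewrite ?X0' ?X1' ?X2' ger0_norm ?(ltW sx0) ?(ltW sy0) //.
  by rewrite mulr_ge0 // ltW.
have t1 : -1 < t by exact: t_xi_gtN1.
have t0 : t < 0.
  by rewrite /t /tX /t_xi /tS nmulr_rlt0 ?expR_gt0 // subr_lt0.
have L := C1 _ Uu sa; rewrite -/(fX (u 0 0)) -fE -/(tX (u 0 0)) -/t in L.
set N := Num.max x y in gmax.
have N0 : 0 < N by rewrite lt_max sx0.
have HN : `|X u| <= N.
  apply: rV_norm_le; first exact: ltW.
  apply: ord3P; rewrite ?X0' ?X1' ?X2'.
  - by rewrite gtr0_norm // le_max lexx.
  - by rewrite gtr0_norm // le_max lexx orbT.
  - rewrite ler0_norm; last by rewrite nmulr_lle0 // ltW.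
    apply: le_trans gmax; rewrite -mulrN -[X in _ <= X]mulr1 ler_pM2l //; lra.
have xyN : d * N <= x * y.
  rewrite /N; case: (leP x y) => xy; first by rewrite ler_pM2r // ltW.
  by rewrite mulrC ler_pM2l // ltW.
have NC : C / (d * d * (d * d * d)) <= N.
  apply: le_trans HN; apply: le_trans (ltW Hv); rewrite lerDr ltW //.
(* With D1 for the vertical distance, [D1^3 (x y)^2 = (1 + t)^3 (x y r)^2 r <= C N], while
   [x y >= d N]. Thus [D1 > d] would give [N < C / d^5], against [NC]. *)
rewrite leNgt; apply/negP => D.
set D1 := r * t + r in D.
have D1E : D1 = (1 + t) * r by rewrite /D1; ring.
have D10 : 0 <= D1 by exact: le_trans (ltW d0) (ltW D).
have D3 : d * d * d < D1 * D1 * D1.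
  have dd0 : 0 <= d * d := ltW dd.
  exact: ltr_pM dd0 (ltW d0) (ltr_pM (ltW d0) (ltW d0) D D) D.
have E1 : D1 * D1 * D1 * ((x * y) * (x * y)) <= C * N.
  have -> : D1 * D1 * D1 * ((x * y) * (x * y)) = (1 + t) ^+ 3 * (x * y * r) ^+ 2 * r.
    by rewrite D1E; ring.
  apply: ler_pM => //; last exact: ltW.
  by apply: mulr_ge0; [apply: exprn_ge0; lra|exact: sqr_ge0].
have xy0 : 0 < x * y by exact: mulr_gt0.
have E2 : d * d * d * ((x * y) * (x * y)) < D1 * D1 * D1 * ((x * y) * (x * y)).
  by rewrite ltr_pM2r // mulr_gt0.
have dN0 : 0 < d * N by exact: mulr_gt0.
have ddd : 0 < d * d * d by exact: mulr_gt0.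
have E3 : d * d * d * ((d * N) * (d * N)) <= d * d * d * ((x * y) * (x * y)).
  rewrite ler_pM2l //; exact: (ler_pM (ltW dN0) (ltW dN0) xyN xyN).
have E4 : C <= N * (d * d * (d * d * d)).
  by move: NC; rewrite ler_pdivrMr //; exact: mulr_gt0.
have : C * N <= N * (d * d * (d * d * d)) * N by rewrite ler_pM2r.
lra.
Qed.

(** * Completeness of the affine metric *)

Lemma ge0_le_integral_nonmeasurable d (T : measurableType d)
    (mu : {measure set T -> \bar R}) (D : set T) (f1 f2 : T -> \bar R) :
  (forall x, D x -> (0 <= f1 x)%E) -> (forall x, D x -> (f1 x <= f2 x)%E) ->
  (\int[mu]_(x in D) f1 x <= \int[mu]_(x in D) f2 x)%E.
Proof.
move=> f10 f12.
have f20 x : D x -> (0 <= f2 x)%E by move=> Dx; exact: le_trans (f10 x Dx) (f12 x Dx).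
(* The integral of a nonnegative function is a supremum over simple functions below it, so it is
   monotone without measurability; the speed of a curve thus needs no measurability proof. *)
rewrite !ge0_integralE //; apply: le_ereal_sup => _ [r /= Hr <-].
exists r => // x; apply: le_trans (Hr x) _.
by rewrite /patch; case: ifPn => //; rewrite inE => /f12.
Qed.

(** By the fundamental theorem of calculus the increment is the integral of [dphi], whose absolute
    value is dominated by [s]. *)
Lemma variation_le (phi dphi s : R -> R) :
  (forall t : R, 0 <= t <= 1 -> is_derive t 1 phi (dphi t)) ->
  {within `[0%R, 1%R], continuous dphi} ->
  (forall t : R, 0 <= t <= 1 -> `|dphi t| <= s t) ->
  (`|phi 1 - phi 0|%:E <= \int[@lebesgue_measure R]_(t in `[0%R, 1%R]) (s t)%:E)%E.
Proof.
move=> D cd ds.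
have FTC : (\int[@lebesgue_measure R]_(t in `[0%R, 1%R]) (dphi t)%:E = (phi 1)%:E - (phi 0)%:E)%E.
  apply: continuous_FTC2 => //.
    split=> [t| |].
    - by rewrite in_itv /= => t01; case: (@D t) => //; lra.
    - apply: cvg_at_right_filter; apply: is_derive_continuous (D 0 _); lra.
    - apply: cvg_at_left_filter; apply: is_derive_continuous (D 1 _); lra.
  by move=> t; rewrite in_itv /= => t01; rewrite derive1E; case: (@D t) => //; lra.
have idphi := continuous_compact_integrable (@segment_compact R 0 1) cd.
have -> : (`|phi 1 - phi 0|%:E =
    `| \int[@lebesgue_measure R]_(t in `[0%R, 1%R]) (dphi t)%:E |)%E by rewrite FTC.
apply: le_trans (le_abse_integral _ _ (measurable_int _ idphi)) _ => //.
apply: ge0_le_integral_nonmeasurable => [t _|t]; first exact: abse_ge0.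
by rewrite /= in_itv /= => t01; rewrite lee_fin; exact: ds.
Qed.

Definition metric_scale : R := Num.sqrt (60 * nu_scale)^-1.

Lemma metric_scale_gt0 : 0 < metric_scale.
Proof. by rewrite sqrtr_gt0 invr_gt0 mulr_gt0 ?nu_scale_gt0. Qed.

Lemma metric_scaleE : metric_scale ^+ 2 = (60 * nu_scale)^-1.
Proof. by rewrite sqr_sqrtr // invr_ge0 mulr_ge0 // ltW ?nu_scale_gt0. Qed.

Lemma le_sqrt_metricX u v y : U u ->
  y ^+ 2 <= (mX (u 0 0) * tX1 (u 0 0) * v 0 0) ^+ 2 + v 0 1 ^+ 2 ->
  `|metric_scale * y| <= Num.sqrt (qform (metricX u) v).
Proof.
move=> Uu Hy; rewrite -sqrtr_sqr ler_wsqrtr // exprMn metric_scaleE mulrC.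
apply: le_trans (metricX_lb v Uu).
by rewrite ler_pM2r // invr_gt0 mulr_gt0 ?nu_scale_gt0.
Qed.

Lemma C1_curve_is_derive (gm : R -> 'rV[R]_2) x y (t : R) : C1_curve U gm x y ->
  forall i, is_derive t 1 (fun t => gm t 0 i) (derive1 gm t 0 i).
Proof.
move=> [D _ _ _ _] i.
have : is_derive t 1 gm (derive1 gm t) by rewrite derive1E; exact: derivableP.
by move=> /is_derive_rowP; apply.
Qed.

Lemma curve_length_mu (gm : R -> 'rV[R]_2) x y : C1_curve U gm x y ->
  ((metric_scale * `|y 0 1 - x 0 1|)%:E <= curve_length metricX gm)%E.
Proof.
move=> Cg; have [D cD Ug g0 g1] := Cg; have k0 := metric_scale_gt0.
have := @variation_le (fun t => metric_scale * gm t 0 1)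
  (fun t => metric_scale * derive1 gm t 0 1)
  (fun t => Num.sqrt (qform (metricX (gm t)) (derive1 gm t))).
rewrite g0 g1 -mulrBr normrM (gtr0_norm k0); apply.
- move=> t _; have Dg := C1_curve_is_derive t Cg 1.
  by der_eq; rewrite mulr0 addr0.
- apply: continuous_subspaceT => t.
  apply: (@continuousM _ _ (fun=> metric_scale) (fun t => derive1 gm t 0 1)).
    exact: cst_continuous.
  apply: (@continuous_comp _ _ _ (derive1 gm) (fun v : 'rV[R]_2 => v 0 1)).
    exact: cD.
  exact: coord_continuous.
- move=> t t01; apply: le_sqrt_metricX; first exact: Ug.
  by rewrite lerDr sqr_ge0.
Qed.

Lemma curve_length_phi (gm : R -> 'rV[R]_2) x y : C1_curve U gm x y ->
  ((metric_scale * `|fX (y 0 0) - fX (x 0 0)|)%:E <= curve_length metricX gm)%E.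
Proof.
move=> Cg; have [D cD Ug g0 g1] := Cg; have k0 := metric_scale_gt0.
have := @variation_le (fun t => metric_scale * fX (gm t 0 0))
  (fun t => metric_scale * (mX (gm t 0 0) * tX1 (gm t 0 0) * derive1 gm t 0 0))
  (fun t => Num.sqrt (qform (metricX (gm t)) (derive1 gm t))).
rewrite g0 g1 -mulrBr normrM (gtr0_norm k0); apply.
- move=> t t01; have Dg := C1_curve_is_derive t Cg 0.
  have Df := isd_comp (pf_f pX (Ug _ t01)) Dg.
  by der_eq; rewrite mulr0 addr0.
- apply: continuous_in_subspaceT => t; rewrite inE /= in_itv /= => t01.
  have Dg := is_derive_continuous (C1_curve_is_derive t Cg 0).
  have c1 := is_derive_continuous (pf_m pX (Ug _ t01)).
  have c2 := is_derive_continuous (pf_t1 pX (Ug _ t01)).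
  apply: (@continuousM _ _ (fun=> metric_scale)
    (fun t => mX (gm t 0 0) * tX1 (gm t 0 0) * derive1 gm t 0 0)).
    exact: cst_continuous.
  apply: (@continuousM _ _ (fun t => mX (gm t 0 0) * tX1 (gm t 0 0)) (fun t => derive1 gm t 0 0)).
    apply: (@continuousM _ _ (fun t => mX (gm t 0 0)) (fun t => tX1 (gm t 0 0))).
      exact: (@continuous_comp _ _ _ (fun t => gm t 0 0) mX).
    exact: (@continuous_comp _ _ _ (fun t => gm t 0 0) tX1).
  apply: (@continuous_comp _ _ _ (derive1 gm) (fun v : 'rV[R]_2 => v 0 0)).
    exact: cD.
  exact: coord_continuous.
- move=> t t01; apply: le_sqrt_metricX; first exact: Ug.
  by rewrite lerDl sqr_ge0.
Qed.

Lemma real_cauchy_cvg (u : nat -> R) :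
  (forall e : R, 0 < e -> exists N : nat, forall k m : nat,
     (N <= k)%N -> (N <= m)%N -> `|u m - u k| < e) -> exists l : R, u @ \oo --> l.
Proof.
move=> H; suff : cvg (u @ \oo) by move=> ?; exists (lim (u @ \oo)).
apply: cauchy_cvg; apply: cauchy_exP => e e0.
have [N HN] := H e e0; exists (u N).
exists N => // m /= Nm; rewrite -ball_normE /ball_ /=.
exact: HN.
Qed.

(** Length bounds the variation of both phi and [mu], so these are Cauchy in R along the sequence.
    Since phi is onto, the limit of its values is attained at some [xi > 0], so the sequence does
    not escape through [xi = 0] or infinity; monotonicity of phi gives convergence of [xi]. *)
Lemma complete_metricX : complete_metric U metricX.
Proof.
move=> s Us Hs; have k0 := metric_scale_gt0.
have cau (f : 'rV[R]_2 -> R) :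
    (forall gm x y, C1_curve U gm x y ->
      ((metric_scale * `|f y - f x|)%:E <= curve_length metricX gm)%E) ->
    exists l : R, (fun n => f (s n)) @ \oo --> l.
  move=> Hf; apply: real_cauchy_cvg => e e0.
  have [N HN] := Hs (metric_scale * e) (mulr_gt0 k0 e0).
  exists N => k m Nk Nm; have [gm [Cg Lg]] := HN k m Nk Nm.
  by have := le_lt_trans (Hf _ _ _ Cg) Lg; rewrite lte_fin ltr_pM2l.
have [l Hl] := cau (fun u => fX (u 0 0)) curve_length_phi.
have [mu Hmu] := cau (fun u => u 0 1) curve_length_mu.
have [xi xi0 Exi] := phi_xi_onto pp l.
exists (\row_(i < 2) [:: xi; mu]`_i); first by rewrite /half_plane /= mxE.
apply/cvgrPdist_lt => e e0.
(* The bound by [xi] keeps [xi - d / 2] positive, where phi is known to be increasing. *)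
pose d := Num.min e xi.
have d0 : 0 < d by rewrite lt_min e0.
have de : d <= e by rewrite ge_min lexx.
have dx : d <= xi by rewrite ge_min lexx orbT.
have x10 : 0 < xi - d / 2 by lra.
have x20 : 0 < xi + d / 2 by lra.
have l1 : fX (xi - d / 2) < l by rewrite -Exi; apply: phi_xi_incr => //; lra.
have l2 : l < fX (xi + d / 2) by rewrite -Exi; apply: phi_xi_incr => //; lra.
near=> n.
have E1 : fX (xi - d / 2) < fX (s n 0 0) by near: n; exact: cvgr_gt Hl _ l1.
have E2 : fX (s n 0 0) < fX (xi + d / 2) by near: n; exact: cvgr_lt Hl _ l2.
have E3 : `|mu - s n 0 1| < e by near: n; exact: cvgr_dist_lt.
have F1 := fX_le_inv x10 (Us n) (ltW E1).
have F2 := fX_le_inv (Us n) x20 (ltW E2).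
apply: rV_norm_lt => //; case=> -[|[|//]] Hi; rewrite !mxE /=.
  rewrite (_ : Ordinal Hi = 0); last by apply/val_inj.
  apply: (@le_lt_trans _ _ (d / 2)); last by lra.
  by rewrite ler_norml; apply/andP; split; lra.
by rewrite (_ : Ordinal Hi = 1) //; apply/val_inj.
Unshelve. all: by end_near. Qed.

Lemma sphere_Y : complete_hyperbolic_affine_sphere U Y 0.
Proof.
exists nuX, metricX; split.
- exact: blaschke_Y.
- move=> u Uu; exists (- nu_scale^-1); rewrite YX // /nuX scalerA mulNr mulVf.
    by rewrite scaleN1r subrr.
  by rewrite gt_eqF // nu_scale_gt0.
- exact: hull_boundary.
- exact: separates_Y.
- exact: complete_metricX.
Qed.

End PowerSurface.

(** * The parametrization *)

Section SphereMap.
Context {R : realType}.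
Variables p q : R.
Hypotheses (p_ge2 : 2 <= p) (pq_conj : p^-1 + q^-1 = 1).

Let g := Num.sqrt (p - 1).
Let h := Num.sqrt (q - 1).
Let a := Num.sqrt (p + q).
Let b := Num.sqrt (p + q - 1).
Let c := (1 + q^-1) / 3.

Lemma conj_p_gt0 : 0 < p. Proof. exact: lt_le_trans p_ge2. Qed.

Lemma conj_qE : q = p / (p - 1).
Proof.
have p2 := p_ge2; have p0 := conj_p_gt0.
have -> : q = (1 - p^-1)^-1 by rewrite -pq_conj addrAC subrr add0r invrK.
by field; rewrite !gt_eqF //; lra.
Qed.

Lemma conj_q1 : (p - 1) * (q - 1) = 1.
Proof. have p2 := p_ge2; rewrite conj_qE; field; by rewrite gt_eqF //; lra. Qed.

Lemma conj_q_gt1 : 1 < q.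
Proof. by have := conj_q1; have := p_ge2; nra. Qed.

(** Conjugacy means [(p - 1)(q - 1) = 1], that is, [g h = 1]; then [(g + h)^2 = p + q], whence
    [a = g + h]. *)
Lemma conj_profile : [/\ profile_params g h a b, p^-1 = h / a & q^-1 = g / a].
Proof.
have p2 := p_ge2; have p0 := conj_p_gt0; have q1 := conj_q_gt1; have pq := conj_q1.
have g0 : 0 < g by rewrite sqrtr_gt0; lra.
have h0 : 0 < h by rewrite sqrtr_gt0; lra.
have a0 : 0 < a by rewrite sqrtr_gt0; lra.
have b0 : 0 < b by rewrite sqrtr_gt0; lra.
have g2 : g ^+ 2 = p - 1 by rewrite sqr_sqrtr; lra.
have h2 : h ^+ 2 = q - 1 by rewrite sqr_sqrtr; lra.
have a2 : a ^+ 2 = p + q by rewrite sqr_sqrtr; lra.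
have b2 : b ^+ 2 = p + q - 1 by rewrite sqr_sqrtr; lra.
have gh : g * h = 1 by rewrite -sqrtrM ?pq ?sqrtr1 //; lra.
have agh : a = g + h.
  apply/eqP; rewrite -(@eqrXn2 _ 2) //; [|lra|lra].
  by apply/eqP; rewrite sqrrD gh a2 g2 h2; lra.
have pE : p = g * a by rewrite agh mulrDr gh -expr2 g2; lra.
have qE : q = h * a by rewrite agh mulrDr mulrC gh -expr2 h2; lra.
have hE : h = g^-1 by apply: (mulfI (lt0r_neq0 g0)); rewrite gh mulfV ?gt_eqF.
split.
- by split=> //; rewrite b2 a2.
- by rewrite pE invfM hE.
- by rewrite qE invfM hE invrK.
Qed.

Lemma sphere_coefE :
  [/\ (q + 1) / (3 * q) = c, (p + 1) / (3 * p) = 1 - c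
    & (p - q) / (3 * (p + q)) = 2 * c - 1].
Proof.
have p2 := p_ge2; have p0 := conj_p_gt0; have q1 := conj_q_gt1.
split.
- by rewrite /c; field; rewrite gt_eqF //; lra.
- rewrite /c.
  have -> : q^-1 = 1 - p^-1 by rewrite -pq_conj; ring.
  by field; rewrite gt_eqF //; lra.
- rewrite /c conj_qE; field.
  by rewrite !gt_eqF //; nra.
Qed.

Lemma sqrt_xiE x : Num.sqrt (x + p + q - 1) = sq b x.
Proof.
have p2 := p_ge2; have p0 := conj_p_gt0; have q1 := conj_q_gt1.
by rewrite /sq sqr_sqrtr; [congr Num.sqrt; ring|lra].
Qed.

Lemma t_funE x : 0 < x -> t_fun p q x = t_xi g h a b x.
Proof.
move=> x0; have [pp pE qE] := conj_profile.
rewrite /t_fun sqrt_xiE -/a -/b -/g -/h /t_xi /tS.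
have bs := sq_gt pp x0; have b0 := pp_b pp; have g0 := pp_g pp.
have h0 := h_gt0 pp; have a2 := a_ge2 pp.
have sE := sqE b x0; set s := sq b x in bs sE *.
have -> : (1 - x) / (s + a) = a - s.
  have -> : 1 - x = (a - s) * (s + a) by have := pp_b2 pp; lra.
  by rewrite mulfK // gt_eqF //; lra.
have sb : 0 < s - b by lra.
have sb' : 0 < s + b by lra.
have sh : 0 < s + h by lra.
have sg : 0 < s + g by lra.
have d0 : 0 < (s + b) / (s - b) by rewrite divr_gt0.
rewrite /powR (gt_eqF d0) (gt_eqF sh) (gt_eqF sg) ln_div ?posrE //.
rewrite -!mulrA -!expRD; congr (_ * expR _).
by rewrite /psi -pE -qE; ring.
Qed.

(** The zero of [1 - xi] at [xi = 1] is cancelled by the factor [a - s] of t. The quotient agrees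
    off 1 with the continuous function [- m_xi], which therefore also supplies the limit. *)
Lemma ratio_funE x : 0 < x -> ratio_fun p q x = - m_xi g h a b x.
Proof.
have [pp pE qE] := conj_profile; move=> x0.
have E y : 0 < y -> y != 1 -> (1 - y) / t_fun p q y = - m_xi g h a b y.
  move=> y0 y1; rewrite t_funE // /m_xi /mS /t_xi /tS.
  have bs := sq_gt pp y0; have b0 := pp_b pp; have a2 := a_ge2 pp.
  have sE := sqE b y0; set s := sq b y in bs sE *.
  have y1E : 1 - y = (a - s) * (s + a) by have := pp_b2 pp; lra.
  have as0 : a - s != 0.
    by apply: contra_neq y1 => as0; move: y1E; rewrite as0 mul0r; lra.
  by rewrite y1E expRN invfM invrK mulrACA mulfV // mul1r; ring.
rewrite /ratio_fun; case: eqVneq => [->|x1]; last exact: E.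
apply/cvg_lim => //.
apply: (@cvg_trans _ ((fun y => - m_xi g h a b y) @ (1 : R)^')).
  apply: near_eq_cvg; near=> y; rewrite E //.
    near: y; apply: nbhs_dnbhs; exact: lt_nbhsr.
  by near: y; exact: nbhs_dnbhs_neq.
apply: cvg_within_filter; apply: cvgN.
have [D _] := is_derive_m_xi pp (@ltr01 R).
exact/differentiable_continuous/derivable1_diffP.
Unshelve. all: by end_near. Qed.

Lemma phi_funE x : 0 < x -> phi_fun p q x = phi_xi g h a b x.
Proof.
move=> x0; have [pp pE qE] := conj_profile.
have p2 := p_ge2; have p0 := conj_p_gt0; have q1 := conj_q_gt1.
rewrite /phi_fun ratio_funE // /m_xi /mS /phi_xi /fS.
have bs := sq_gt pp x0; have b0 := pp_b pp; have a2 := a_ge2 pp.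
have aE : p + q = a ^+ 2 by rewrite sqr_sqrtr; lra.
have a0 : 0 < a by lra.
have sE := sqE b x0; have sx : sq b x = Num.sqrt (x + b ^+ 2) by [].
have s0 : 0 < sq b x by lra.
have P0 := polP_gt0 pp s0.
have -> : Num.sqrt (1 + (x - 1) / (p + q)) = sq b x / a.
  apply/eqP; rewrite -(@eqrXn2 _ 2) ?sqrtr_ge0 ?divr_ge0 ?ltW //.
  have E : 1 + (x - 1) / (p + q) = (sq b x / a) ^+ 2.
    by rewrite expr_div_n sE (pp_b2 pp) aE; field; rewrite gt_eqF.
  by rewrite E sqr_sqrtr ?sqr_ge0.
set s := sq b x in s0 sE bs P0 *.
have d0 : 0 < 1 + x * (s / a) by rewrite addr_gt0 ?mulr_gt0 ?invr_gt0.
have sa0 : 0 < s + a by lra.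
have xE : x = s ^+ 2 - a ^+ 2 + 1 by have := pp_b2 pp; lra.
(* Polynomial identity after the substitution [x = s^2 - a^2 + 1]; the factor [s + a] in the
   denominator is cancelled by the one in [- m_xi]. *)
have -> : (1 + x + x ^+ 2 / (p + q)) / (1 + x * (s / a)) = polP a s / a / (s + a).
  apply: (canLR (mulfK (lt0r_neq0 d0))).
  by rewrite aE /polP xE; field; rewrite !gt_eqF.
rewrite -mulNr opprK [ln (_ * expR _)]lnM ?posrE ?expR_gt0 // expRK.
by rewrite !ln_div ?posrE ?divr_gt0 //; ring.
Qed.

Lemma sphere_mapE u : half_plane u -> sphere_map p q u = X g h a b c u.
Proof.
move=> u0; have [c1 c2 c3] := sphere_coefE.
rewrite /sphere_map phi_funE // c1 c2 t_funE //.
have -> : u 0 1 * (p - q) / (3 * (p + q)) = - ((1 - 2 * c) * u 0 1).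
  by rewrite -mulrA c3; ring.
rewrite opprK /X /surf /sx /sy /sr.
apply: row3P; rewrite row3E !mxE /= ?expRD //.
by rewrite mulrA.
Qed.

End SphereMap.

Theorem mainTheorem6 (R : realType) (p q : R) (F : 'rV[R]_3 -> R)
    (p_ge2 : 2 <= p) (pq_conj : p^-1 + q^-1 = 1)
    (F_pot : canonical_potential (power_cone p q) F) :
  [/\ regular_cone (power_cone p q),
      hypersurface_immersion (@half_plane R) (sphere_map p q),
      sphere_map p q @` (@half_plane R) = zero_level_set (power_cone p q) F,
      complete_hyperbolic_affine_sphere
        (@half_plane R) (sphere_map p q) 0
    & asymptotic_to_boundary
        (zero_level_set (power_cone p q) F) (power_cone p q)].
Proof.
have [pp pE qE] := conj_profile p_ge2 pq_conj.
have YX := sphere_mapE p_ge2 pq_conj.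
have cE : 3 * ((1 + q^-1) / 3) - 1 = q^-1 :> R by lra.
have p2 := p_ge2; have p0 := conj_p_gt0 p_ge2.
have q0 : 0 < q := lt_trans ltr01 (conj_q_gt1 p_ge2 pq_conj).
split.
- exact: regular_power_cone.
- exact: (immersion_Y pp YX).
- exact: (image_Y pp cE pE qE F_pot YX).
- exact: (sphere_Y pp cE pE qE F_pot YX).
- exact: (asymptotic pp cE pE qE F_pot).
Qed.
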